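(* Let $\Lambda$ be a $k$-graph and let $\alpha:\mathbf{T}^k\to\operatorname{Aut} C^*(\Lambda)$ be the gauge action. Let $B$ be a $C^*$-algebra, let $\pi:C^*(\Lambda)\to B$ be a $*$-homomorphism, and let $\beta:\mathbf{T}^k\to\operatorname{Aut}(B)$ be an action such that $\pi\circ\alpha_t=\beta_t\circ\pi$ for all $t\in\mathbf{T}^k$. Then $\pi$ is faithful (injective) if and only if $\pi(p_v)\neq 0$ for all $v\in\Lambda^0$.
   Context: Let $\mathbf{N}=\{0,1,2,\dots\}$, $k\ge 1$, and order $\mathbf{N}^k$ coordinatewise. A $k$-graph $(\Lambda,d)$ is a countable small category $\Lambda$ (range map $r$, source map $s$) with a functor $d:\Lambda\to\mathbf{N}^k$ (with $\mathbf{N}^k$ viewed as a one-object category) satisfying the factorisation property: if $d(\lambda)=m+n$ there are unique $\mu,\nu\in\Lambda$ with $\lambda=\mu\nu$, $d(\mu)=m$, $d(\nu)=n$. $\Lambda$ is identified with its set of morphisms; $\lambda\mu$ is defined iff $s(\lambda)=r(\mu)$. Put $\Lambda^n=d^{-1}(n)$; $\Lambda^0$ is identified with the set of objects; $\Lambda^n(v)=\{\lambda\in\Lambda^n: r(\lambda)=v\}$. Standing assumption: $0<\#\Lambda^n(v)<\infty$ for all $v\in\Lambda^0$, $n\in\mathbf{N}^k$ (row finite, no sources). $C^*(\Lambda)$ is the universal $C^*$-algebra generated by partial isometries $\{s_\lambda:\lambda\in\Lambda\}$ satisfying: (i) $\{s_v: v\in\Lambda^0\}$ are mutually orthogonal projections;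 (ii) $s_{\lambda\mu}=s_\lambda s_\mu$ whenever $s(\lambda)=r(\mu)$; (iii) $s_\lambda^*s_\lambda=s_{s(\lambda)}$; (iv) $s_v=\sum_{\lambda\in\Lambda^n(v)}s_\lambda s_\lambda^*$ for all $v\in\Lambda^0$, $n\in\mathbf{N}^k$. Write $p_\lambda=s_\lambda s_\lambda^*$, so $p_v=s_v$. The gauge action is the action of $\mathbf{T}^k$ on $C^*(\Lambda)$ determined by $\alpha_t(s_\lambda)=t^{d(\lambda)}s_\lambda$, where $t^m=t_1^{m_1}\cdots t_k^{m_k}$. Actions of topological groups on $C^*$-algebras are point-norm continuous. *)

(* Defs.v *)
From HB Require Import structures.
From mathcomp Require Import all_boot all_order all_algebra.
From mathcomp Require Import complex.
From mathcomp Require Import all_classical all_reals all_analysis.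

Set Implicit Arguments.
Unset Strict Implicit.
Unset Printing Implicit Defensive.

Import Order.TTheory GRing.Theory Num.Theory numFieldNormedType.Exports.

Local Open Scope classical_set_scope.
Local Open Scope ring_scope.
Local Open Scope complex_scope.

(* C*-algebras are not assumed unital, so the product cannot be inherited from
   the (unital) rings of MathComp.  The norm takes its values in the
   nonnegative reals of R[i], as for every normedModType over R[i]. *)
HB.mixin Record CompleteNormedModule_isCStarAlgebra (R : realType) A
    of CompleteNormedModule R[i] A := {
  cmul : A -> A -> A ;
  cadj : A -> A ;
  cmulA : associative cmul ;
  cmul_linear_l : forall b, linear (fun a => cmul a b) ;
  cmul_linear_r : forall a, linear (cmul a) ;
  cadjK : involutive cadj ;
  cadjD : {morph cadj : a b / a + b} ;
  cadjZ : forall (z : R[i]) (a : A), cadj (z *: a) = z^* *: cadj a ;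
  cadjM : forall a b, cadj (cmul a b) = cmul (cadj b) (cadj a) ;
  cnormM : forall a b, `|cmul a b| <= `|a| * `|b| ;
  cstar_identity : forall a, `|cmul (cadj a) a| = `|a| ^+ 2
}.

#[short(type="cstarAlgType")]
HB.structure Definition CStarAlgebra (R : realType) :=
  {A of CompleteNormedModule_isCStarAlgebra R A & CompleteNormedModule R[i] A}.

Infix "**" := cmul (at level 40, left associativity) : ring_scope.
Notation "a ^#*" := (cadj a) (at level 2, format "a ^#*") : ring_scope.

Definition star_hom (R : realType) (A B : cstarAlgType R) (f : A -> B) : Prop :=
  [/\ linear f, {morph f : a b / a ** b} & {morph f : a / a^#*}].

Definition cstar_subalgebra (R : realType) (A : cstarAlgType R) (S : set A) :
    Prop :=
  [/\ closed S /\ S 0,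
      (forall a b, S a -> S b -> S (a + b)),
      (forall (z : R[i]) a, S a -> S (z *: a)),
      (forall a b, S a -> S b -> S (a ** b)) &
      (forall a, S a -> S a^#*)].

Definition partial_isometry (R : realType) (A : cstarAlgType R) (a : A) : Prop :=
  a ** a^#* ** a = a.

Definition projection (R : realType) (A : cstarAlgType R) (p : A) : Prop :=
  p ** p = p /\ p^#* = p.

Definition torus_set (R : realType) (k : nat) : set 'rV[R[i]^o]_k :=
  [set t | forall j, `|t ord0 j| = 1].

Arguments torus_set R k : clear implicits.

(* [set_type] carries the subspace topology. *)
Definition torus (R : realType) (k : nat) : Type := set_type (torus_set R k).

HB.instance Definition _ (R : realType) (k : nat) :=
  Topological.copy (torus R k) (set_type (torus_set R k)).

Section TorusGroup.
Variables (R : realType) (k : nat).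
Implicit Types t u : torus R k.

Lemma torus_mul_subproof t u :
  (\row_j (\val t ord0 j * \val u ord0 j)) \in torus_set R k.
Proof.
apply/mem_set => j; rewrite mxE normrM.
by rewrite (set_mem (valP t)) (set_mem (valP u)) mulr1.
Qed.

Lemma torus_one_subproof : (\row_j 1) \in torus_set R k.
Proof. by apply/mem_set => j; rewrite mxE normr1. Qed.

Definition torus_mul t u : torus R k := SigSub (torus_mul_subproof t u).
Definition torus_one : torus R k := SigSub torus_one_subproof.

End TorusGroup.

Arguments torus_one R k : clear implicits.

(* Each [tact t] is automatically bijective, with inverse [tact t^-1]. *)
Record torus_action (R : realType) (k : nat) (A : cstarAlgType R) := TorusAction {
  tact :> torus R k -> A -> A ;
  tact_star_hom : forall t, star_hom (tact t) ;
  tact_one : forall a, tact (torus_one R k) a = a ;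
  tact_mul : forall t u a, tact (torus_mul t u) a = tact t (tact u a) ;
  tact_continuous : forall a, continuous (fun t => tact t a)
}.

Definition torus_pow (R : realType) (k : nat) (t : torus R k)
    (m : {ffun 'I_k -> nat}) : R[i] :=
  \prod_(j < k) (\val t ord0 j) ^+ m j.

(* Composition is a total function, but [kcomp l m] is meaningful only when
   [src l = rng m]; all axioms are restricted to that case. *)
Record kgraph (k : nat) := KGraph {
  ob : countType ;
  mor : countType ;
  rng : mor -> ob ;
  src : mor -> ob ;
  idm : ob -> mor ;
  kcomp : mor -> mor -> mor ;
  rng_idm : forall v, rng (idm v) = v ;
  src_idm : forall v, src (idm v) = v ;
  rng_kcomp : forall l m, src l = rng m -> rng (kcomp l m) = rng l ;
  src_kcomp : forall l m, src l = rng m -> src (kcomp l m) = src m ;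
  kcomp_idl : forall l, kcomp (idm (rng l)) l = l ;
  kcomp_idr : forall l, kcomp l (idm (src l)) = l ;
  kcompA : forall l m n, src l = rng m -> src m = rng n ->
    kcomp l (kcomp m n) = kcomp (kcomp l m) n ;
  deg : mor -> {ffun 'I_k -> nat} ;
  deg_idm : forall v, deg (idm v) = 0 ;
  deg_kcomp : forall l m, src l = rng m -> deg (kcomp l m) = deg l + deg m ;
  factorisation : forall l (m n : {ffun 'I_k -> nat}), deg l = m + n ->
    exists! p : mor * mor,
      [/\ src p.1 = rng p.2, l = kcomp p.1 p.2, deg p.1 = m & deg p.2 = n]
}.

Arguments idm {k} _.

(* The morphisms of degree 0 are exactly the identities, so that quantifying
   over the objects is quantifying over d^{-1}(0). *)
Lemma deg_eq0 (k : nat) (L : kgraph k) (l : mor L) :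
  deg l = 0 <-> exists v, l = idm L v.
Proof.
split=> [l0|[v ->]]; last exact: deg_idm.
have e : deg l = (0 : {ffun 'I_k -> nat}) + 0 by rewrite l0 addr0.
have [p [_ p_uniq]] := factorisation e.
have p1 : p = (idm L (rng l), l).
  by apply: p_uniq; rewrite /= src_idm kcomp_idl deg_idm.
have p2 : p = (l, idm L (src l)).
  by apply: p_uniq; rewrite /= rng_idm kcomp_idr deg_idm.
by exists (rng l); move: p1; rewrite p2 => -[].
Qed.

(* Lambda^n(v) *)
Definition paths (k : nat) (L : kgraph k) (n : {ffun 'I_k -> nat}) (v : ob L) :
    set (mor L) :=
  [set l | deg l = n /\ rng l = v].

Definition row_finite_no_sources (k : nat) (L : kgraph k) : Prop :=
  forall (n : {ffun 'I_k -> nat}) (v : ob L),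
    finite_set (paths n v) /\ paths n v !=set0.

Record ck_family (R : realType) (k : nat) (L : kgraph k) (A : cstarAlgType R)
    (s : mor L -> A) : Prop := CKFamily {
  ck_isometry : forall l, partial_isometry (s l) ;
  ck_proj : forall v, projection (s (idm L v)) ;
  ck_orth : forall v w, v <> w -> s (idm L v) ** s (idm L w) = 0 ;
  ck_comp : forall l m, src l = rng m -> s (kcomp l m) = s l ** s m ;
  ck_source : forall l, (s l)^#* ** s l = s (idm L (src l)) ;
  ck_range : forall v n,
    s (idm L v) = \sum_(l \in paths n v) (s l ** (s l)^#*)
}.

(* [A] with the family [s] is the universal C*-algebra C*(L); this determines
   the pair up to unique isomorphism. *)
Record universal_ck (R : realType) (k : nat) (L : kgraph k) (A : cstarAlgType R)
    (s : mor L -> A) : Prop := UniversalCK {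
  univ_family : ck_family s ;
  univ_generated : forall S : set A, cstar_subalgebra S ->
    (forall l, S (s l)) -> S = setT ;
  univ_map : forall (B : cstarAlgType R) (t : mor L -> B), ck_family t ->
    exists f : A -> B, star_hom f /\ forall l, f (s l) = t l
}.

Definition gauge_action (R : realType) (k : nat) (L : kgraph k)
    (A : cstarAlgType R) (s : mor L -> A) (alpha : torus_action k A) : Prop :=
  forall t l, alpha t (s l) = torus_pow t (deg l) *: s l.

(* Main.v *)
Require Import Defs.
From HB Require Import structures.
From mathcomp Require Import all_boot all_order all_algebra.
From mathcomp Require Import complex finmap.
From mathcomp Require Import all_classical all_reals all_analysis.
From mathcomp Require Import ring lra.
Require Import Defs.

(** If [pi] is injective, then [pi] does not kill the vertex projections because
    they are nonzero in the universal algebra.  To see the latter one needs some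
    Cuntz-Krieger family with a nonzero vertex projection: the paths of the graph
    act by partial bijections on the infinite paths, hence by partial isometries
    on the square-summable functions of infinite paths, and every vertex is the
    range of an infinite path ([ck_family_nonzero]).  The bounded operators on a
    Hilbert space are made into a C*-algebra for this purpose.

    Conversely, suppose that [pi] does not kill the vertex projections, and let
    [pi a = 0].  The paths [l] of a fixed degree give matrix units [s_l s_m^*],
    whose images under [pi] are nonzero.  A homomorphism between C*-algebras is
    contractive ([star_hom_on_contractive]); applied to the inverse of [pi] on
    the span of finitely many matrix units, this shows that [pi] is isometric
    there ([mu_comb_rnorm_le]).  By the C*-identity [pi] is isometric on all
    elements of the span that are homogeneous for the gauge action
    ([ck_span_isometric_pq]).  As [pi] intertwines the two actions, it commutes
    with taking Fourier coefficients, so the Fourier coefficients of [a], which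
    are limits of homogeneous elements, vanish.  By Fejer's theorem [a = 0]
    ([fejer_vanish]).  Averages over finite subgroups of the torus take the place
    of the Haar integral.

    Contractivity rests on the following argument.  If [b] is self-adjoint of
    norm less than 1, then [1 - b^2] has a self-adjoint square root [1 - d] with
    [d] in the algebra.  Formally [(1 - d) + i b] is unitary, and so is its image
    under a homomorphism; hence the image of [b] has norm at most 1.

    The orthogonality of the range projections of distinct paths of the same
    degree is not among the defining relations.  It follows because projections
    whose sum is a projection are orthogonal ([projections_orthogonal]). *)

Set Implicit Arguments.
Unset Strict Implicit.
Unset Printing Implicit Defensive.

Import Order.TTheory GRing.Theory Num.Theory numFieldNormedType.Exports.

Local Open Scope classical_set_scope.
Local Open Scope ring_scope.
Local Open Scope complex_scope.

(** * Norms with real values and sequential limits *)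

Section RealNorm.
Variable R : realType.

(** Norms over [R[i]] take values in [R[i]], where the order is only partial;
    all estimates are made with their real parts. *)
Definition rnorm (V : normedZmodType R[i]) (v : V) : R := complex.Re `|v|.

Section Basic.
Variable V : normedZmodType R[i].
Implicit Types v w : V.

Lemma rnormE v : `|v| = (rnorm v)%:C.
Proof. by rewrite /rnorm RRe_real // normr_real. Qed.

Lemma rnorm_ge0 v : 0 <= rnorm v.
Proof. by have := normr_ge0 v; rewrite rnormE ler0c. Qed.

Lemma rnormD u v : rnorm (u + v) <= rnorm u + rnorm v.
Proof. by have := ler_normD u v; rewrite !rnormE -rmorphD lecR. Qed.

Lemma rnormN v : rnorm (- v) = rnorm v.
Proof. by rewrite /rnorm normrN. Qed.

Lemma rnorm0 : rnorm (0 : V) = 0.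
Proof. by rewrite /rnorm normr0. Qed.

Lemma rnorm0_eq0 v : rnorm v = 0 -> v = 0.
Proof. by move=> v0; apply/normr0_eq0; rewrite rnormE v0. Qed.

Lemma rnorm_gt0 v : v <> 0 -> 0 < rnorm v.
Proof.
by move=> v0; rewrite lt_neqAle rnorm_ge0 andbT eq_sym; apply/eqP => /rnorm0_eq0.
Qed.

Lemma rdistC u v : rnorm (u - v) = rnorm (v - u).
Proof. by rewrite -rnormN opprB. Qed.

Lemma rdist_triangle w u v : rnorm (u - v) <= rnorm (u - w) + rnorm (w - v).
Proof. by rewrite (_ : u - v = (u - w) + (w - v)) ?rnormD // addrA subrK. Qed.

Lemma rnorm_sum (I : Type) (r : seq I) (P : pred I) (F : I -> V) :
  rnorm (\sum_(i <- r | P i) F i) <= \sum_(i <- r | P i) rnorm (F i).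
Proof.
elim/big_rec2: _ => [|i x y _ le_yx]; first by rewrite rnorm0.
by apply: le_trans (rnormD _ _) _; rewrite lerD2l.
Qed.

Definition tends_to (u : nat -> V) l :=
  forall e : R, 0 < e -> exists N, forall n, (N <= n)%N -> rnorm (u n - l) <= e.

Definition cauchy_sequence (u : nat -> V) := forall e : R, 0 < e ->
  exists N, forall m n, (N <= m)%N -> (N <= n)%N -> rnorm (u m - u n) <= e.

Lemma rnorm_small_eq0 v : (forall e : R, 0 < e -> rnorm v <= e) -> v = 0.
Proof.
move=> small; apply: rnorm0_eq0; apply/eqP; rewrite eq_le rnorm_ge0 andbT.
by apply/ler_addgt0Pl => e e0; rewrite addr0 small.
Qed.

Lemma tends_to_uniq u l l' : tends_to u l -> tends_to u l' -> l = l'.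
Proof.
move=> ul ul'; apply/subr0_eq/rnorm_small_eq0 => e e0.
have e20 : 0 < e / 2 by rewrite divr_gt0.
have [N uN] := ul _ e20; have [M uM] := ul' _ e20.
apply: le_trans (rdist_triangle (u (maxn N M)) _ _) _.
have -> : e = e / 2 + e / 2 by field.
by rewrite (rdistC l) lerD ?uN ?uM // ?leq_maxl ?leq_maxr.
Qed.

Lemma tends_to_cst v : tends_to (fun=> v) v.
Proof. by move=> e e0; exists 0%N => n _; rewrite subrr rnorm0 ltW. Qed.

Lemma tends_toD u u' l l' : tends_to u l -> tends_to u' l' ->
  tends_to (fun n => u n + u' n) (l + l').
Proof.
move=> ul ul' e e0; have e20 : 0 < e / 2 by rewrite divr_gt0.
have [N uN] := ul _ e20; have [M uM] := ul' _ e20.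
exists (maxn N M) => n; rewrite geq_max => /andP[Nn Mn].
rewrite opprD addrACA; apply: le_trans (rnormD _ _) _.
have -> : e = e / 2 + e / 2 by field.
by rewrite lerD ?uN ?uM.
Qed.

Lemma tends_to_cauchy u l : tends_to u l -> cauchy_sequence u.
Proof.
move=> ul e e0; have e20 : 0 < e / 2 by rewrite divr_gt0.
have [N uN] := ul _ e20; exists N => m n Nm Nn.
apply: le_trans (rdist_triangle l _ _) _.
have -> : e = e / 2 + e / 2 by field.
by rewrite (rdistC l) lerD ?uN.
Qed.

Lemma tends_to_eq u u' l : (forall n, u n = u' n) -> tends_to u l ->
  tends_to u' l.
Proof. by move=> /funext->. Qed.

Lemma tends_toS u l : tends_to u l -> tends_to (fun n => u n.+1) l.
Proof.
by move=> ul e /ul[N uN]; exists N => n Nn; apply: uN; rewrite leqW.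
Qed.

Lemma tends_to_rnorm_le u l (c : R) : tends_to u l ->
  (exists N, forall n, (N <= n)%N -> rnorm (u n) <= c) -> rnorm l <= c.
Proof.
move=> ul [M uc]; apply/ler_addgt0Pr => e /ul[N uN].
rewrite -(subKr (u (maxn N M)) l); apply: le_trans (rnormD _ _) _.
by rewrite rnormN lerD ?uN ?uc // ?leq_maxl ?leq_maxr.
Qed.

End Basic.

Lemma tends_to_lipschitz (V W : normedZmodType R[i]) (f : V -> W) (c : R)
    (u : nat -> V) l :
  (forall x y, rnorm (f x - f y) <= c * rnorm (x - y)) ->
  tends_to u l -> tends_to (fun n => f (u n)) (f l).
Proof.
move=> fc ul e e0; have c1 : 0 < `|c| + 1 by rewrite ltr_wpDl.
have [N uN] := ul (e / (`|c| + 1)) (divr_gt0 e0 c1); exists N => n /uN le_n.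
apply: le_trans (fc _ _) _.
have cc : c <= `|c| + 1 by rewrite (le_trans (ler_norm c)) // lerDl.
apply: le_trans (ler_wpM2r (rnorm_ge0 _) cc) _.
by rewrite mulrC -ler_pdivlMr.
Qed.

Lemma rnormZ (V : normedModType R[i]) (z : R[i]) (v : V) :
  rnorm (z *: v) = rnorm z * rnorm v.
Proof. by apply: complexI; rewrite -rnormE normrZ !rnormE rmorphM. Qed.

Lemma tends_toZ (V : normedModType R[i]) (z : R[i]) (u : nat -> V) l :
  tends_to u l -> tends_to (fun n => z *: u n) (z *: l).
Proof.
by apply: (tends_to_lipschitz (c := rnorm z)) => x y; rewrite -scalerBr rnormZ.
Qed.

Lemma rnorm_complexM (z w : R[i]) : rnorm (z * w) = rnorm z * rnorm w.
Proof. by apply: complexI; rewrite -rnormE normrM !rnormE rmorphM. Qed.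

Lemma rnorm_real (x : R) : rnorm x%:C = `|x|.
Proof. by rewrite /rnorm normc_def /= expr0n addr0 sqrtr_sqr. Qed.

Lemma rnorm_nat n : rnorm (n%:R : R[i]) = n%:R.
Proof. by rewrite /rnorm normr_nat -(rmorph_nat (real_complex R)). Qed.

Lemma rnorm1 : rnorm (1 : R[i]) = 1. Proof. exact: rnorm_nat 1%N. Qed.

Lemma rnorm_conj (z : R[i]) : rnorm z^* = rnorm z.
Proof. by rewrite /rnorm normcJ. Qed.

Lemma rnorm_sqr (z : R[i]) :
  rnorm z ^+ 2 = complex.Re z ^+ 2 + complex.Im z ^+ 2.
Proof.
by apply: complexI; rewrite rmorphXn /= -rnormE -add_Re2_Im2.
Qed.

Lemma le_Re_rnorm (z : R[i]) : `|complex.Re z| <= rnorm z.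
Proof. by have := normc_ge_Re z; rewrite rnormE lecR. Qed.

Lemma le_Im_rnorm (z : R[i]) : `|complex.Im z| <= rnorm z.
Proof.
rewrite -(ler_pXn2r (_ : 0 < 2)%N) ?nnegrE ?rnorm_ge0 ?normr_ge0 //.
by rewrite rnorm_sqr real_normK ?num_real // lerDr sqr_ge0.
Qed.

Lemma rnorm_le_ReIm (z : R[i]) :
  rnorm z <= `|complex.Re z| + `|complex.Im z|.
Proof.
rewrite -(ler_pXn2r (_ : 0 < 2)%N) ?nnegrE ?rnorm_ge0 ?addr_ge0 ?normr_ge0 //.
rewrite rnorm_sqr sqrrD !real_normK ?num_real // lerD2r lerDl.
by rewrite mulrn_wge0 // mulr_ge0.
Qed.

Lemma real_cauchy_tends_to (u : nat -> R) :
  (forall e : R, 0 < e -> exists N, forall m n,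
     (N <= m)%N -> (N <= n)%N -> `|u m - u n| <= e) ->
  exists l, forall e : R, 0 < e ->
    exists N, forall n, (N <= n)%N -> `|u n - l| <= e.
Proof.
move=> uC; have : cvg (u @ \oo).
  apply/cauchy_cvgP/cauchy_exP => e e0.
  have [N uN] := uC (e / 2) ltac:(by rewrite divr_gt0).
  exists (u N); exists N => // n Nn /=; rewrite /ball /=.
  apply: le_lt_trans (uN _ _ (leqnn N) Nn) _.
  by rewrite ltr_pdivrMr // ltr_pMr // ltr1n.
move=> /cvg_ex[l ul]; exists l => e e0.
have /cvgrPdist_le/(_ e e0)[N _ uN] := ul.
by exists N => n Nn; rewrite distrC; exact: uN.
Qed.

Lemma complex_cauchy_tends_to (u : nat -> R[i]) :
  cauchy_sequence u -> exists l, tends_to u l.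
Proof.
move=> uC.
have [a ua] : exists a, forall e : R, 0 < e ->
    exists N, forall n, (N <= n)%N -> `|complex.Re (u n) - a| <= e.
  apply: real_cauchy_tends_to => e /uC[N uN]; exists N => m n Nm Nn.
  by rewrite -raddfB; apply: le_trans (le_Re_rnorm _) (uN _ _ _ _).
have [b ub] : exists b, forall e : R, 0 < e ->
    exists N, forall n, (N <= n)%N -> `|complex.Im (u n) - b| <= e.
  apply: real_cauchy_tends_to => e /uC[N uN]; exists N => m n Nm Nn.
  by rewrite -raddfB; apply: le_trans (le_Im_rnorm _) (uN _ _ _ _).
exists (a +i* b) => e e0; have e20 : 0 < e / 2 by rewrite divr_gt0.
have [N uN] := ua _ e20; have [M uM] := ub _ e20.
exists (maxn N M) => n; rewrite geq_max => /andP[Nn Mn].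
apply: le_trans (rnorm_le_ReIm _) _; rewrite !raddfB /=.
have -> : e = e / 2 + e / 2 by field.
by rewrite lerD ?uN ?uM.
Qed.

End RealNorm.

(** * Norm estimates in C*-algebras *)

Lemma cstar_subalgebraT (R : realType) (A : cstarAlgType R) :
  cstar_subalgebra [set: A].
Proof. by split. Qed.

Section CStarBasics.
Variables (R : realType) (A : cstarAlgType R).
Implicit Types a b c e p v w x y : A.

Lemma cmulDl a b c : (a + b) ** c = a ** c + b ** c.
Proof. by have := cmul_linear_l c 1 a b; rewrite !scale1r. Qed.

Lemma cmulDr a b c : a ** (b + c) = a ** b + a ** c.
Proof. by have := cmul_linear_r a 1 b c; rewrite !scale1r. Qed.

Lemma cmul0l a : 0 ** a = 0.
Proof. by apply: (addrI (0 ** a)); rewrite -cmulDl !addr0. Qed.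

Lemma cmul0r a : a ** 0 = 0.
Proof. by apply: (addrI (a ** 0)); rewrite -cmulDr !addr0. Qed.

Lemma cmulZl z a b : (z *: a) ** b = z *: (a ** b).
Proof. by have := cmul_linear_l b z a 0; rewrite !addr0 cmul0l addr0. Qed.

Lemma cmulZr z a b : a ** (z *: b) = z *: (a ** b).
Proof. by have := cmul_linear_r a z b 0; rewrite !addr0 cmul0r addr0. Qed.

Lemma cmulNl a b : (- a) ** b = - (a ** b).
Proof. by rewrite -scaleN1r cmulZl scaleN1r. Qed.

Lemma cmulNr a b : a ** (- b) = - (a ** b).
Proof. by rewrite -scaleN1r cmulZr scaleN1r. Qed.

Lemma cmulBl a b c : (a - b) ** c = a ** c - b ** c.
Proof. by rewrite cmulDl cmulNl. Qed.

Lemma cmulBr a b c : a ** (b - c) = a ** b - a ** c.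
Proof. by rewrite cmulDr cmulNr. Qed.

Lemma cmul_suml (I : Type) (r : seq I) (P : pred I) (F : I -> A) a :
  (\sum_(i <- r | P i) F i) ** a = \sum_(i <- r | P i) (F i ** a).
Proof. exact: (big_morph (cmul^~ a) (fun x y => cmulDl x y a) (cmul0l a)). Qed.

Lemma cmul_sumr (I : Type) (r : seq I) (P : pred I) (F : I -> A) a :
  a ** (\sum_(i <- r | P i) F i) = \sum_(i <- r | P i) (a ** F i).
Proof. exact: (big_morph (cmul a) (cmulDr a) (cmul0r a)). Qed.

Lemma cadj0 : (0 : A)^#* = 0.
Proof. by apply: (addrI (0^#*)); rewrite -cadjD !addr0. Qed.

Lemma cadjN a : (- a)^#* = - a^#*.
Proof. by apply/eqP; rewrite -addr_eq0 -cadjD addNr cadj0. Qed.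

(** The conjugation of closed fields is exchanged for [conjc], which computes on
    real and imaginary parts. *)
Lemma conjZ (z : R[i]) a : (z *: a)^#* = (z^*)%C *: a^#*.
Proof. exact: cadjZ. Qed.

Lemma cadjB a b : (a - b)^#* = a^#* - b^#*.
Proof. by rewrite cadjD cadjN. Qed.

Lemma cadj_sum (I : Type) (r : seq I) (P : pred I) (F : I -> A) :
  (\sum_(i <- r | P i) F i)^#* = \sum_(i <- r | P i) (F i)^#*.
Proof. exact: (big_morph (@cadj R A) (@cadjD R A) cadj0). Qed.

Lemma rnormM a b : rnorm (a ** b) <= rnorm a * rnorm b.
Proof. by have := cnormM a b; rewrite !rnormE -rmorphM lecR. Qed.

Lemma rnorm_star a : rnorm (a^#* ** a) = rnorm a ^+ 2.
Proof.
by apply: complexI; rewrite rmorphXn /= -!rnormE cstar_identity.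
Qed.

Lemma rnorm_adj a : rnorm a^#* = rnorm a.
Proof.
have le_adj b : rnorm b <= rnorm b^#*.
  have [b0|b0] := eqVneq (rnorm b) 0; first by rewrite b0 rnorm_ge0.
  have b_gt0 : 0 < rnorm b by rewrite lt_neqAle eq_sym b0 rnorm_ge0.
  by rewrite -(ler_pM2r b_gt0) -expr2 -rnorm_star rnormM.
by apply/eqP; rewrite eq_le le_adj -{2}(cadjK a) le_adj.
Qed.

Lemma complete_cauchy (u : nat -> A) : cauchy_sequence u -> exists l, tends_to u l.
Proof.
move=> uC; have : cvg (u @ \oo).
  apply/cauchy_cvgP/cauchy_exP => e e0.
  have eE : e = (complex.Re e)%:C by rewrite RRe_real // realE ltW.
  have re0 : 0 < complex.Re e by move: e0; rewrite eE ltcR.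
  have [N uN] := uC (complex.Re e / 2) ltac:(by rewrite divr_gt0).
  exists (u N); exists N => // n Nn /=; rewrite -ball_normE /=.
  rewrite rnormE eE ltcR; apply: le_lt_trans (uN _ _ (leqnn N) Nn) _.
  by rewrite ltr_pdivrMr // ltr_pMr // ltr1n.
move=> /cvg_ex[l ul]; exists l => e e0.
have e0' : 0 < e%:C by rewrite ltcR.
have [N _ uN] := (iffLR (cvgrPdist_le _ _) ul) e%:C e0'.
by exists N => n Nn; have := uN _ Nn; rewrite rnormE lecR rdistC.
Qed.

Lemma tends_to_scaler (z : nat -> R[i]) (l : R[i]) a :
  tends_to z l -> tends_to (fun n => z n *: a) (l *: a).
Proof.
apply: (tends_to_lipschitz (f := fun z : R[i] => z *: a) (c := rnorm a)) => x y.
by rewrite -scalerBl rnormZ mulrC.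
Qed.

Lemma tends_to_sum (I : Type) (r : seq I) (u : I -> nat -> A) (l : I -> A) :
  (forall i, tends_to (u i) (l i)) ->
  tends_to (fun n => \sum_(i <- r) u i n) (\sum_(i <- r) l i).
Proof.
move=> ul; elim: r => [|i r IH].
  rewrite big_nil; apply: (tends_to_eq _ (tends_to_cst 0)) => n.
  by rewrite big_nil.
rewrite big_cons; apply: (tends_to_eq _ (tends_toD (ul i) IH)) => n.
by rewrite big_cons.
Qed.

Lemma tends_to_adj (u : nat -> A) l :
  tends_to u l -> tends_to (fun n => (u n)^#*) l^#*.
Proof.
apply: (tends_to_lipschitz (c := 1)) => x y.
by rewrite -cadjB rnorm_adj mul1r.
Qed.

Lemma tends_toMl a (u : nat -> A) l :
  tends_to u l -> tends_to (fun n => a ** u n) (a ** l).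
Proof.
apply: (tends_to_lipschitz (c := rnorm a)) => x y.
by rewrite -cmulBr rnormM.
Qed.

Lemma tends_toMr a (u : nat -> A) l :
  tends_to u l -> tends_to (fun n => u n ** a) (l ** a).
Proof.
apply: (tends_to_lipschitz (f := cmul^~ a) (c := rnorm a)) => x y /=.
by rewrite -cmulBl mulrC rnormM.
Qed.

Lemma tends_to_sqr (u : nat -> A) l q : (forall n, rnorm (u n) <= q) ->
  tends_to u l -> tends_to (fun n => u n ** u n) (l ** l).
Proof.
move=> uq ul; have lq : rnorm l <= q.
  by apply: (tends_to_rnorm_le ul); exists 0%N.
have q0 : 0 <= q by apply: le_trans lq; apply: rnorm_ge0.
move=> e e0; have q1 : 0 < q + q + 1 by rewrite ltr_wpDl // addr_ge0.
have [N uN] := ul (e / (q + q + 1)) (divr_gt0 e0 q1); exists N => n /uN le_n.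
have -> : u n ** u n - l ** l = u n ** (u n - l) + (u n - l) ** l.
  by rewrite cmulBr cmulBl addrA subrK.
apply: le_trans (rnormD _ _) _.
apply: le_trans (lerD (rnormM (u n) _) (rnormM _ l)) _.
rewrite ler_pdivlMr // in le_n.
have := uq n; have := rnorm_ge0 (u n - l); nra.
Qed.

(** When [w^* x] is self-adjoint, [(w + i x)^* (w + i x)] and
    [(w - i x)^* (w - i x)] both equal [w^* w + x^* x], and [2 w] is the sum of
    [w + i x] and [w - i x]. *)
Lemma rnorm_sqr_le_sum w x : w^#* ** x = x^#* ** w ->
  rnorm w ^+ 2 <= rnorm (w^#* ** w + x^#* ** x).
Proof.
move=> wx.
have norm_u (c : R[i]) : (c^*)%C = - c -> c * c = -1 ->
    rnorm (w + c *: x) ^+ 2 = rnorm (w^#* ** w + x^#* ** x).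
  move=> cj cc; rewrite -rnorm_star cadjD conjZ cj cmulDl !cmulDr.
  rewrite !cmulZl !cmulZr scalerA mulNr cc opprK scale1r wx scaleNr.
  by rewrite addrA addrK.
have i2 : 'i * 'i = -1 :> R[i] by rewrite -expr2 sqr_i.
have n1 : rnorm (w + 'i *: x) ^+ 2 = rnorm (w^#* ** w + x^#* ** x).
  by apply: norm_u => //; apply/eqP; rewrite eq_complex /= oppr0 !eqxx.
have n2 : rnorm (w + (- 'i) *: x) ^+ 2 = rnorm (w^#* ** w + x^#* ** x).
  apply: norm_u; rewrite ?mulrNN //.
  by apply/eqP; rewrite eq_complex /= opprK !oppr0 !eqxx.
have : rnorm ((2 : R[i]) *: w) <= rnorm (w + 'i *: x) + rnorm (w + (- 'i) *: x).
  apply: le_trans (rnormD _ _).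
  by rewrite addrACA scaleNr subrr addr0 scaler_nat mulr2n.
have -> : rnorm (w + (- 'i) *: x) = rnorm (w + 'i *: x).
  by apply/eqP; rewrite -(eqrXn2 (n := 2)) ?rnorm_ge0 // n1 n2.
rewrite rnormZ rnorm_nat -n1 => le2; apply: lerXn2r; rewrite ?nnegrE ?rnorm_ge0 //.
by lra.
Qed.

(** If [b] and [d] are commuting and self-adjoint with [(1 - d)^2 + b^2 = 1],
    then [(1 - d) + i b] is formally unitary.  The previous estimate applied to
    [b b] and [(1 - d) b] gives [|b^2| <= |b|]. *)
Lemma rnorm_sine_le1 b d : b^#* = b -> d^#* = d -> b ** d = d ** b ->
  d + d - d ** d = b ** b -> rnorm b <= 1.
Proof.
move=> bs ds bd db; pose w := b - d ** b; pose z := b ** b.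
have wz : z^#* ** w = w^#* ** z.
  rewrite /w /z cadjB !cadjM bs ds !cmulBl !cmulBr !cmulA; congr (_ - _).
  by rewrite -!cmulA; congr (b ** _); rewrite !cmulA -bd.
have ww : w^#* ** w + z^#* ** z = b^#* ** b.
  have -> : z^#* ** z = b ** (d + d - d ** d) ** b.
    by rewrite db /z cadjM bs !cmulA.
  rewrite /w cadjB cadjM ds bs !cmulBl !cmulBr cmulDr !cmulBl !cmulDl !cmulA.
  by rewrite -(addrA (b ** d ** b)) -(addrA (b ** b)) -opprD subrK.
have := rnorm_sqr_le_sum wz; rewrite addrC ww rnorm_star.
have -> : rnorm z = rnorm b ^+ 2 by rewrite /z -{1}bs rnorm_star.
have c0 := sqr_ge0 (rnorm b); move: (rnorm b ^+ 2) c0 (expr_le1 (n := 2) isT (rnorm_ge0 b)).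
by move=> c c0 <- le_c; nra.
Qed.

Lemma geometric_cauchy (u : nat -> A) (q c : R) : 0 <= q -> q < 1 -> 0 <= c ->
  (forall n, rnorm (u n.+1 - u n) <= q ^+ n * c) -> cauchy_sequence u.
Proof.
move=> q0 q1 c0 step.
have bound n (p : nat) : rnorm (u (n + p)%N - u n) * (1 - q) <= c * q ^+ n * (1 - q ^+ p).
  elim: p => [|p IH]; first by rewrite addn0 !subrr rnorm0 mul0r mulr0.
  rewrite addnS; have := rdist_triangle (u (n + p)%N) (u (n + p).+1) (u n).
  have := step (n + p)%N; rewrite exprD exprS.
  have := exprn_ge0 n q0; have := exprn_ge0 p q0.
  set x := q ^+ n; set y := q ^+ p => y0 x0 h1 h2.
  rewrite -/x -/y in IH.
  have h3 := le_trans h2 (lerD h1 (lexx _)).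
  have q1' : 0 <= 1 - q by rewrite subr_ge0 ltW.
  apply: le_trans (ler_wpM2r q1' h3) _; rewrite mulrDl.
  apply: le_trans (lerD (lexx _) IH) _.
  by rewrite le_eqVlt; apply/orP; left; apply/eqP; ring.
have q1' : 0 < 1 - q by rewrite subr_gt0.
move=> e e0; pose d := e * (1 - q) / 2 / (c + 1).
have c1 : 0 < c + 1 by rewrite ltr_wpDl.
have d0 : 0 < d by rewrite !divr_gt0 // mulr_gt0.
have [N _ qN] : \forall n \near \oo, `|0 - q ^+ n| <= d.
  have cq : (q ^+ n @[n --> \oo] --> 0) by apply: cvg_expr; rewrite ger0_norm.
  exact: (iffLR (cvgrPdist_le _ _) cq d d0).
have near_N n : (N <= n)%N -> rnorm (u n - u N) <= e / 2.
  move=> Nn; have := bound N (n - N)%N; rewrite subnKC // => le1.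
  have qd : q ^+ N <= d.
    by have := qN N (leqnn N); rewrite sub0r normrN ger0_norm // exprn_ge0.
  rewrite -(ler_pM2r q1'); apply: le_trans le1 _.
  have le_p : 1 - q ^+ (n - N) <= 1 by rewrite gerBl exprn_ge0.
  have cq0 : 0 <= c * q ^+ N by rewrite mulr_ge0 // exprn_ge0.
  apply: le_trans (ler_wpM2l cq0 le_p) _; rewrite mulr1.
  apply: le_trans (ler_wpM2l c0 qd) _.
  have -> : e / 2 * (1 - q) = (c + 1) * d.
    by rewrite /d; field; rewrite lt0r_neq0.
  by rewrite ler_wpM2r ?(ltW d0) // lerDl.
exists N => m n Nm Nn; apply: le_trans (rdist_triangle (u N) _ _) _.
have -> : e = e / 2 + e / 2 by field.
by rewrite (rdistC (u N)) lerD ?near_N.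
Qed.

Lemma closed_tends_to (S : set A) (u : nat -> A) l : closed S ->
  (forall n, S (u n)) -> tends_to u l -> S l.
Proof.
move=> Sc Su ul; apply: Sc => U /nbhs_ballP[e /= e0 eU].
have eE : e = (complex.Re e)%:C by rewrite RRe_real // realE ltW.
have re0 : 0 < complex.Re e by move: e0; rewrite eE ltcR.
have [N uN] := ul (complex.Re e / 2) ltac:(by rewrite divr_gt0).
exists (u N); split=> //; apply: eU; rewrite -ball_normE /=.
rewrite rnormE eE ltcR rdistC; apply: le_lt_trans (uN _ (leqnn N)) _.
by rewrite ltr_pdivrMr // ltr_pMr // ltr1n.
Qed.

Lemma tends_to_closed (S : set A) :
  (forall u l, (forall n, S (u n)) -> tends_to u l -> S l) -> closed S.
Proof.
move=> Sseq l Sl.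
have near_l n : exists x, S x /\ rnorm (x - l) <= n.+1%:R^-1.
  have [|x [Sx lx]] := Sl (ball l (n.+1%:R^-1)%:C).
    by apply: nbhsx_ballx; rewrite ltcR invr_gt0.
  exists x; split=> //; move: lx; rewrite -ball_normE /= rnormE ltcR rdistC.
  exact: ltW.
have [u ul] := choice near_l.
apply: (Sseq u) => [n|e e0]; first by case: (ul n).
have [N Ne] : exists N, N.+1%:R^-1 <= e.
  exists (Num.truncn e^-1); rewrite -[leRHS]invrK lef_pV2 ?posrE ?invr_gt0 //.
  by apply: ltW; apply: Num.Theory.truncnS_gt.
exists N => n Nn; apply: le_trans (proj2 (ul n)) (le_trans _ Ne).
by rewrite lef_pV2 ?posrE // ler_nat ltnS.
Qed.

(** The square root of [1 - h]: the iteration for the fixed point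
    [d = (h + d^2) / 2] stays in the ball of radius [|h|], where it contracts by
    the factor [|h|]. *)
Lemma one_sub_sqrt (S : set A) h : cstar_subalgebra S -> S h -> h^#* = h ->
  rnorm h < 1 ->
  exists d, [/\ S d, d^#* = d, forall x, x ** h = h ** x -> x ** d = d ** x &
    d + d - d ** d = h].
Proof.
move=> [[Sc S0] SD SZ SM SJ] Sh hs q1; set q := rnorm h in q1.
have q0 : 0 <= q by apply: rnorm_ge0.
pose z : R[i] := (2^-1)%:C.
have zz : z + z = 1 by rewrite -rmorphD /= (_ : _ + _ = 1) //; field.
have nz : rnorm z = 2^-1 by rewrite rnorm_real ger0_norm // invr_ge0.
pose f x := z *: (h + x ** x); pose u n := iter n f 0.
have uS n : [/\ S (u n), (u n)^#* = u n,
    forall x, x ** h = h ** x -> x ** u n = u n ** x & rnorm (u n) <= q].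
  elim: n => [|n [Sn sn cn qn]].
    by rewrite cadj0 rnorm0; split=> // x _; rewrite cmul0l cmul0r.
  rewrite /u iterS -/(u n) /f; split.
  - by apply: SZ; apply: SD => //; apply: SM.
  - by rewrite conjZ conjc_real cadjD cadjM hs sn.
  - move=> x xh; rewrite cmulZl cmulZr cmulDl cmulDr xh cmulA.
    by rewrite (cn _ xh) -cmulA (cn _ xh) cmulA.
  - rewrite rnormZ nz; have := rnormD h (u n ** u n).
    have := rnormM (u n) (u n); rewrite -/q.
    have := rnorm_ge0 (u n); nra.
have step n : rnorm (u n.+1 - u n) <= q ^+ n * q.
  elim: n => [|n IH].
    by rewrite expr0 mul1r subr0; case: (uS 1%N).
  have -> : u n.+2 - u n.+1 =
      z *: (u n.+1 ** (u n.+1 - u n) + (u n.+1 - u n) ** u n).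
    rewrite /u 2!iterS -/(u n) -/(u n.+1) /f -scalerBr; congr (_ *: _).
    by rewrite opprD addrACA subrr add0r cmulBr cmulBl addrA subrK.
  have [_ _ _ qn] := uS n; have [_ _ _ qn1] := uS n.+1.
  rewrite rnormZ nz exprS.
  have le1 := rnormM (u n.+1) (u n.+1 - u n).
  have le2 := rnormM (u n.+1 - u n) (u n).
  have le3 := rnormD (u n.+1 ** (u n.+1 - u n)) ((u n.+1 - u n) ** u n).
  have := rnorm_ge0 (u n.+1 - u n); nra.
have [d ud] := complete_cauchy (geometric_cauchy q0 q1 q0 step).
exists d; split.
- by apply: (closed_tends_to Sc _ ud) => n; case: (uS n).
- apply: (tends_to_uniq _ ud); apply: (tends_to_eq _ (tends_to_adj ud)) => n.
  by case: (uS n).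
- move=> x xh; apply: (tends_to_uniq (tends_toMl x ud)).
  apply: (tends_to_eq _ (tends_toMr x ud)) => n.
  by case: (uS n) => _ _ -> .
have dE : d = z *: (h + d ** d).
  apply: (tends_to_uniq (tends_toS ud)).
  have du : tends_to (fun n => u n ** u n) (d ** d).
    by apply: (tends_to_sqr (q := q) _ ud) => n; case: (uS n).
  exact: (tends_toZ z (tends_toD (tends_to_cst h) du)).
by rewrite {1 2}dE -scalerDl zz scale1r addrK.
Qed.

(** * Projections that add up to a projection *)

Lemma rnorm_projection_le1 e : projection e -> rnorm e <= 1.
Proof.
move=> [ee es]; have := rnorm_star e; rewrite es ee.
have := rnorm_ge0 e; nra.
Qed.

(** Multiplication by the reflection [1 - 2 p] is isometric, and [1 - p] is the
    average of 1 and this reflection. *)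
Lemma rnorm_compl_projection p x : projection p ->
  rnorm (x - p ** x) <= rnorm x.
Proof.
move=> [pp ps]; pose s := p ** x.
have xs : x^#* ** s = s^#* ** s by rewrite /s cadjM ps -!cmulA (cmulA p) pp.
have sx : s^#* ** x = s^#* ** s by rewrite /s cadjM ps -!cmulA (cmulA p) pp.
have refl : rnorm (x - (s + s)) = rnorm x.
  apply/eqP; rewrite -(eqrXn2 (n := 2)) ?rnorm_ge0 //; rewrite -!rnorm_star.
  rewrite cadjB cadjD; clearbody s.
  by rewrite cmulBl 2!cmulBr !(cmulDl, cmulDr) xs sx opprB addrK subrK.
have two : rnorm ((2 : R[i]) *: (x - s)) <= rnorm x + rnorm x.
  rewrite -{2}refl; apply: le_trans (rnormD _ _).
  by rewrite scaler_nat mulr2n opprD addrCA !addrA lexx.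
move: two; rewrite rnormZ rnorm_nat; lra.
Qed.

(** The unit of a corner is an extreme point of the unit ball.  With [y = w^2]
    the hypotheses give [|e + y| <= 1] and [|e - y| <= 1].  If
    [|e + t y| <= 1] then [(e + t y)^2 = (e + 2 t y) + (t y)^2] is a sum of two
    commuting squares, so [|e + 2 t y| <= 1]; hence all [2^n y] are bounded. *)
Lemma corner_unit_extreme e w : projection e -> w^#* = w -> e ** w = w ->
  rnorm (e + w) <= 1 -> rnorm (e - w) <= 1 -> w = 0.
Proof.
move=> ep ws ew leD leB; have [ee es] := ep.
have we : w ** e = w by rewrite -[LHS]cadjK cadjM ws es ew ws.
pose y := w ** w.
have ys : y^#* = y by rewrite /y cadjM ws.
have ey : e ** y = y by rewrite /y cmulA ew.
have ye : y ** e = y by rewrite /y -cmulA we.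
have ey1 : rnorm (e - y) <= 1.
  have -> : e - y = (e + w) ** (e - w).
    by rewrite cmulBr !cmulDl ee we ew opprD addrA addrK.
  apply: le_trans (rnormM _ _) _.
  by rewrite -[leRHS]mulr1; apply: ler_pM; rewrite ?rnorm_ge0.
have half v : (2^-1 : R)%:C *: (v + v) = v :> A.
  by rewrite scalerDr -scalerDl -rmorphD /= (_ : _ + _ = 1) ?scale1r //; field.
have sqr1 v : rnorm v <= 1 -> rnorm (v ** v) <= 1.
  by move=> v1; apply: le_trans (rnormM _ _) _; rewrite mulr_ile1 ?rnorm_ge0.
have ey2 : rnorm (e + y) <= 1.
  have -> : e + y = (2^-1 : R)%:C *: ((e + w) ** (e + w) + (e - w) ** (e - w)).
    rewrite cmulBr !cmulBl !cmulDr !cmulDl ee we ew -/y.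
    have -> : e + w + (w + y) + (e - w - (w - y)) = (e + y) + (e + y).
      rewrite opprB addrACA (addrACA e) subrr addr0 (addrC w y) (addrACA y).
      by rewrite subrr addr0 addrACA.
    by rewrite half.
  rewrite rnormZ rnorm_real ger0_norm ?invr_ge0 //.
  have := rnormD ((e + w) ** (e + w)) ((e - w) ** (e - w)).
  have := sqr1 _ leD; have := sqr1 _ leB; lra.
have ye_comm v t : v ** y = y ** v -> v ** e = e ** v ->
    v ** (e + t *: y) = (e + t *: y) ** v.
  by move=> vy ve; rewrite cmulDr cmulDl cmulZr cmulZl vy ve.
have double (t : R) : 0 < t -> rnorm (e + t%:C *: y) <= 1 ->
    rnorm (e + (t + t)%:C *: y) <= 1.
  (* [T] is so large that [h], which is 2t (e - y) + e divided by [T], has norm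
     below 1; then [e - h] is the square of [c = (1 - d) e]. *)
  move=> t0 le1; pose T := t + t + 2; have T0 : 0 < T by rewrite !addr_gt0.
  pose h := e - T^-1%:C *: (e + (t + t)%:C *: y).
  have hE : h = T^-1%:C *: ((t + t)%:C *: (e - y) + e).
    have -> : h = T^-1%:C *: (T%:C *: e - (e + (t + t)%:C *: y)).
      rewrite scalerBr scalerA -rmorphM /= mulVf ?lt0r_neq0 //.
      by rewrite scale1r.
    congr (_ *: _); rewrite scalerBr opprD addrA [RHS]addrAC; congr (_ - _).
    have -> : T = (t + t) + (1 + 1) by rewrite /T.
    by rewrite !rmorphD /= !scalerDl !scale1r !addrA addrK.
  have hs : h^#* = h by rewrite /h cadjB conjZ cadjD conjZ ys es !conjc_real.
  have h1 : rnorm h < 1.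
    rewrite hE rnormZ rnorm_real ger0_norm ?invr_ge0 ?(ltW T0) //.
    rewrite mulrC ltr_pdivrMr // mul1r.
    apply: le_lt_trans (rnormD _ _) _; rewrite rnormZ rnorm_real.
    rewrite ger0_norm ?addr_ge0 ?ltW //.
    have := rnorm_projection_le1 ep; rewrite /T; nra.
  have [d [_ ds dc dh]] := one_sub_sqrt (@cstar_subalgebraT _ A) I hs h1.
  have hcomm v : v ** y = y ** v -> v ** e = e ** v -> v ** h = h ** v.
    by move=> vy ve; rewrite cmulBr cmulBl cmulZr cmulZl ve ye_comm.
  have ed : e ** d = d ** e by apply/dc/hcomm; rewrite // ey ye.
  have yd : y ** d = d ** y by apply/dc/hcomm; rewrite // ey ye.
  have he : h ** e = h by rewrite cmulBl cmulZl cmulDl cmulZl ee ye.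
  pose c := e - d ** e.
  have cs : c^#* = c by rewrite /c cadjB cadjM ds es ed.
  have cy : c ** y = y ** c.
    by rewrite cmulBl cmulBr ey ye -cmulA ey cmulA yd -cmulA ye.
  have cc : c ** c = T^-1%:C *: (e + (t + t)%:C *: y).
    have -> : T^-1%:C *: (e + (t + t)%:C *: y) = e - h.
      by rewrite /h subKr.
    have ede : e ** (d ** e) = d ** e by rewrite cmulA ed -cmulA ee.
    rewrite -he -dh /c !(cmulBl, cmulBr, cmulDl) -!cmulA !ee !ede.
    by rewrite !opprD !opprK !addrA.
  pose x := (Num.sqrt T)%:C *: c; pose z := t%:C *: y.
  have xx : x ** x = e + (t + t)%:C *: y.
    rewrite /x cmulZl cmulZr scalerA -rmorphM /= -expr2 sqr_sqrtr ?ltW // cc.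
    by rewrite scalerA -rmorphM /= mulfV ?lt0r_neq0 // scale1r.
  have xz : x ** z = z ** x by rewrite /x /z !(cmulZl, cmulZr) cy !scalerA mulrC.
  have sum_sqr : x ** x + z ** z = (e + z) ** (e + z).
    rewrite xx cmulDl !cmulDr ee /z !cmulZl !cmulZr ey ye -!addrA.
    by rewrite rmorphD /= scalerDl !addrA.
  have xs : x^#* = x by rewrite /x conjZ conjc_real cs.
  have zs : z^#* = z by rewrite /z conjZ conjc_real ys.
  have xz' : x^#* ** z = z^#* ** x by rewrite xs zs.
  have := rnorm_sqr_le_sum xz'; rewrite xs zs sum_sqr -xx => le2.
  apply: le_trans (rnormM _ _) _; rewrite -expr2; apply: le_trans le2 _.
  exact: sqr1.
have bound n : rnorm (e + (2 ^+ n : R)%:C *: y) <= 1.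
  elim: n => [|n IH]; first by rewrite expr0 scale1r.
  by rewrite exprS mulr_natl mulr2n; apply: double; rewrite ?exprn_gt0.
have y0 : y = 0.
  apply: rnorm_small_eq0 => eps eps0.
  have [n ne] : exists n, 2 / eps <= 2 ^+ n.
    exists (Num.truncn (2 / eps)); apply: ltW.
    apply: lt_le_trans (Num.Theory.truncnS_gt _) _.
    by rewrite -natrX ler_nat ltn_expl.
  have := rnormD (e + (2 ^+ n : R)%:C *: y) (- e).
  rewrite rnormN addrAC subrr add0r rnormZ rnorm_real ger0_norm ?exprn_ge0 //.
  have := bound n; have := rnorm_projection_le1 ep.
  rewrite ler_pdivrMr // in ne; move=> e1 b1 le2.
  have n0 : 0 < 2 ^+ n :> R by rewrite exprn_gt0.
  by rewrite -(ler_pM2l n0); apply: le_trans ne; lra.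
apply: rnorm0_eq0; apply/eqP; rewrite -sqrf_eq0 -rnorm_star ws -/y y0.
by rewrite rnorm0.
Qed.

(** As [e = P j] is below the sum, the compressions [e (P l) e] with [l != j] add
    up to 0.  With [w] a multiple of [e (P i) e], both [e + w] and [e - w] are
    averages of contractions, and [e] is extreme, so [e (P i) e] vanishes. *)
Lemma projections_orthogonal (I : eqType) (r : seq I) (P : I -> A) p i j :
  uniq r -> (forall l, projection (P l)) -> \sum_(l <- r) P l = p ->
  (forall l, l \in r -> P l ** p = P l) -> i \in r -> j \in r -> i != j ->
  P i ** P j = 0.
Proof.
move=> ur Pp sumP Pl ir jr ij; have [ee es] := Pp j; set e := P j in ee es *.
have [pp ps] := Pp i; pose x := e ** P i ** e.
have xs : x^#* = x by rewrite /x !cadjM es ps cmulA.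
have ex : e ** x = x by rewrite /x !cmulA ee.
have compl l : rnorm (e - e ** P l ** e) <= 1.
  have := rnorm_compl_projection e (Pp l).
  have -> : e - e ** P l ** e = (e - P l ** e)^#* ** (e - P l ** e).
    have [ll ls] := Pp l; rewrite cadjB cadjM es ls cmulBl !cmulBr ee.
    by rewrite -!cmulA (cmulA (P l)) ll subrr subr0.
  rewrite rnorm_star => le1; have := rnorm_projection_le1 (Pp j).
  rewrite -/e => e1; rewrite expr_le1 ?rnorm_ge0 //; exact: le_trans le1 e1.
pose r' := rem j (rem i r).
have perm_r : perm_eq r [:: i, j & r'].
  apply: perm_trans (perm_to_rem ir) _; rewrite perm_cons.
  by apply: perm_to_rem; rewrite mem_rem_uniq // !inE eq_sym ij.
have sum_x : \sum_(l <- r') (e ** P l ** e) = - x.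
  have := congr1 (fun v => v ** e) (Pl j jr); rewrite -/e ee -sumP.
  rewrite (perm_big _ perm_r) !big_cons /= -/e cmulDr cmulDr ee addrCA cmulDl ee.
  rewrite -[RHS]addr0 => /addrI; rewrite cmulDl -/x => /eqP.
  rewrite addrC addr_eq0 cmul_sumr cmul_suml => /eqP <-.
  by [].
(* Scaling by the number of remaining projections plus one makes [e + c x] and
   [e - c x] convex combinations, also when none remain. *)
pose M := size r'; pose c : R := M.+1%:R^-1.
have M0 : (0 : R) < M.+1%:R by rewrite ltr0n.
have cM : c * M%:R + c = 1.
  by rewrite -{2}(mulr1 c) -mulrDr natr1 mulVf // lt0r_neq0.
have c0 : 0 < c by rewrite invr_gt0.
have e1 := rnorm_projection_le1 (Pp j); rewrite -/e in e1.
have Me : rnorm (M%:R%:C *: e + x) <= M%:R.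
  have -> : M%:R%:C *: e + x = \sum_(l <- r') (e - e ** P l ** e).
    rewrite sumrB sum_x opprK; congr (_ + _).
    by rewrite rmorph_nat big_const_seq count_predT iter_addr_0 scaler_nat.
  apply: le_trans (rnorm_sum _ _ _) _.
  apply: le_trans (ler_sum _ (fun l _ => compl l)) _.
  by rewrite big_const_seq count_predT iter_addr_0.
have cx : c%:C *: x = 0.
  apply: (corner_unit_extreme (Pp j)); rewrite ?cmulZr -/e ?ex ?conjZ ?conjc_real ?xs //.
  - have -> : e + c%:C *: x = c%:C *: (M%:R%:C *: e + x) + c%:C *: e.
      rewrite scalerDr scalerA addrAC -scalerDl -rmorphM -rmorphD /= cM.
      by rewrite scale1r.
    apply: le_trans (rnormD _ _) _; rewrite !rnormZ !rnorm_real.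
    rewrite gtr0_norm //; move: cM Me e1 c0; nra.
  - have -> : e - c%:C *: x = c%:C *: (e - x) + (c * M%:R)%:C *: e.
      rewrite scalerBr addrAC -scalerDl -rmorphD /= addrC.
      by rewrite addrC [c + _]addrC cM scale1r.
    apply: le_trans (rnormD _ _) _; rewrite !rnormZ !rnorm_real.
    rewrite gtr0_norm // (@ger0_norm _ (c * _)) ?mulr_ge0 ?(ltW c0) //.
    have := compl i; rewrite -/x => xi.
    have cM0 : 0 <= c * M%:R by rewrite mulr_ge0 // ltW.
    have := ler_wpM2l cM0 e1; have := ler_wpM2l (ltW c0) xi; lra.
have x0 : x = 0.
  apply: rnorm0_eq0; move/(congr1 (@rnorm R A)): cx; rewrite rnormZ rnorm0.
  by move/eqP; rewrite mulf_eq0 rnorm_real normr_eq0 (negbTE (lt0r_neq0 c0)) /= => /eqP.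
apply: rnorm0_eq0; apply/eqP; rewrite -sqrf_eq0 -rnorm_star cadjM es ps -/e.
by rewrite -cmulA (cmulA (P i)) pp cmulA -/x x0 rnorm0.
Qed.

End CStarBasics.

(** * Homomorphisms are contractive *)

Section StarHomomorphisms.
Variables (R : realType) (A B : cstarAlgType R) (f : A -> B).
Hypothesis hf : star_hom f.

Lemma star_homD a b : f (a + b) = f a + f b.
Proof. by have [lin _ _] := hf; have := lin 1 a b; rewrite !scale1r. Qed.

Lemma star_hom0 : f 0 = 0.
Proof. by apply: (addrI (f 0)); rewrite -star_homD !addr0. Qed.

Lemma star_homZ z a : f (z *: a) = z *: f a.
Proof. by have [lin _ _] := hf; have := lin z a 0; rewrite star_hom0 !addr0. Qed.

Lemma star_homM a b : f (a ** b) = f a ** f b.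
Proof. by have [_ M _] := hf. Qed.

Lemma star_homJ a : f a^#* = (f a)^#*.
Proof. by have [_ _ J] := hf. Qed.

Lemma star_hom_sum (I : Type) (r : seq I) (P : pred I) (F : I -> A) :
  f (\sum_(i <- r | P i) F i) = \sum_(i <- r | P i) f (F i).
Proof. exact: (big_morph f star_homD star_hom0). Qed.

End StarHomomorphisms.

(** The inverse of a homomorphism that is injective on a subalgebra is a
    homomorphism of this restricted kind. *)
Definition star_hom_on (R : realType) (A B : cstarAlgType R) (S : set A)
    (f : A -> B) : Prop :=
  [/\ forall a b, S a -> S b -> f (a + b) = f a + f b,
      forall (z : R[i]) a, S a -> f (z *: a) = z *: f a,
      forall a b, S a -> S b -> f (a ** b) = f a ** f b &
      forall a, S a -> f a^#* = (f a)^#*].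

(** By the C*-identity it is enough to treat [b = a^* a] scaled to have norm
    below 1; a homomorphism carries the square root of [1 - b^2] along. *)
Lemma star_hom_on_contractive (R : realType) (A B : cstarAlgType R) (S : set A)
    (f : A -> B) (a : A) :
  cstar_subalgebra S -> star_hom_on S f -> S a -> rnorm (f a) <= rnorm a.
Proof.
move=> SA [fD fZ fM fJ] Sa; have [[Sc S0] SD SZ SM SJ] := SA.
suff le_t (t : R) : rnorm a ^+ 2 < t -> rnorm (f a) ^+ 2 <= t.
  rewrite -(ler_pXn2r (_ : 0 < 2)%N) ?nnegrE ?rnorm_ge0 //.
  apply/ler_addgt0Pr => e e0; apply: le_t; by rewrite ltrDl.
move=> at_; have t0 : 0 < t by apply: le_lt_trans at_; rewrite sqr_ge0.
pose c : R[i] := (t^-1)%:C; pose b := c *: (a^#* ** a).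
have nc : rnorm c = t^-1 by rewrite rnorm_real ger0_norm // invr_ge0 ltW.
have Saa : S (a^#* ** a) by apply: SM => //; apply: SJ.
have Sb : S b by apply: SZ.
have bs : b^#* = b by rewrite /b conjZ conjc_real cadjM cadjK.
have b1 : rnorm b < 1.
  by rewrite rnormZ nc rnorm_star mulrC ltr_pdivrMr // mul1r.
have [d [Sd ds /(_ b) bd db]] : exists d, [/\ S d, d^#* = d,
    forall x, x ** (b ** b) = b ** b ** x -> x ** d = d ** x &
    d + d - d ** d = b ** b].
  apply: one_sub_sqrt => //; [exact: SM|by rewrite cadjM bs|].
  by apply: le_lt_trans (rnormM _ _) _; rewrite mulr_ilt1 ?rnorm_ge0.
have fb1 : rnorm (f b) <= 1.
  apply: (@rnorm_sine_le1 _ _ _ (f d)).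
  - by rewrite -fJ // bs.
  - by rewrite -fJ // ds.
  - by rewrite -!fM // bd // cmulA.
  - have fN : f (- (d ** d)) = - (f d ** f d).
      by rewrite -scaleN1r fZ ?fM ?scaleN1r //; apply: SM.
    rewrite -fN -!fM // -db fD ?fD //; first exact: SD.
    by rewrite -scaleN1r; apply/SZ/SM.
rewrite -rnorm_star -fJ // -fM //; last exact: SJ.
by move: fb1; rewrite /b fZ // rnormZ nc mulrC ler_pdivrMr // mul1r.
Qed.

Lemma star_hom_contractive (R : realType) (A B : cstarAlgType R) (f : A -> B) a :
  star_hom f -> rnorm (f a) <= rnorm a.
Proof.
move=> hf; apply: star_hom_on_contractive (@cstar_subalgebraT R A) _ I.
split=> [x y _ _|z x _|x y _ _|x _].
- exact: (star_homD hf).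
- exact: (star_homZ hf).
- exact: (star_homM hf).
- exact: (star_homJ hf).
Qed.

(** * Matrix units *)

Section MatrixUnits.
Variables (R : realType) (n : nat) (sim : rel 'I_n).
Hypothesis sim_equiv : equivalence_rel sim.

(** The classes of [sim] are the blocks of a direct sum of full matrix
    algebras. *)
Definition block_matrix (c : 'M[R[i]]_n) := forall i j, ~~ sim i j -> c i j = 0.

(** Combinations have block coefficients, so the product rule is confined to
    pairs of indices in the same block. *)
Record matrix_units (A : cstarAlgType R) (E : 'I_n -> 'I_n -> A) : Prop :=
  MatrixUnits {
    mu_adj : forall i j, (E i j)^#* = E j i ;
    mu_mul : forall i j k l, sim i j -> sim k l ->
      E i j ** E k l = if j == k then E i l else 0
  }.

Definition mu_comb (A : cstarAlgType R) (E : 'I_n -> 'I_n -> A)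
    (c : 'M[R[i]]_n) : A :=
  \sum_i \sum_j c i j *: E i j.

Let sim_refl i : sim i i.
Proof. by have [] := sim_equiv i i i. Qed.

Let sim_sym i j : sim i j = sim j i.
Proof.
have trans x y : sim x y -> sim y x.
  by move=> xy; have [_ /(_ xy) <-] := sim_equiv x y x; apply: sim_refl.
by apply/idP/idP; apply: trans.
Qed.

Let sim_trans j i k : sim i j -> sim j k -> sim i k.
Proof. by move=> ij; have [_ /(_ ij) ->] := sim_equiv i j k. Qed.

Lemma block_matrixD c d :
  block_matrix c -> block_matrix d -> block_matrix (c + d).
Proof. by move=> bc bd i j ij; rewrite mxE bc ?bd ?addr0. Qed.

Lemma block_matrixZ z c : block_matrix c -> block_matrix (z *: c).
Proof. by move=> bc i j ij; rewrite mxE bc ?mulr0. Qed.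

Lemma block_matrixM c d :
  block_matrix c -> block_matrix d -> block_matrix (c *m d).
Proof.
move=> bc bd i j ij; rewrite mxE big1 // => k _.
have [ik|ik] := boolP (sim i k); last by rewrite bc ?mul0r.
rewrite [d k j]bd ?mulr0 //; apply: contra ij => kj; exact: sim_trans ik kj.
Qed.

Lemma block_matrix_adj c :
  block_matrix c -> block_matrix (map_mx (@conjc R) c^T).
Proof. by move=> bc i j ij; rewrite !mxE bc ?conjc0 // sim_sym. Qed.

Section OneSystem.
Variables (A : cstarAlgType R) (E : 'I_n -> 'I_n -> A).
Hypothesis EM : matrix_units E.

Lemma mu_combD c d : mu_comb E (c + d) = mu_comb E c + mu_comb E d.
Proof.
rewrite /mu_comb -big_split; apply: eq_bigr => i _ /=.
by rewrite -big_split; apply: eq_bigr => j _; rewrite mxE scalerDl.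
Qed.

Lemma mu_combZ z c : mu_comb E (z *: c) = z *: mu_comb E c.
Proof.
rewrite /mu_comb scaler_sumr; apply: eq_bigr => i _.
by rewrite scaler_sumr; apply: eq_bigr => j _; rewrite mxE scalerA.
Qed.

Lemma mu_comb0 : mu_comb E 0 = 0.
Proof. by rewrite -(scale0r 0) mu_combZ scale0r. Qed.

Lemma mu_comb_adj c : (mu_comb E c)^#* = mu_comb E (map_mx (@conjc R) c^T).
Proof.
rewrite /mu_comb exchange_big cadj_sum; apply: eq_bigr => i _.
by rewrite cadj_sum; apply: eq_bigr => j _; rewrite conjZ (mu_adj EM) !mxE.
Qed.

Lemma mu_combM c d : block_matrix c -> block_matrix d ->
  mu_comb E (c *m d) = mu_comb E c ** mu_comb E d.
Proof.
move=> bc bd; rewrite /mu_comb cmul_suml; apply: eq_bigr => i _.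
have term j k l : (c i j *: E i j) ** (d k l *: E k l) =
    if j == k then (c i j * d k l) *: E i l else 0.
  rewrite cmulZl cmulZr scalerA; have [ij|/bc->] := boolP (sim i j); last first.
    by rewrite mul0r !scale0r if_same.
  have [kl|/bd->] := boolP (sim k l); last by rewrite mulr0 !scale0r if_same.
  by rewrite (mu_mul EM) //; case: eqP => _ //; rewrite scaler0.
under eq_bigr => l _ do rewrite mxE scaler_suml.
rewrite exchange_big cmul_suml; apply: eq_bigr => j _ /=.
rewrite cmul_sumr [RHS](bigD1 j) //= [X in _ + X]big1 ?addr0 => [|k kj].
  by rewrite cmul_sumr; apply: eq_bigr => l _; rewrite term eqxx.
rewrite cmul_sumr big1 // => l _.
by rewrite term eq_sym (negbTE kj).
Qed.

Lemma mu_comb_coef c i j : block_matrix c -> sim i j ->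
  E i i ** mu_comb E c ** E j j = c i j *: E i j.
Proof.
move=> bc ij; rewrite /mu_comb cmul_sumr cmul_suml (bigD1 i) //=.
have term k l : E i i ** (c k l *: E k l) ** E j j =
    if (k == i) && (l == j) then c i j *: E i j else 0.
  rewrite cmulZr cmulZl; have [kl|kl] := boolP (sim k l); last first.
    rewrite bc // scale0r; case: ifP => // /andP[/eqP ki /eqP lj].
    by rewrite ki lj ij in kl.
  rewrite (mu_mul EM) // eq_sym; have [ki|] := eqVneq k i; last first.
    by rewrite cmul0l scaler0.
  rewrite ki in kl *; rewrite (mu_mul EM) //=; case: eqP => [->//|_].
  by rewrite scaler0.
rewrite [X in _ + X]big1 ?addr0 => [|k ki]; last first.
  rewrite cmul_sumr cmul_suml big1 // => l _.
  by rewrite term (negbTE ki).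
rewrite cmul_sumr cmul_suml (bigD1 j) //= term !eqxx.
rewrite big1 ?addr0 // => l lj.
by rewrite term (negbTE lj) andbF.
Qed.

Hypothesis E_neq0 : forall i j, sim i j -> E i j <> 0.

Lemma mu_comb_inj c d : block_matrix c -> block_matrix d ->
  mu_comb E c = mu_comb E d -> c = d.
Proof.
move=> bc bd cd; apply/matrixP => i j.
have [ij|ij] := boolP (sim i j); last by rewrite bc ?bd.
have := mu_comb_coef bc ij; rewrite cd mu_comb_coef // => /eqP.
rewrite -subr_eq0 -scalerBl scaler_eq0 subr_eq0 => /orP[/eqP//|/eqP].
by move/E_neq0: ij.
Qed.

(** Compressing by [E i i] and [E j j] recovers the coefficients continuously,
    so the coefficients of a Cauchy sequence of combinations are Cauchy. *)
Lemma mu_comb_closed : cstar_subalgebra (mu_comb E @` block_matrix).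
Proof.
split.
- split; last first.
    exists 0; first by move=> i j _; rewrite mxE.
    by rewrite mu_comb0.
  apply: tends_to_closed => u l Su ul.
  have coefs m : exists c, block_matrix c /\ mu_comb E c = u m.
    by have [c bc cu] := Su m; exists c.
  have [c cP] := choice coefs.
  have coef i j : exists z : R[i], (~~ sim i j -> z = 0) /\
      tends_to (fun m => c m i j : R[i]) z.
    have [ij|ij] := boolP (sim i j); last first.
      exists 0; split=> // e e0; exists 0%N => m _.
      by have [-> //] := cP m; rewrite subr0 rnorm0 ltW.
    have E0 := rnorm_gt0 (E_neq0 ij).
    have [|z cz] := @complex_cauchy_tends_to R (fun m => c m i j); last by exists z.
    move=> e e0; have := tends_to_cauchy (tends_toMr (E j j) (tends_toMl (E i i) ul)).
    move=> /(_ (e * rnorm (E i j)))[|N uN]; first exact: mulr_gt0.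
    exists N => m m' Nm Nm'; have := uN m m' Nm Nm'.
    have [bm <-] := cP m; have [bm' <-] := cP m'.
    by rewrite !mu_comb_coef // -scalerBl rnormZ ler_pM2r.
  have [z zP] : exists z : 'M[R[i]]_n, forall i j, (~~ sim i j -> z i j = 0) /\
      tends_to (fun m => c m i j : R[i]) (z i j).
    have [z zP] := choice (fun p => coef p.1 p.2).
    by exists (\matrix_(i, j) z (i, j)) => i j; rewrite mxE; apply: (zP (i, j)).
  exists z; first by move=> i j /(proj1 (zP i j)).
  apply: (tends_to_uniq _ ul).
  have -> : u = fun m => mu_comb E (c m) by apply/funext => m; have [_ ->] := cP m.
  apply: tends_to_sum => i; apply: tends_to_sum => j.
  by apply: tends_to_scaler; case: (zP i j).
- move=> _ _ [c bc <-] [d bd <-]; exists (c + d); last by rewrite mu_combD.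
  exact: block_matrixD.
- move=> z _ [c bc <-]; exists (z *: c); last by rewrite mu_combZ.
  exact: block_matrixZ.
- move=> _ _ [c bc <-] [d bd <-]; exists (c *m d); last by rewrite mu_combM.
  exact: block_matrixM.
- move=> _ [c bc <-]; exists (map_mx (@conjc R) c^T); last by rewrite mu_comb_adj.
  exact: block_matrix_adj.
Qed.

End OneSystem.

(** The combinations of nonzero matrix units form a C*-algebra, from which
    there is a homomorphism onto the combinations of any other such system;
    homomorphisms are contractive. *)
Lemma mu_comb_rnorm_le (A B : cstarAlgType R) (E : 'I_n -> 'I_n -> A)
    (F : 'I_n -> 'I_n -> B) c :
  matrix_units E -> matrix_units F -> (forall i j, sim i j -> F i j <> 0) ->
  block_matrix c -> rnorm (mu_comb E c) <= rnorm (mu_comb F c).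
Proof.
move=> EM FM F0 bc; pose S := mu_comb F @` block_matrix.
pose coefs y : 'M[R[i]]_n := xget 0 [set d | block_matrix d /\ mu_comb F d = y].
have coefsK d : block_matrix d -> coefs (mu_comb F d) = d.
  move=> bd; rewrite /coefs; case: xgetP => [d' _ [bd' dd']|/(_ d)[]//].
  exact: (mu_comb_inj FM F0).
pose f y := mu_comb E (coefs y).
rewrite -{1}(coefsK c bc) -/(f _); apply: (@star_hom_on_contractive _ _ _ S).
- exact: mu_comb_closed.
- split.
  + move=> _ _ [d bd <-] [d' bd' <-]; rewrite /f -mu_combD !coefsK ?mu_combD //.
    exact: block_matrixD.
  + move=> z _ [d bd <-]; rewrite /f -mu_combZ !coefsK ?mu_combZ //.
    exact: block_matrixZ.
  + move=> _ _ [d bd <-] [d' bd' <-]; rewrite /f -mu_combM // !coefsK ?mu_combM //.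
    exact: block_matrixM.
  + move=> _ [d bd <-]; rewrite /f mu_comb_adj // !coefsK ?mu_comb_adj //.
    exact: block_matrix_adj.
- by exists c.
Qed.

End MatrixUnits.

(** * Cuntz-Krieger families *)

Section CuntzKrieger.
Variables (R : realType) (k : nat) (L : kgraph k).
Hypothesis hL : row_finite_no_sources L.
Implicit Types (l m : mor L) (v : ob L) (p q r : {ffun 'I_k -> nat}).

Definition path_seq p v : seq (mor L) :=
  finmap.enum_fset (fset_set (paths p v)).

Lemma path_seqP p v l : (l \in path_seq p v) = (deg l == p) && (rng l == v).
Proof.
have [fin _] := hL p v.
have -> : (l \in path_seq p v) = (l \in fset_set (paths p v)) by [].
rewrite in_fset_set //.
by apply/idP/andP => [/set_mem[-> ->]|[/eqP lp /eqP lv]] //; exact/mem_set.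
Qed.

Lemma path_seq_uniq p v : uniq (path_seq p v).
Proof. exact: fset_uniq. Qed.

Variables (A : cstarAlgType R) (s : mor L -> A).
Hypothesis sCK : ck_family s.

Lemma ck_sum v p : s (idm L v) = \sum_(l <- path_seq p v) s l ** (s l)^#*.
Proof. by rewrite (ck_range sCK v p) fsbig_finite //; case: (hL p v). Qed.

Lemma ck_src l : s l ** s (idm L (src l)) = s l.
Proof. by rewrite -(ck_comp sCK) ?kcomp_idr ?rng_idm. Qed.

Lemma ck_rng l : s (idm L (rng l)) ** s l = s l.
Proof. by rewrite -(ck_comp sCK) ?kcomp_idl ?src_idm. Qed.

Lemma ck_adj_src l : s (idm L (src l)) ** (s l)^#* = (s l)^#*.
Proof.
by have [_ e] := ck_proj sCK (src l); rewrite -{1}e -cadjM ck_src.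
Qed.

Lemma ck_range_projection l : projection (s l ** (s l)^#*).
Proof.
by split; rewrite ?cadjM ?cadjK // cmulA (ck_isometry sCK).
Qed.

(** The Cuntz-Krieger relations only say that the range projections of the
    paths in [paths p v] add up to a projection, which forces orthogonality. *)
Lemma ck_adj_mul_neq l m : deg l = deg m -> l != m -> (s l)^#* ** s m = 0.
Proof.
move=> dlm lm; have adjI x : (s x)^#* ** s x ** (s x)^#* = (s x)^#*.
  by rewrite -[in RHS](ck_isometry sCK x) !cadjM cadjK cmulA.
have [rlm|rlm] := eqVneq (rng l) (rng m); last first.
  have [_ e] := ck_proj sCK (rng l).
  rewrite -(ck_rng l) -(ck_rng m) cadjM e -cmulA (cmulA (s (idm L _))).
  by rewrite (ck_orth sCK) ?cmul0l ?cmul0r //; apply/eqP.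
have orth : s l ** (s l)^#* ** (s m ** (s m)^#*) = 0.
  have [pp ps] := ck_proj sCK (rng l).
  apply: (projections_orthogonal (path_seq_uniq (deg l) (rng l))
    ck_range_projection (esym (ck_sum (rng l) (deg l)))) => // [x||].
  - rewrite path_seqP => /andP[_ /eqP <-]; have [_ e] := ck_proj sCK (rng x).
    have adj_rng : (s x)^#* ** s (idm L (rng x)) = (s x)^#*.
      by rewrite -{1}e -cadjM ck_rng.
    by rewrite -cmulA adj_rng.
  - by rewrite path_seqP !eqxx.
  - by rewrite path_seqP dlm rlm !eqxx.
rewrite -adjI -(ck_isometry sCK m) -!cmulA (cmulA (s l)) (cmulA (s m)).
by rewrite (cmulA (s l ** _)) orth cmul0l cmul0r.
Qed.

Lemma ck_mul_vertex l v : s l ** s (idm L v) = if src l == v then s l else 0.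
Proof.
case: eqP => [<-|lv]; first exact: ck_src.
by rewrite -(ck_src l) -cmulA (ck_orth sCK) // cmul0r.
Qed.

Definition ck_unit l m := s l ** (s m)^#*.

Lemma ck_unit_eq0 l m : src l != src m -> ck_unit l m = 0.
Proof.
move=> lm; rewrite /ck_unit -(ck_adj_src m) cmulA ck_mul_vertex (negbTE lm).
by rewrite cmul0l.
Qed.

Lemma ck_unit_adj l m : (ck_unit l m)^#* = ck_unit m l.
Proof. by rewrite cadjM cadjK. Qed.

Lemma ck_unit_mul l m l' m' : deg m = deg l' ->
  ck_unit l m ** ck_unit l' m' =
    if (m == l') && (src l == src m) then ck_unit l m' else 0.
Proof.
move=> dml; rewrite /ck_unit -cmulA (cmulA (s m)^#*).
have [ml|ml] /= := eqVneq m l'; last by rewrite ck_adj_mul_neq // cmul0l cmul0r.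
rewrite -ml (ck_source sCK) cmulA ck_mul_vertex; case: eqP => // _.
by rewrite cmul0l.
Qed.

Lemma ck_unit_expand l m p : src l = src m ->
  ck_unit l m = \sum_(x <- path_seq p (src l)) ck_unit (kcomp l x) (kcomp m x).
Proof.
move=> lm; rewrite /ck_unit -{1}(ck_src l) (ck_sum (src l) p) cmul_sumr cmul_suml.
apply: eq_big_seq => x; rewrite path_seqP => /andP[_ /eqP xl].
by rewrite !(ck_comp sCK) -?lm // cadjM !cmulA.
Qed.

(** Elements come with an explicit linear combination, so that only finitely many
    paths are involved at a time. *)
Definition ck_span p q : set A := [set a | exists r : seq (R[i] * (mor L * mor L)),
  all (fun x => (deg x.2.1 == p) && (deg x.2.2 == q)) r /\
  a = \sum_(x <- r) x.1 *: ck_unit x.2.1 x.2.2].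

Lemma ck_span0 p q : ck_span p q 0.
Proof. by exists [::]; rewrite big_nil. Qed.

Lemma ck_spanD p q a b : ck_span p q a -> ck_span p q b -> ck_span p q (a + b).
Proof.
move=> [r [rP ->]] [r' [rP' ->]]; exists (r ++ r').
by rewrite all_cat rP rP' big_cat.
Qed.

Lemma ck_spanZ p q z a : ck_span p q a -> ck_span p q (z *: a).
Proof.
move=> [r [rP ->]]; exists [seq (z * x.1, x.2) | x <- r].
rewrite all_map; split; first exact: rP.
by rewrite big_map scaler_sumr; apply: eq_bigr => x _; rewrite scalerA.
Qed.

Lemma ck_span_unit p q l m : deg l = p -> deg m = q -> ck_span p q (ck_unit l m).
Proof.
move=> lp mq; exists [:: (1, (l, m))]; rewrite /= lp mq !eqxx.
by rewrite big_seq1 scale1r.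
Qed.

Lemma ck_span_ind p q (P : A -> Prop) : P 0 ->
  (forall a b, P a -> P b -> P (a + b)) ->
  (forall z a, P a -> P (z *: a)) ->
  (forall l m, deg l = p -> deg m = q -> P (ck_unit l m)) ->
  forall a, ck_span p q a -> P a.
Proof.
move=> P0 PD PZ Pu a [r [rP ->]]; elim: r rP => [|x r IH] /=.
  by rewrite big_nil.
move=> /andP[/andP[/eqP x1 /eqP x2] /IH Pr]; rewrite big_cons.
by apply: PD => //; apply/PZ/Pu.
Qed.

Lemma ck_span_sum p q (I : eqType) (r : seq I) (F : I -> A) :
  (forall i, i \in r -> ck_span p q (F i)) -> ck_span p q (\sum_(i <- r) F i).
Proof.
elim: r => [|i r IH] rP; first by rewrite big_nil; apply: ck_span0.
rewrite big_cons; apply: ck_spanD; first by apply: rP; rewrite mem_head.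
by apply: IH => j jr; apply: rP; rewrite in_cons jr orbT.
Qed.

Lemma ck_span_adj p q a : ck_span p q a -> ck_span q p a^#*.
Proof.
move: a; apply: ck_span_ind => [|a b|z a|l m lp mq].
- by rewrite cadj0; apply: ck_span0.
- by rewrite cadjD; apply: ck_spanD.
- by rewrite conjZ; apply: ck_spanZ.
- by rewrite ck_unit_adj; apply: ck_span_unit.
Qed.

Lemma ck_spanM p q r a b :
  ck_span p q a -> ck_span q r b -> ck_span p r (a ** b).
Proof.
move=> Sa Sb; move: a Sa; apply: ck_span_ind => [|a a' Sa Sa'|z a Sa|l m lp mq].
- by rewrite cmul0l; apply: ck_span0.
- by rewrite cmulDl; apply: ck_spanD.
- by rewrite cmulZl; apply: ck_spanZ.
move: b Sb; apply: ck_span_ind => [|b b' Sb Sb'|z b Sb|l' m' lp' mq'].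
- by rewrite cmul0r; apply: ck_span0.
- by rewrite cmulDr; apply: ck_spanD.
- by rewrite cmulZr; apply: ck_spanZ.
rewrite ck_unit_mul ?mq ?lp' //; case: ifP => _; last exact: ck_span0.
exact: ck_span_unit.
Qed.

(** Products of spans with different inner degrees are computed after expanding
    both factors to a common inner degree. *)
Lemma ck_span_expand p q r a : ck_span p q a -> ck_span (p + r) (q + r) a.
Proof.
move: a; apply: ck_span_ind => [|a b|z a|l m lp mq].
- exact: ck_span0.
- exact: ck_spanD.
- exact: ck_spanZ.
have [lm|lm] := eqVneq (src l) (src m); last first.
  by rewrite ck_unit_eq0 //; apply: ck_span0.
rewrite (ck_unit_expand r lm); apply: ck_span_sum => x.
rewrite path_seqP => /andP[/eqP xr /eqP xl].
by apply: ck_span_unit; rewrite deg_kcomp -?lm // ?lp ?mq xr.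
Qed.

Section Representation.
Variables (B : cstarAlgType R) (pi : A -> B).
Hypothesis hpi : star_hom pi.
Hypothesis pi_neq0 : forall v, pi (s (idm L v)) <> 0.

Lemma pi_unit_neq0 l m : src l = src m -> pi (ck_unit l m) <> 0.
Proof.
move=> lm u0; apply: (pi_neq0 (v := src l)).
have [pp _] := ck_proj sCK (src l).
have -> : s (idm L (src l)) = (s l)^#* ** ck_unit l m ** s m.
  by rewrite /ck_unit cmulA -cmulA !(ck_source sCK) -lm pp.
by rewrite 2!(star_homM hpi) u0 cmul0r cmul0l.
Qed.

(** The [s_l s_m^*] with [l] and [m] in a finite set of paths of degree [p] are
    matrix units, and their images are nonzero. *)
Lemma ck_span_isometric p a : ck_span p p a -> rnorm a <= rnorm (pi a).
Proof.
move=> [r [rP ->]].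
pose V := undup ([seq x.2.1 | x <- r] ++ [seq x.2.2 | x <- r]).
pose f := tnth (in_tuple V); pose sim i j := src (f i) == src (f j).
have sim_equiv : equivalence_rel sim.
  by move=> i j h; split=> [|/eqP ij]; rewrite /sim ?eqxx ?ij.
have fV x : x \in V -> exists i, f i = x.
  move=> xV; have lt_x : (index x V < size V)%N by rewrite index_mem.
  by exists (Ordinal lt_x); rewrite /f (tnth_nth x) /= nth_index.
have deg_f i : deg (f i) = p.
  have : f i \in V by apply: mem_tnth.
  rewrite mem_undup mem_cat => /orP[] /mapP[x xr ->].
    by have /andP[/eqP] := allP rP x xr.
  by have /andP[_ /eqP] := allP rP x xr.
have f_inj : injective f.
  move=> i j; rewrite /f !(tnth_nth (f i)) => /eqP.
  by rewrite nth_uniq ?undup_uniq //= => /eqP/val_inj.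
pose E i j := ck_unit (f i) (f j); pose F i j := pi (E i j).
have EM : matrix_units sim E.
  split=> [i j|i j h l ij hl]; first exact: ck_unit_adj.
  by rewrite ck_unit_mul ?deg_f // (inj_eq f_inj) (ij : src (f i) == src (f j)) andbT.
have FM : matrix_units sim F.
  split=> [i j|i j h l ij hl]; rewrite /F; first by rewrite -(star_homJ hpi) (mu_adj EM).
  by rewrite -(star_homM hpi) (mu_mul EM) //; case: eqP; rewrite ?(star_hom0 hpi).
have F0 i j : sim i j -> F i j <> 0 by move=> /eqP ij; apply: pi_unit_neq0.
have [c bc ->] : exists2 c, block_matrix sim c &
    \sum_(x <- r) x.1 *: ck_unit x.2.1 x.2.2 = mu_comb E c.
  have comb (r' : seq (R[i] * (mor L * mor L))) : {subset r' <= r} -> exists2 c, block_matrix sim c &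
      \sum_(x <- r') x.1 *: ck_unit x.2.1 x.2.2 = mu_comb E c.
    elim: r' => [|x r' IH] sub.
      exists 0; first by move=> i j _; rewrite mxE.
      by rewrite big_nil mu_comb0.
    have [|c bc e] := IH; first by move=> y yr; apply: sub; rewrite in_cons yr orbT.
    rewrite big_cons {}e.
    suff [d bd ->] : exists2 d, block_matrix sim d & ck_unit x.2.1 x.2.2 = mu_comb E d.
      exists (x.1 *: d + c); last by rewrite mu_combD mu_combZ.
      by apply: block_matrixD => //; apply: block_matrixZ.
    have xr : x \in r by apply: sub; rewrite mem_head.
    have [i fi] : exists i, f i = x.2.1.
      by apply: fV; rewrite mem_undup mem_cat; apply/orP; left; apply: map_f.
    have [j fj] : exists j, f j = x.2.2.
      by apply: fV; rewrite mem_undup mem_cat; apply/orP; right; apply: map_f.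
    have [ij|ij] := boolP (sim i j); last first.
      exists 0; first by move=> ? ? _; rewrite mxE.
      by rewrite mu_comb0 -fi -fj ck_unit_eq0.
    exists (delta_mx i j).
      move=> i' j' ij'; rewrite mxE; case: eqP => //= i'i; case: eqP => //= j'j.
      by rewrite i'i j'j ij in ij'.
    rewrite /mu_comb (bigD1 i) //= (bigD1 j) //= mxE !eqxx scale1r.
    rewrite big1 => [|j' jj]; last by rewrite mxE (negbTE jj) andbF scale0r.
    rewrite big1 => [|i' ii]; first by rewrite !addr0 /E fi fj.
    by rewrite big1 // => j' _; rewrite mxE (negbTE ii) scale0r.
  exact: comb.
have -> : pi (mu_comb E c) = mu_comb F c.
  rewrite (star_hom_sum hpi); apply: eq_bigr => i _.
  by rewrite (star_hom_sum hpi); apply: eq_bigr => j _; rewrite (star_homZ hpi).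
exact: mu_comb_rnorm_le.
Qed.

(** By the C*-identity, since [a^* a] lies in the span of degrees [q], [q]. *)
Lemma ck_span_isometric_pq p q a : ck_span p q a -> rnorm a <= rnorm (pi a).
Proof.
move=> Sa; rewrite -(ler_pXn2r (_ : 0 < 2)%N) ?nnegrE ?rnorm_ge0 //.
rewrite -!rnorm_star -(star_homJ hpi) -(star_homM hpi).
apply: (@ck_span_isometric q); exact: ck_spanM (ck_span_adj Sa) Sa.
Qed.

End Representation.
End CuntzKrieger.

(** * Averages over finite subgroups of the torus *)

Section RootsOfUnity.
Variable R : realType.

Definition dyadic_order M := (2 ^ M.+1)%N.
(** Iterated square roots of -1 are primitive roots of unity. *)
Definition dyadic_root M : R[i] := iter M (fun z => sqrtC z) (-1).

Lemma dyadic_rootN1 M : dyadic_root M ^+ (2 ^ M) = -1.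
Proof.
elim: M => [|M IH]; first by rewrite expr1.
by rewrite expnS exprM /dyadic_root iterS sqrtCK.
Qed.

Lemma dyadic_root_order M : dyadic_root M ^+ dyadic_order M = 1.
Proof. by rewrite /dyadic_order expnS mulnC exprM dyadic_rootN1 sqrrN expr1n. Qed.

Lemma dyadic_root_prim M : (dyadic_order M).-primitive_root (dyadic_root M).
Proof.
have N_gt0 : (0 < dyadic_order M)%N by rewrite expn_gt0.
have [n n_prim n_dvd] := prim_order_exists N_gt0 (dyadic_root_order M).
have /(dvdn_pfactor n M.+1)-/(_ isT)[j] := n_dvd.
rewrite leq_eqVlt => /orP[/eqP->|j_lt] nE; first by rewrite /dyadic_order -nE.
have /eqP : dyadic_root M ^+ (2 ^ M) = 1.
  by apply/eqP; rewrite -(prim_order_dvd n_prim) nE dvdn_exp2l.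
by rewrite dyadic_rootN1 eq_sym -subr_eq0 opprK (pnatr_eq0 _ 2).
Qed.

Lemma rnorm_unity (z : R[i]) n : (0 < n)%N -> z ^+ n = 1 -> rnorm z = 1.
Proof.
move=> n0 zn; apply: complexI; rewrite -rnormE; apply/eqP.
by rewrite -(pexpr_eq1 n0) // -normrX zn normr1.
Qed.

Lemma unit_mul_conj (z : R[i]) : rnorm z = 1 -> z * z^*%C = 1.
Proof. by move=> z1; rewrite -sqr_normc rnormE z1 expr1n. Qed.

Lemma dyadic_root_orthogonal M m n : (m < dyadic_order M)%N ->
  (n < dyadic_order M)%N ->
  \sum_(a < dyadic_order M)
     (dyadic_root M ^+ a) ^+ m * ((dyadic_root M ^+ a) ^+ n)^*%C =
  if m == n then (dyadic_order M)%:R else 0.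
Proof.
move=> mN nN; set z := dyadic_root M; pose w := z ^+ m * (z ^+ n)^*%C.
have z1 : rnorm z = 1 by apply: rnorm_unity (dyadic_root_order M); rewrite expn_gt0.
have term a : (z ^+ a) ^+ m * ((z ^+ a) ^+ n)^*%C = w ^+ a.
  by rewrite /w exprMn -rmorphXn /= -!exprM !(mulnC a).
under eq_bigr => a _ do rewrite term.
have n1 : rnorm (z ^+ n) = 1.
  apply: (rnorm_unity (n := dyadic_order M)); first by rewrite expn_gt0.
  by rewrite exprAC dyadic_root_order expr1n.
case: eqP => [mn|mn].
  have -> : w = 1 by rewrite /w mn unit_mul_conj.
  by under eq_bigr => a _ do rewrite expr1n; rewrite sumr_const card_ord.
have w1 : w != 1.
  apply: contra_notN mn => /eqP w1.
  have : z ^+ m == z ^+ n.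
    by rewrite -[z ^+ n]mul1r -w1 /w -mulrA [_^*%C * _]mulrC unit_mul_conj ?mulr1.
  rewrite (eq_prim_root_expr (dyadic_root_prim M)).
  by rewrite !modn_small // => /eqP.
have wN : w ^+ dyadic_order M = 1.
  rewrite /w exprMn -rmorphXn /= -!exprM !(mulnC _ (dyadic_order M)) !exprM.
  by rewrite dyadic_root_order !expr1n rmorph1 mulr1.
have := subrX1 w (dyadic_order M); rewrite wN subrr => /esym/eqP.
by rewrite mulf_eq0 subr_eq0 (negbTE w1) => /eqP.
Qed.

End RootsOfUnity.

Section GridAverages.
Variables (R : realType) (k : nat).
Implicit Types (t : torus R k) (m n : {ffun 'I_k -> nat}).

Definition tcoord t (l : 'I_k) : R[i] := \val t ord0 l.

Lemma rnorm_tcoord t l : rnorm (tcoord t l) = 1.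
Proof. by have := set_mem (valP t) l; rewrite /tcoord rnormE => -[]. Qed.

Notation index M := {ffun 'I_k -> 'I_(dyadic_order M)}.

Lemma grid_subproof M (f : index M) :
  (\row_l (dyadic_root R M ^+ f l)) \in torus_set R k.
Proof.
apply/mem_set => l; rewrite mxE normrX rnormE.
rewrite (rnorm_unity _ (dyadic_root_order R M)) ?expn_gt0 //.
by rewrite expr1n.
Qed.

Definition grid M (f : index M) : torus R k := SigSub (grid_subproof f).

Lemma torus_oneE l : tcoord (torus_one R k) l = 1.
Proof. by rewrite /tcoord /= mxE. Qed.

Lemma tcoord_grid M (f : index M) l : tcoord (grid f) l = dyadic_root R M ^+ f l.
Proof. by rewrite /tcoord /= mxE. Qed.

Definition grid_card M : nat := (dyadic_order M ^ k)%N.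

Lemma grid_card_gt0 M : 0 < (grid_card M)%:R :> R.
Proof. by rewrite ltr0n !expn_gt0. Qed.

Lemma card_index M : #|{: index M}| = grid_card M.
Proof. by rewrite card_ffun !card_ord. Qed.

(** The average over the points of order dividing [dyadic_order M] replaces the
    Haar integral: it is exact on monomials of degree less than that order. *)
Definition mean M (V : lmodType R[i]) (F : torus R k -> V) : V :=
  (grid_card M)%:R^-1 *: \sum_(f : index M) F (grid f).

Definition rmean M (h : torus R k -> R) : R :=
  (grid_card M)%:R^-1 * \sum_(f : index M) h (grid f).

(** The character [t^(m - n)]; exponents are kept as pairs because degrees are
    natural numbers. *)
Definition monomial t m n : R[i] := torus_pow t m * (torus_pow t n)^*%C.

Lemma torus_powE t m : torus_pow t m = \prod_l tcoord t l ^+ m l.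
Proof. by []. Qed.

Lemma sum_monomial M m n : (forall l, (m l < dyadic_order M)%N) ->
  (forall l, (n l < dyadic_order M)%N) ->
  \sum_(f : index M) monomial (grid f) m n =
  if m == n then (grid_card M)%:R else 0.
Proof.
move=> mN nN.
transitivity (\prod_(l < k) \sum_(a < dyadic_order M)
   (dyadic_root R M ^+ a) ^+ m l * ((dyadic_root R M ^+ a) ^+ n l)^*%C).
  rewrite bigA_distr_bigA; apply: eq_bigr => f _.
  rewrite /monomial !torus_powE rmorph_prod -big_split.
  by apply: eq_bigr => l _; rewrite tcoord_grid.
under eq_bigr => l _ do rewrite dyadic_root_orthogonal //.
case: eqP => [->|mn].
  under eq_bigr => l _ do rewrite eqxx.
  by rewrite prodr_const card_ord -natrX.
have [l ml] : exists l, m l != n l.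
  apply/existsP; rewrite -negb_forall; apply: contra_notN mn => /forallP mn.
  by apply/ffunP => l; apply/eqP.
by rewrite (bigD1 l) //= (negbTE ml) mul0r.
Qed.

Lemma mean_monomial M (V : lmodType R[i]) m n (a : V) :
  (forall l, (m l < dyadic_order M)%N) ->
  (forall l, (n l < dyadic_order M)%N) ->
  mean M (fun t => monomial t m n *: a) = if m == n then a else 0.
Proof.
move=> mN nN; rewrite /mean -scaler_suml sum_monomial //.
case: eqP => _; last by rewrite scale0r scaler0.
by rewrite scalerA mulVf ?scale1r // pnatr_eq0 -lt0n !expn_gt0.
Qed.

Lemma rnorm_mean_le M (V : normedModType R[i]) (F : torus R k -> V) :
  rnorm (mean M F) <= rmean M (fun t => rnorm (F t)).
Proof.
rewrite /mean /rmean rnormZ.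
have -> : rnorm ((grid_card M)%:R^-1 : R[i]) = (grid_card M)%:R^-1 :> R.
  have -> : (grid_card M)%:R^-1 = ((grid_card M)%:R^-1)%:C :> R[i].
    by rewrite fmorphV rmorph_nat.
  by rewrite rnorm_real ger0_norm // invr_ge0.
by rewrite ler_wpM2l ?invr_ge0 // rnorm_sum.
Qed.

Lemma rmean_le M (h h' : torus R k -> R) : (forall t, h t <= h' t) ->
  rmean M h <= rmean M h'.
Proof. by move=> hh; rewrite ler_wpM2l ?invr_ge0 // ler_sum. Qed.

Lemma rmean_cst M c : rmean M (fun=> c) = c.
Proof.
rewrite /rmean sumr_const card_index -[c *+ _]mulr_natl mulrA mulVf ?mul1r //.
by rewrite lt0r_neq0 // grid_card_gt0.
Qed.

Lemma rmeanD M h h' : rmean M (fun t => h t + h' t) = rmean M h + rmean M h'.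
Proof. by rewrite /rmean big_split mulrDr. Qed.

Lemma rmeanZ M c h : rmean M (fun t => c * h t) = c * rmean M h.
Proof. by rewrite /rmean -mulr_sumr mulrCA. Qed.

Lemma rmean_sum M (I : Type) (r : seq I) (h : I -> torus R k -> R) :
  rmean M (fun t => \sum_(i <- r) h i t) = \sum_(i <- r) rmean M (h i).
Proof. by rewrite /rmean exchange_big mulr_sumr. Qed.

Lemma rmean_prod M (h : 'I_k -> R[i] -> R) :
  rmean M (fun t => \prod_l h l (tcoord t l)) =
  \prod_l ((dyadic_order M)%:R^-1 *
           \sum_(a < dyadic_order M) h l (dyadic_root R M ^+ a)).
Proof.
rewrite big_split prodr_const card_ord exprVn -natrX /rmean /=; congr (_ * _).
rewrite bigA_distr_bigA; apply: eq_bigr => f _.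
by apply: eq_bigr => l _; rewrite tcoord_grid.
Qed.


End GridAverages.

(** * The Fejer kernel *)

Section Fejer.
Variable R : realType.

Definition fejer n (z : R[i]) : R := rnorm (\sum_(a < n) z ^+ a) ^+ 2 / n%:R.

Lemma fejer_ge0 n z : 0 <= fejer n z.
Proof. by rewrite divr_ge0 // sqr_ge0. Qed.

Lemma fejerE n z : (fejer n z)%:C =
  n%:R^-1 * ((\sum_(a < n) z ^+ a) * (\sum_(a < n) z ^+ a)^*%C).
Proof.
by rewrite -sqr_normc rnormE rmorphM fmorphV rmorph_nat rmorphXn mulrC.
Qed.

Lemma mean_fejer n M : (0 < n <= dyadic_order M)%N ->
  (dyadic_order M)%:R^-1 * \sum_(a < dyadic_order M) fejer n (dyadic_root R M ^+ a)
  = 1.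
Proof.
move=> /andP[n0 nN]; apply: complexI; rewrite rmorphM fmorphV rmorph_nat rmorph_sum.
have -> : \sum_(a < dyadic_order M) (fejer n (dyadic_root R M ^+ a))%:C =
    n%:R^-1 * \sum_(i < n) \sum_(j < n) (if i == j then (dyadic_order M)%:R else 0).
  under eq_bigr => a _ do rewrite fejerE.
  rewrite -mulr_sumr; congr (_ * _).
  under eq_bigr => a _ do rewrite rmorph_sum mulr_suml.
  rewrite exchange_big; apply: eq_bigr => i _.
  under eq_bigr => a _ do rewrite mulr_sumr.
  rewrite exchange_big; apply: eq_bigr => j _.
  by rewrite dyadic_root_orthogonal // (leq_trans (ltn_ord _)).
have -> : \sum_(i < n) \sum_(j < n) (if i == j then (dyadic_order M)%:R else 0)
    = n%:R * (dyadic_order M)%:R :> R[i].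
  rewrite mulr_natl -[in RHS](card_ord n) -sumr_const; apply: eq_bigr => i _.
  rewrite (bigD1 i) //= eqxx big1 ?addr0 // => j ji.
  by rewrite eq_sym (negbTE ji).
by field; rewrite !pnatr_eq0 -!lt0n n0 expn_gt0.
Qed.

Lemma fejer_dist_le n (z : R[i]) : (0 < n)%N -> rnorm z = 1 ->
  fejer n z * rnorm (z - 1) ^+ 2 <= 4 / n%:R.
Proof.
move=> n0 z1; rewrite /fejer mulrAC ler_pM2r ?invr_gt0 ?ltr0n //.
rewrite -exprMn mulrC -rnorm_complexM -subrX1.
have le2 : rnorm (z ^+ n - 1) <= 2.
  have zn1 : rnorm (z ^+ n) = 1.
    by apply: complexI; rewrite -rnormE normrX rnormE z1 expr1n.
  by apply: le_trans (rnormD _ _) _; rewrite rnormN zn1 rnorm1.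
by have := rnorm_ge0 (z ^+ n - 1); nra.
Qed.

Variable k : nat.
Implicit Types t : torus R k.

Definition fejer_kernel n t : R := \prod_l fejer n (tcoord t l).

Lemma fejer_kernel_ge0 n t : 0 <= fejer_kernel n t.
Proof. by apply: prodr_ge0 => l _; apply: fejer_ge0. Qed.

Lemma rmean_fejer_kernel n M : (0 < n <= dyadic_order M)%N ->
  rmean M (@fejer_kernel n) = 1.
Proof.
move=> nM; rewrite /fejer_kernel (rmean_prod M (fun _ => fejer n)).
by rewrite big1 // => l _; apply: mean_fejer.
Qed.

(** The mass of the kernel concentrates at 1: as
    [(1 + z + ... + z^(n-1)) (z - 1) = z^n - 1], one factor of the kernel times
    [|z - 1|^2] is at most [4 / n]. *)
Lemma rmean_fejer_kernel_dist n M l : (0 < n <= dyadic_order M)%N ->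
  rmean M (fun t => fejer_kernel n t * rnorm (tcoord t l - 1) ^+ 2) <= 4 / n%:R.
Proof.
move=> nM; have /andP[n0 _] := nM.
pose h (l' : 'I_k) z := if l' == l then 1 else fejer n z.
apply: (@le_trans _ _ (rmean M (fun t => 4 / n%:R * \prod_l' h l' (tcoord t l')))).
  apply: rmean_le => t; rewrite /fejer_kernel (bigD1 l) //= mulrAC.
  rewrite [X in _ <= _ * X](bigD1 l) //= {1}/h eqxx mul1r.
  have -> : \prod_(l' | l' != l) h l' (tcoord t l') =
            \prod_(l' | l' != l) fejer n (tcoord t l').
    by apply: eq_bigr => l' ll; rewrite /h (negbTE ll).
  rewrite ler_wpM2r ?fejer_dist_le ?rnorm_tcoord //.
  by apply: prodr_ge0 => l' _; apply: fejer_ge0.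
rewrite rmeanZ rmean_prod big1 ?mulr1 // => l' _; rewrite /h.
case: eqP => _; last exact: mean_fejer.
by rewrite sumr_const card_ord mulVf // pnatr_eq0 -lt0n expn_gt0.
Qed.

Definition exponent n (f : {ffun 'I_k -> 'I_n}) : {ffun 'I_k -> nat} :=
  [ffun l => val (f l)].

Lemma fejer_kernelE n t : (fejer_kernel n t)%:C = (n ^ k)%:R^-1 *
  \sum_(f : {ffun 'I_k -> 'I_n}) \sum_(g : {ffun 'I_k -> 'I_n})
     monomial t (exponent f) (exponent g).
Proof.
have geom : \prod_l \sum_(a < n) tcoord t l ^+ a =
    \sum_(f : {ffun 'I_k -> 'I_n}) torus_pow t (exponent f).
  rewrite bigA_distr_bigA; apply: eq_bigr => f _.
  by rewrite torus_powE; apply: eq_bigr => l _; rewrite ffunE.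
have -> : (fejer_kernel n t)%:C = \prod_l (n%:R^-1 *
    ((\sum_(a < n) tcoord t l ^+ a) * (\sum_(a < n) tcoord t l ^+ a)^*%C)).
  by rewrite rmorph_prod; apply: eq_bigr => l _; apply: fejerE.
rewrite !big_split /= prodr_const card_ord exprVn -natrX -rmorph_prod geom.
rewrite rmorph_sum mulr_suml; congr (_ * _); apply: eq_bigr => f _.
by rewrite mulr_sumr.
Qed.

Lemma mean_fejer_kernel n M (V : lmodType R[i]) (F : torus R k -> V) :
  mean M (fun t => (fejer_kernel n t)%:C *: F t) = (n ^ k)%:R^-1 *:
    \sum_(f : {ffun 'I_k -> 'I_n}) \sum_(g : {ffun 'I_k -> 'I_n})
       mean M (fun t => monomial t (exponent f) (exponent g) *: F t).
Proof.
rewrite /mean; under eq_bigr => f _ do rewrite fejer_kernelE -scalerA.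
rewrite -scaler_sumr scalerA mulrC -scalerA; congr (_ *: _).
under [RHS]eq_bigr => f _ do rewrite -scaler_sumr.
rewrite -scaler_sumr; congr (_ *: _).
under eq_bigr => f _ do rewrite scaler_suml.
rewrite exchange_big; apply: eq_bigr => f _.
under eq_bigr => g _ do rewrite scaler_suml.
by rewrite exchange_big.
Qed.

(** Fejer's theorem in its weakest form: a bounded function on the torus that
    is continuous at 1 and has vanishing Fourier coefficients vanishes at 1.
    The Fourier coefficients enter as limits of averages over finite
    subgroups. *)
Lemma fejer_vanish (A : cstarAlgType R) (F : torus R k -> A) (C : R) :
  (forall t, rnorm (F t) <= C) ->
  (forall e : R, 0 < e -> exists2 d : R, 0 < d & forall t,
     (forall l, rnorm (tcoord t l - 1) <= d) ->
     rnorm (F t - F (torus_one R k)) <= e) ->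
  (forall m n, tends_to (fun M => mean M (fun t => monomial t m n *: F t)) 0) ->
  F (torus_one R k) = 0.
Proof.
move=> FC Fcont F0; set F1 := F _ in Fcont *.
have C0 : 0 <= C by apply: le_trans (FC (torus_one R k)); apply: rnorm_ge0.
apply: rnorm_small_eq0 => e e0.
have [e3 e30 e3E] : exists2 x, 0 < x & e = x + x + x.
  by exists (e / 3); [rewrite divr_gt0|field].
have [d d0 Fd] := Fcont e3 e30; pose c := 2 * C / d ^+ 2.
have d20 : 0 < d ^+ 2 by rewrite exprn_gt0.
have c0 : 0 <= c by rewrite divr_ge0 ?mulr_ge0 // ltW.
(* Away from 1 some [|t_l - 1|] exceeds [d], and the trivial bound [2 C] is
   absorbed by the second term; the kernel then averages this term. *)
have pointwise t : rnorm (F t - F1) <=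
    e3 + c * \sum_l rnorm (tcoord t l - 1) ^+ 2.
  have sum0 (P : pred 'I_k) : 0 <= \sum_(l | P l) rnorm (tcoord t l - 1) ^+ 2.
    by apply: sumr_ge0 => l _; apply: sqr_ge0.
  have [/forallP near1|] := boolP [forall l, rnorm (tcoord t l - 1) <= d].
    by apply: le_trans (Fd t near1) _; rewrite lerDl mulr_ge0.
  rewrite negb_forall => /existsP[l]; rewrite -ltNge => dl.
  have le_d : d ^+ 2 <= \sum_l rnorm (tcoord t l - 1) ^+ 2.
    rewrite (bigD1 l) //=; apply: le_trans (_ : rnorm (tcoord t l - 1) ^+ 2 <= _).
      by apply: lerXn2r; rewrite ?nnegrE ?rnorm_ge0 ?(ltW d0) ?(ltW dl).
    by rewrite lerDl.
  apply: le_trans (_ : 2 * C <= _).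
    apply: le_trans (rnormD _ _) _; rewrite rnormN.
    by have := FC t; have := FC (torus_one R k); rewrite -/F1; lra.
  apply: le_trans (_ : c * d ^+ 2 <= _); first by rewrite /c divfK // lt0r_neq0.
  by apply: le_trans (ler_wpM2l c0 le_d) _; rewrite lerDr ltW.
have [n n0 nP] : exists2 n : nat, (0 < n)%N & c * (k%:R * (4 / n%:R)) <= e3.
  pose x := c * (k%:R * 4) / e3; exists (Num.truncn x).+1 => //.
  have := ltW (Num.Theory.truncnS_gt x).
  by rewrite {1}/x ler_pdivrMr // !mulrA ler_pdivrMr // [e3 * _]mulrC.
have [N NP] : exists N, forall M, (N <= M)%N ->
    rnorm (mean M (fun t => (fejer_kernel n t)%:C *: F t)) <= e3.
  have : tends_to (fun M => mean M (fun t => (fejer_kernel n t)%:C *: F t)) 0.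
    have -> : (0 : A) = (n ^ k)%:R^-1 *: \sum_(f : {ffun 'I_k -> 'I_n})
       \sum_(g : {ffun 'I_k -> 'I_n}) 0.
      by rewrite big1 ?scaler0 // => f _; rewrite big1.
    apply: (tends_to_eq (fun M => esym (mean_fejer_kernel n M F))).
    apply: tends_toZ; apply: tends_to_sum => f; apply: tends_to_sum => g.
    exact: F0.
  by move=> /(_ e3 e30)[N NP]; exists N => M /NP; rewrite subr0.
pose M := maxn N n.
have nM : (0 < n <= dyadic_order M)%N.
  rewrite n0 (leq_trans (leq_maxr N n)) // ltnW // (leq_trans (ltn_expl _ (ltnSn 1))) //.
  by rewrite leq_exp2l.
have mean1 : mean M (fun t => (fejer_kernel n t)%:C *: F1) = F1.
  rewrite /mean -scaler_suml scalerA -(rmorph_nat (real_complex R)) -fmorphV.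
  rewrite -rmorph_sum -rmorphM /=.
  by have := rmean_fejer_kernel nM; rewrite /rmean => ->; rewrite scale1r.
have meanB : mean M (fun t => (fejer_kernel n t)%:C *: F1) -
    mean M (fun t => (fejer_kernel n t)%:C *: F t) =
    mean M (fun t => (fejer_kernel n t)%:C *: (F1 - F t)).
  rewrite /mean -scalerBr -sumrB; congr (_ *: _).
  by apply: eq_bigr => f _; rewrite -scalerBr.
rewrite -mean1 -[X in rnorm X](subrK (mean M (fun t => (fejer_kernel n t)%:C *: F t))).
rewrite meanB; apply: le_trans (rnormD _ _) _.
have NM : (N <= M)%N by apply: leq_maxl.
have le1 := NP M NM.
suff le2 : rnorm (mean M (fun t => (fejer_kernel n t)%:C *: (F1 - F t))) <= e3 + e3.
  by move: le1 le2; rewrite e3E; lra.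
apply: le_trans (rnorm_mean_le _ _) _.
apply: (@le_trans _ _ (rmean M (fun t => e3 * fejer_kernel n t +
  c * \sum_l fejer_kernel n t * rnorm (tcoord t l - 1) ^+ 2))).
  apply: rmean_le => t; rewrite rnormZ rnorm_real ger0_norm ?fejer_kernel_ge0 //.
  rewrite -mulr_sumr mulrCA [e3 * _]mulrC -mulrDr ler_wpM2l ?fejer_kernel_ge0 //.
  by rewrite rdistC.
rewrite rmeanD !rmeanZ rmean_fejer_kernel // mulr1 lerD2l rmean_sum.
apply: le_trans nP; rewrite ler_wpM2l //.
apply: le_trans (_ : \sum_(l < k) (4 / n%:R) <= _).
  by apply: ler_sum => l _; apply: rmean_fejer_kernel_dist.
by rewrite sumr_const card_ord -[X in X <= _]mulr_natl.
Qed.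

End Fejer.

(** * Gauge-invariant uniqueness *)

Lemma torus_action_continuous1 (R : realType) (k : nat) (A : cstarAlgType R)
    (gamma : torus_action k A) (a : A) (e : R) : 0 < e ->
  exists2 d : R, 0 < d & forall t,
    (forall l, rnorm (tcoord t l - 1) <= d) ->
    rnorm (gamma t a - gamma (torus_one R k) a) <= e.
Proof.
move=> e0; have e0' : 0 < e%:C by rewrite ltcR.
have cont := @tact_continuous _ _ _ gamma a (torus_one R k).
have : \forall t \near torus_one R k,
    `|gamma (torus_one R k) a - gamma t a| <= e%:C.
  exact: (iffLR (cvgrPdist_le _ _) cont).
move=> [_ [[U Uopen <-] U1 Usub]].
have : nbhs (\val (torus_one R k) : 'rV[R[i]^o]_k) U by apply: open_nbhs_nbhs.
move=> /nbhs_ballP[r /= r0 rU].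
have rE : r = (complex.Re r)%:C by rewrite RRe_real // realE ltW.
have re0 : 0 < complex.Re r by move: r0; rewrite rE ltcR.
exists (complex.Re r / 2); first by rewrite divr_gt0.
move=> t near1; have : `|gamma (torus_one R k) a - gamma t a| <= e%:C.
  apply: Usub; apply: rU; split=> // i j; rewrite ord1 -ball_normE /=.
  change (`|tcoord (torus_one R k) j - tcoord t j| < r).
  rewrite torus_oneE rnormE rE ltcR rdistC.
  apply: le_lt_trans (near1 j) _.
  by rewrite ltr_pdivrMr // ltr_pMr // ltr1n.
by rewrite rnormE lecR rdistC.
Qed.

Section FourierCoefficients.
Variables (R : realType) (k : nat).
Implicit Types (m n p q : {ffun 'I_k -> nat}).

Lemma rnorm_monomial (t : torus R k) m n : rnorm (monomial t m n) = 1.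
Proof.
have pow1 p : rnorm (torus_pow t p) = 1.
  apply: complexI; rewrite -rnormE torus_powE normr_prod big1 // => l _.
  by rewrite normrX rnormE rnorm_tcoord expr1n.
by rewrite /monomial rnorm_complexM rnorm_conj !pow1 mulr1.
Qed.

Lemma monomialD (t : torus R k) m n p q :
  monomial t m n * monomial t p q = monomial t (m + p) (n + q).
Proof.
have powD x y : torus_pow t (x + y) = torus_pow t x * torus_pow t y.
  rewrite !torus_powE -big_split; apply: eq_bigr => l _.
  by rewrite ffunE exprD.
by rewrite /monomial !powD rmorphM mulrACA.
Qed.

Variables (A : cstarAlgType R) (gamma : torus_action k A).

(** The Fourier coefficient of [t |-> gamma t a] at the character
    [t^(n - m)], averaged over a finite subgroup. *)
Definition fourier M m n (a : A) : A :=
  mean M (fun t => monomial t m n *: gamma t a).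

Lemma fourierD M m n a b : fourier M m n (a + b) = fourier M m n a + fourier M m n b.
Proof.
rewrite /fourier /mean -scalerDr -big_split; congr (_ *: _).
by apply: eq_bigr => f _; rewrite (star_homD (tact_star_hom gamma _)) scalerDr.
Qed.

Lemma fourierZ M m n z a : fourier M m n (z *: a) = z *: fourier M m n a.
Proof.
rewrite /fourier /mean [RHS]scalerA [z * _]mulrC -[RHS]scalerA [in RHS]scaler_sumr.
congr (_ *: _).
apply: eq_bigr => f _; rewrite (star_homZ (tact_star_hom gamma _)) !scalerA.
by rewrite [z * _]mulrC.
Qed.

Lemma fourierB M m n a b : fourier M m n (a - b) = fourier M m n a - fourier M m n b.
Proof. by rewrite fourierD -scaleN1r fourierZ scaleN1r. Qed.

Lemma rnorm_fourier_le M m n a : rnorm (fourier M m n a) <= rnorm a.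
Proof.
apply: le_trans (rnorm_mean_le _ _) _.
rewrite -[leRHS](@rmean_cst R k M); apply: rmean_le => t.
rewrite rnormZ rnorm_monomial mul1r.
exact: star_hom_contractive (tact_star_hom gamma t).
Qed.

Lemma fourier_eq0 a : (forall m n, tends_to (fun M => fourier M m n a) 0) -> a = 0.
Proof.
move=> a0; rewrite -[a](tact_one gamma).
apply: (@fejer_vanish R k A (gamma^~ a) (rnorm a)) => //.
  by move=> t; apply: star_hom_contractive (tact_star_hom gamma t).
by move=> e e0; apply: torus_action_continuous1.
Qed.

End FourierCoefficients.

Lemma fourier_hom (R : realType) (k : nat) (A B : cstarAlgType R)
    (alpha : torus_action k A) (beta : torus_action k B) (pi : A -> B) M
    (m n : {ffun 'I_k -> nat}) a :
  star_hom pi -> (forall t a, pi (alpha t a) = beta t (pi a)) ->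
  pi (fourier alpha M m n a) = fourier beta M m n (pi a).
Proof.
move=> hpi hbeta; rewrite /fourier /mean (star_homZ hpi) (star_hom_sum hpi).
by congr (_ *: _); apply: eq_bigr => f _; rewrite (star_homZ hpi) hbeta.
Qed.

Section GaugeInvariantUniqueness.
Variables (R : realType) (k : nat) (L : kgraph k).
Hypothesis hL : row_finite_no_sources L.
Variables (A : cstarAlgType R) (s : mor L -> A).
Hypothesis sA : universal_ck s.
Variable alpha : torus_action k A.
Hypothesis gauge : gauge_action s alpha.
Implicit Types (m n p q : {ffun 'I_k -> nat}).

Let sCK : ck_family s := univ_family sA.

(** Finite sums in which each summand has fixed degrees. *)
Inductive ck_dense : A -> Prop :=
| CkDense0 : ck_dense 0
| CkDenseD p q x a : ck_span s p q x -> ck_dense a -> ck_dense (x + a).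

Lemma ck_dense_span p q x : ck_span s p q x -> ck_dense x.
Proof. by move=> Sx; rewrite -[x]addr0; apply: CkDenseD Sx CkDense0. Qed.

Lemma ck_denseD a b : ck_dense a -> ck_dense b -> ck_dense (a + b).
Proof.
move=> Da Db; elim: Da => [|p q x {}a Sx _ IH]; first by rewrite add0r.
by rewrite -addrA; apply: CkDenseD Sx IH.
Qed.

Lemma ck_denseZ z a : ck_dense a -> ck_dense (z *: a).
Proof.
elim=> [|p q x {}a Sx _ IH]; first by rewrite scaler0; apply: CkDense0.
by rewrite scalerDr; apply: CkDenseD IH; apply: (ck_spanZ z Sx).
Qed.

Lemma ck_dense_adj a : ck_dense a -> ck_dense a^#*.
Proof.
elim=> [|p q x {}a Sx _ IH]; first by rewrite cadj0; apply: CkDense0.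
by rewrite cadjD; apply: CkDenseD IH; apply: (ck_span_adj Sx).
Qed.

Lemma ck_denseM a b : ck_dense a -> ck_dense b -> ck_dense (a ** b).
Proof.
move=> Da Db; elim: Da => [|p q x {}a Sx _ IH]; first by rewrite cmul0l; apply: CkDense0.
rewrite cmulDl; apply: ck_denseD IH => {a}.
elim: Db => [|p' q' y {}b Sy _ IH]; first by rewrite cmul0r; apply: CkDense0.
rewrite cmulDr; apply: ck_denseD IH.
have Sx' := ck_span_expand hL sCK p' Sx; have Sy' := ck_span_expand hL sCK q Sy.
rewrite [q + p']addrC in Sx'.
exact: ck_dense_span (ck_spanM hL sCK Sx' Sy').
Qed.

(** The closure of the span is a C*-subalgebra containing the generators. *)
Lemma ck_dense_approx a (e : R) : 0 < e ->
  exists2 d, ck_dense d & rnorm (a - d) <= e.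
Proof.
pose S := [set a | forall e : R, 0 < e ->
  exists2 d, ck_dense d & rnorm (a - d) <= e].
suff ST : S = setT by move: a e; rewrite -/(forall a, S a) => a; rewrite ST.
apply: (univ_generated sA) => [|l e0 e00]; last first.
  exists (s l); last by rewrite subrr rnorm0 ltW.
  have -> : s l = ck_unit s l (idm L (src l)).
    have [_ e1] := ck_proj sCK (src l).
    by rewrite /ck_unit e1 (ck_src sCK).
  exact: ck_dense_span (ck_span_unit s erefl erefl).
split.
- split; last by exists 0; [apply: CkDense0|rewrite subrr rnorm0 ltW].
  apply: tends_to_closed => u l Su ul e0 e00.
  have e20 : 0 < e0 / 2 by rewrite divr_gt0.
  have [N uN] := ul _ e20; have [d Dd ud] := Su N _ e20.
  exists d => //; apply: le_trans (rdist_triangle (u N) _ _) _.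
  have -> : e0 = e0 / 2 + e0 / 2 by field.
  by rewrite (rdistC l) lerD ?uN.
- move=> x y Sx Sy e0 e00; have e20 : 0 < e0 / 2 by rewrite divr_gt0.
  have [d Dd xd] := Sx _ e20; have [d' Dd' yd'] := Sy _ e20.
  exists (d + d'); first exact: ck_denseD.
  rewrite opprD addrACA; apply: le_trans (rnormD _ _) _.
  have -> : e0 = e0 / 2 + e0 / 2 by field.
  exact: lerD.
- move=> z x Sx e0 e00; have z1 : 0 < rnorm z + 1 by rewrite ltr_wpDl ?rnorm_ge0.
  have [d Dd xd] := Sx _ (divr_gt0 e00 z1).
  exists (z *: d); first exact: ck_denseZ.
  rewrite -scalerBr rnormZ; move: xd; rewrite ler_pdivlMr //.
  by have := rnorm_ge0 (x - d); have := rnorm_ge0 z; nra.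
- move=> x y Sx Sy e0 e00.
  have y1 : 0 < rnorm y + 1 by rewrite ltr_wpDl ?rnorm_ge0.
  have e20 : 0 < e0 / 2 by rewrite divr_gt0.
  have [d Dd xd] := Sx _ (divr_gt0 e20 y1).
  have d1 : 0 < rnorm d + 1 by rewrite ltr_wpDl ?rnorm_ge0.
  have [d' Dd' yd'] := Sy _ (divr_gt0 e20 d1).
  exists (d ** d'); first exact: ck_denseM.
  have -> : x ** y - d ** d' = (x - d) ** y + d ** (y - d').
    by rewrite cmulBl cmulBr addrA subrK.
  apply: le_trans (rnormD _ _) _.
  apply: le_trans (lerD (rnormM _ y) (rnormM d _)) _.
  move: xd yd'; rewrite !ler_pdivlMr //.
  by have := rnorm_ge0 (x - d); have := rnorm_ge0 (y - d'); lra.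
- move=> x Sx e0 e00; have [d Dd xd] := Sx _ e00.
  exists d^#*; first exact: ck_dense_adj.
  by rewrite -cadjB rnorm_adj.
Qed.

(** The elements of the span that [alpha] moves by the character [t^(n - m)];
    each lies in a single [ck_span], where [ck_span_isometric_pq] applies. *)
Definition ck_homogeneous m n (a : A) :=
  exists p q, m + p = n + q /\ ck_span s p q a.

Lemma ck_homogeneous0 m n : ck_homogeneous m n 0.
Proof. by exists n, m; split; [rewrite addrC|apply: ck_span0]. Qed.

Lemma ck_homogeneousD m n a b :
  ck_homogeneous m n a -> ck_homogeneous m n b -> ck_homogeneous m n (a + b).
Proof.
move=> [p [q [mp Sa]]] [p' [q' [mp' Sb]]]; exists (p + p'), (q + p').
split; first by rewrite !addrA mp.
apply: ck_spanD; first exact: ck_span_expand.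
have := ck_span_expand hL sCK p Sb; rewrite [p' + p]addrC [q' + p](_ : _ = q + p') //.
have /ffunP cancel_n : n + (q' + p) = n + (q + p').
  by rewrite addrA -mp' (addrAC m) mp -addrA.
by apply/ffunP => l; have := cancel_n l; rewrite !ffunE => /addnI.
Qed.

Lemma gauge_unit t l l' :
  alpha t (ck_unit s l l') = monomial t (deg l) (deg l') *: ck_unit s l l'.
Proof.
have ht := tact_star_hom alpha t.
rewrite /ck_unit (star_homM ht) (star_homJ ht) !gauge conjZ cmulZl cmulZr.
by rewrite scalerA.
Qed.

Lemma gauge_span p q t x : ck_span s p q x -> alpha t x = monomial t p q *: x.
Proof.
have ht := tact_star_hom alpha t.
move: x; apply: ck_span_ind => [|a b ha hb|z a ha|l l' <- <-].
- by rewrite (star_hom0 ht) scaler0.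
- by rewrite (star_homD ht) ha hb scalerDr.
- by rewrite (star_homZ ht) ha !scalerA mulrC.
- exact: gauge_unit.
Qed.

(** On the span the averages over large finite subgroups are the homogeneous
    components. *)
Lemma fourier_dense m n d : ck_dense d ->
  exists N, forall M, (N <= M)%N -> ck_homogeneous m n (fourier alpha M m n d).
Proof.
elim=> [|p q x a Sx _ [N IH]].
  exists 0%N => M _; have -> : fourier alpha M m n 0 = 0.
    by rewrite -[X in fourier _ _ _ _ X](scale0r (0 : A)) fourierZ scale0r.
  exact: ck_homogeneous0.
pose mp := m + p; pose nq := n + q; pose N' := (\sum_l (mp l + nq l))%N.
exists (maxn N N') => M; rewrite geq_max => /andP[NM N'M].
rewrite fourierD; apply: ck_homogeneousD; last exact: IH.
have bound l : (mp l + nq l < dyadic_order M)%N.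
  apply: leq_ltn_trans (_ : M < _)%N; last first.
    by rewrite (leq_trans (ltn_expl _ (ltnSn 1))) // leq_exp2l.
  by apply: leq_trans N'M; rewrite /N' (bigD1 l) //= leq_addr.
have -> : fourier alpha M m n x = mean M (fun t => monomial t mp nq *: x).
  rewrite /fourier /mean; congr (_ *: _); apply: eq_bigr => f _.
  by rewrite (gauge_span _ Sx) scalerA monomialD.
rewrite mean_monomial; last 2 first.
- by move=> l; apply: leq_ltn_trans (bound l); rewrite leq_addr.
- by move=> l; apply: leq_ltn_trans (bound l); rewrite leq_addl.
case: eqP => [mn|_]; last exact: ck_homogeneous0.
by exists p, q.
Qed.

Variables (B : cstarAlgType R) (pi : A -> B).
Hypothesis hpi : star_hom pi.
Variable beta : torus_action k B.
Hypothesis hbeta : forall t a, pi (alpha t a) = beta t (pi a).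

(** Let [pi a = 0].  For [d] in the span close to [a], the homogeneous components
    of [d] are small, because [pi] is isometric on them and commutes with taking
    Fourier coefficients.  Hence all Fourier coefficients of [a] vanish. *)
Lemma gauge_invariant_uniqueness :
  (forall v, pi (s (idm L v)) <> 0) -> injective pi.
Proof.
move=> pi_neq0; suff ker0 a : pi a = 0 -> a = 0.
  move=> a b ab; apply/subr0_eq/ker0.
  by rewrite (star_homD hpi) -scaleN1r (star_homZ hpi) scaleN1r ab subrr.
move=> a0; apply: (fourier_eq0 (gamma := alpha)) => m n e e0.
have e20 : 0 < e / 2 by rewrite divr_gt0.
have [d Dd ad] := ck_dense_approx a e20; have [N NP] := fourier_dense m n Dd.
exists N => M /NP[p [q [_ Sd]]]; rewrite subr0.
have pid : rnorm (pi d) <= e / 2.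
  have -> : pi d = pi (d - a).
    by rewrite (star_homD hpi) -scaleN1r (star_homZ hpi) a0 scaler0 addr0.
  by apply: le_trans (star_hom_contractive _ hpi) _; rewrite rdistC.
have small : rnorm (fourier alpha M m n d) <= e / 2.
  apply: le_trans (ck_span_isometric_pq hL sCK hpi pi_neq0 Sd) _.
  rewrite (fourier_hom _ _ _ _ hpi hbeta).
  exact: le_trans (rnorm_fourier_le _ _ _ _ _) pid.
rewrite -(subrK (fourier alpha M m n d) (fourier alpha M m n a)) -fourierB.
apply: le_trans (rnormD _ _) _; have -> : e = e / 2 + e / 2 by field.
by apply: lerD small; apply: le_trans (rnorm_fourier_le _ _ _ _ _) ad.
Qed.

End GaugeInvariantUniqueness.

(** * The C*-algebra of bounded operators on a Hilbert space *)

Section FilterCompleteness.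
Variables (R : realType) (V : normedModType R[i]).

(** In a normed space it is enough to test completeness on sequences: a Cauchy
    filter contains balls of radius [1/n] whose centres form a Cauchy sequence. *)
Lemma cauchy_filter_cvg : (forall u : nat -> V, cauchy_sequence u ->
    exists l, tends_to u l) ->
  forall F : set_system V, ProperFilter F -> cauchy F -> cvg F.
Proof.
move=> Vc F FF /cauchyP Fc.
have small n : exists x : V, F (ball x (n.+1%:R^-1)%:C).
  have n0 : 0 < (n.+1%:R^-1 : R)%:C by rewrite ltcR invr_gt0.
  by have [x] := Fc _ n0; exists x.
have [u uP] := choice small.
have pos n : 0 < n.+1%:R^-1 :> R by rewrite invr_gt0.
have near0 (e : R) : 0 < e -> exists N, forall n, (N <= n)%N -> n.+1%:R^-1 <= e.
  move=> e0; exists (Num.truncn e^-1) => n Nn.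
  rewrite -[leRHS]invrK lef_pV2 ?posrE ?invr_gt0 //.
  apply: le_trans (ltW (Num.Theory.truncnS_gt _)) _.
  by rewrite ler_nat ltnS.
have dist m n : rnorm (u m - u n) <= m.+1%:R^-1 + n.+1%:R^-1.
  have [y []] := filter_ex (filterI (uP m) (uP n)).
  rewrite -!ball_normE /= !rnormE !ltcR => um un.
  apply: le_trans (rdist_triangle y _ _) _.
  by rewrite lerD ?(ltW um) // rdistC ltW.
have [l ul] : exists l, tends_to u l.
  apply: Vc => e e0; have [N NP] := near0 (e / 2) ltac:(by rewrite divr_gt0).
  exists N => m n /NP mN /NP nN; apply: le_trans (dist m n) _.
  have -> : e = e / 2 + e / 2 by field.
  exact: lerD.
apply/cvg_ex; exists l; apply/cvgrPdist_le => e e0.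
have eE : e = (complex.Re e)%:C by rewrite RRe_real // realE ltW.
have re0 : 0 < complex.Re e / 2 by rewrite divr_gt0 //; move: e0; rewrite eE ltcR.
have [N NP] := ul _ re0; have [N' NP'] := near0 _ re0; pose n := maxn N N'.
apply: filterS (uP n) => y; rewrite -ball_normE /= !rnormE ltcR eE lecR => uy.
apply: le_trans (rdist_triangle (u n) _ _) _.
have -> : complex.Re e = complex.Re e / 2 + complex.Re e / 2 by field.
rewrite rdistC lerD ?NP ?leq_maxl //; apply: le_trans (ltW uy) _.
by apply: NP'; apply: leq_maxr.
Qed.

End FilterCompleteness.

(** Complex Hilbert spaces, presented by the real part of the inner product.  A
    complex linear operator has the same adjoint for the inner product and for
    its real part, so that all estimates can be made in [R]. *)
Record hilbertSpace (R : realType) := HilbertSpace {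
  hcar :> lmodType R[i] ;
  hip : hcar -> hcar -> R ;
  hipC : forall x y, hip x y = hip y x ;
  hipDl : forall x y z, hip (x + y) z = hip x z + hip y z ;
  hipZl : forall (c : R[i]) x y, hip (c *: x) y = hip x (c^*%C *: y) ;
  hipRl : forall (c : R) x y, hip (c%:C *: x) y = c * hip x y ;
  hip_ge0 : forall x, 0 <= hip x x ;
  hip_eq0 : forall x, hip x x = 0 -> x = 0 ;
  hip_complete : forall u : nat -> hcar,
    (forall e : R, 0 < e -> exists N, forall m n, (N <= m)%N -> (N <= n)%N ->
       hip (u m - u n) (u m - u n) <= e) ->
    exists l, forall e : R, 0 < e -> exists N, forall n, (N <= n)%N ->
       hip (u n - l) (u n - l) <= e
}.

Section HilbertNorm.
Variables (R : realType) (H : hilbertSpace R).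
Implicit Types x y z : H.

Definition hnorm x : R := Num.sqrt (hip x x).

Lemma hnorm_ge0 x : 0 <= hnorm x. Proof. exact: sqrtr_ge0. Qed.

Lemma hnorm_sqr x : hnorm x ^+ 2 = hip x x.
Proof. by rewrite sqr_sqrtr // hip_ge0. Qed.

Lemma hipDr x y z : hip x (y + z) = hip x y + hip x z.
Proof. by rewrite hipC hipDl !(hipC x). Qed.

Lemma hipRr (c : R) x y : hip x (c%:C *: y) = c * hip x y.
Proof. by rewrite hipC hipRl hipC. Qed.

Lemma hip0l y : hip 0 y = 0.
Proof. by apply: (addrI (hip 0 y)); rewrite -hipDl !addr0. Qed.

Lemma hipNl x y : hip (- x) y = - hip x y.
Proof. by apply/eqP; rewrite -addr_eq0 -hipDl addNr hip0l. Qed.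

Lemma hipBl x y z : hip (x - y) z = hip x z - hip y z.
Proof. by rewrite hipDl hipNl. Qed.

Lemma hipBr x y z : hip x (y - z) = hip x y - hip x z.
Proof. by rewrite hipC hipBl !(hipC x). Qed.

Lemma hip_sep x y : (forall z, hip x z = hip y z) -> x = y.
Proof. by move=> xy; apply/subr0_eq/hip_eq0; rewrite hipBl xy subrr. Qed.

Lemma hnorm0 : hnorm 0 = 0. Proof. by rewrite /hnorm hip0l sqrtr0. Qed.

Lemma hnorm_eq0 x : hnorm x = 0 -> x = 0.
Proof. by move=> x0; apply: hip_eq0; rewrite -hnorm_sqr x0 expr0n. Qed.

Lemma cauchy_schwarz x y : hip x y <= hnorm x * hnorm y.
Proof.
have [x0|x0] := eqVneq (hnorm x) 0.
  by rewrite (hnorm_eq0 x0) hip0l mulr_ge0 ?hnorm_ge0.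
have [y0|y0] := eqVneq (hnorm y) 0.
  by rewrite (hnorm_eq0 y0) hipC hip0l mulr_ge0 ?hnorm_ge0.
have a0 : 0 < hnorm x by rewrite lt_neqAle eq_sym x0 hnorm_ge0.
have b0 : 0 < hnorm y by rewrite lt_neqAle eq_sym y0 hnorm_ge0.
have := hip_ge0 ((hnorm y)%:C *: x - (hnorm x)%:C *: y).
rewrite hipBl !hipBr !hipRl !hipRr -!hnorm_sqr (hipC y).
move: (hnorm x) (hnorm y) (hip x y) a0 b0 => a b c a0 b0 h.
have ab : 0 < a * b by rewrite mulr_gt0.
by rewrite -(ler_pM2l ab); nra.
Qed.

Lemma hnormD x y : hnorm (x + y) <= hnorm x + hnorm y.
Proof.
rewrite -(ler_pXn2r (_ : 0 < 2)%N) ?nnegrE ?addr_ge0 ?hnorm_ge0 //.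
rewrite hnorm_sqr hipDl !hipDr (hipC y) -!hnorm_sqr.
have := cauchy_schwarz x y; nra.
Qed.

Lemma hnormZ (c : R[i]) x : hnorm (c *: x) = rnorm c * hnorm x.
Proof.
rewrite -[rnorm c]ger0_norm ?rnorm_ge0 // -sqrtr_sqr /hnorm.
rewrite -sqrtrM ?sqr_ge0 //; congr (Num.sqrt _).
rewrite hipZl scalerA mulrC -sqr_normc rnormE -rmorphXn /=.
exact: hipRr.
Qed.

Lemma hnormN x : hnorm (- x) = hnorm x.
Proof. by rewrite -scaleN1r hnormZ rnormN rnorm1 mul1r. Qed.

Lemma hdist_triangle z x y : hnorm (x - y) <= hnorm (x - z) + hnorm (z - y).
Proof. by rewrite (_ : x - y = (x - z) + (z - y)) ?hnormD // addrA subrK. Qed.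

Lemma hnorm_complete (u : nat -> H) :
  (forall e : R, 0 < e -> exists N, forall m n, (N <= m)%N -> (N <= n)%N ->
     hnorm (u m - u n) <= e) ->
  exists l, forall e : R, 0 < e -> exists N, forall n, (N <= n)%N ->
     hnorm (u n - l) <= e.
Proof.
move=> uC; have [|l ul] := hip_complete (u := u).
  move=> e e0; have se : 0 < Num.sqrt e by rewrite sqrtr_gt0.
  have [N NP] := uC _ se; exists N => m n Nm Nn.
  rewrite -hnorm_sqr -[leRHS](sqr_sqrtr (ltW e0)).
  by apply: lerXn2r; rewrite ?nnegrE ?hnorm_ge0 ?sqrtr_ge0 ?NP.
exists l => e e0; have [N NP] := ul _ (exprn_gt0 2 e0); exists N => n /NP.
rewrite -hnorm_sqr => le2.
by rewrite -(ler_pXn2r (_ : 0 < 2)%N) ?nnegrE ?hnorm_ge0 // ltW.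
Qed.

End HilbertNorm.

(** A copy of the module that carries the norm of the Hilbert space, for the
    theory of limits of sequences. *)
Definition hspace (R : realType) (H : hilbertSpace R) : Type := hcar H.

Section HilbertNormed.
Variables (R : realType) (H : hilbertSpace R).

HB.instance Definition _ := GRing.Lmodule.on (hspace H).

Let norm (x : hspace H) : R[i] := (hnorm (x : H))%:C.

Let ler_normD (x y : hspace H) : norm (x + y) <= norm x + norm y.
Proof. by rewrite -rmorphD lecR; exact: hnormD. Qed.

Let normrZ (c : R[i]) (x : hspace H) : norm (c *: x) = `|c| * norm x.
Proof. by rewrite rnormE -rmorphM; congr (_%:C); exact: hnormZ. Qed.

Let normr0_eq0 (x : hspace H) : norm x = 0 -> x = 0.
Proof. by move=> /complexI/hnorm_eq0. Qed.

HB.instance Definition _ :=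
  Lmodule_isNormed.Build R[i] (hspace H) ler_normD normrZ normr0_eq0.

Lemma rnorm_hspace (x : hspace H) : rnorm x = hnorm (x : H).
Proof. by apply: complexI; rewrite -rnormE. Qed.

Lemma hspace_complete (u : nat -> hspace H) :
  cauchy_sequence u -> exists l, tends_to u l.
Proof.
move=> uC; have [|l ul] := @hnorm_complete R H u.
  by move=> e /uC[N NP]; exists N => m n Nm Nn; rewrite -rnorm_hspace NP.
by exists l => e /ul[N NP]; exists N => n Nn; rewrite rnorm_hspace NP.
Qed.

Lemma tends_to_hip (u : nat -> hspace H) l (y : H) : tends_to u l ->
  tends_to (fun n => (hip (u n : H) y)%:C : R[i]) (hip (l : H) y)%:C.
Proof.
apply: (tends_to_lipschitz (f := fun x : hspace H => (hip (x : H) y)%:C : R[i])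
  (c := hnorm y)) => x z.
rewrite -rmorphB rnorm_real -hipBl rnorm_hspace mulrC ler_norml.
by rewrite cauchy_schwarz andbT lerNl -hipNl -(hnormN (_ - _)) cauchy_schwarz.
Qed.

End HilbertNormed.

Section BoundedOperators.
Variables (R : realType) (H : hilbertSpace R).
Implicit Types x y z : H.

Definition adjoint_pair (T T' : H -> H) := forall x y, hip (T x) y = hip x (T' y).
Definition op_bound (T : H -> H) (C : R) :=
  0 <= C /\ forall x, hnorm (T x) <= C * hnorm x.

Definition adjointable : {pred H -> H} := fun T : H -> H =>
  `[< [/\ linear T, exists T', adjoint_pair T T' & exists C, op_bound T C] >].

Lemma adjointable_submod : submod_closed adjointable.
Proof.
split.
  apply/asboolP; split.
  - by move=> c x y; rewrite /= scaler0 addr0.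
  - by exists 0 => x y /=; rewrite hip0l hipC hip0l.
  - by exists 0; split=> // x /=; rewrite mul0r hnorm0.
move=> c S T /asboolP[Sl [S' SS'] [C [C0 SC]]] /asboolP[Tl [T' TT'] [D [D0 TD]]].
apply/asboolP; split.
- move=> d x y; rewrite !fctE Sl Tl !scalerDr !scalerA [c * d]mulrC.
  by rewrite -!addrA; congr (_ + _); rewrite addrCA.
- exists (fun y => S' (c^*%C *: y) + T' y) => x y.
  by rewrite !fctE hipDl hipZl SS' TT' hipDr.
- exists (rnorm c * C + D); split; first by rewrite addr_ge0 // mulr_ge0 ?rnorm_ge0.
  move=> x; rewrite !fctE; apply: le_trans (hnormD _ _) _; rewrite mulrDl.
  by apply: lerD => //; rewrite hnormZ -mulrA ler_wpM2l ?rnorm_ge0.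
Qed.

(** The adjoint is determined by the operator, so its existence is kept as a
    proposition and the operators form a submodule of the functions. *)
Definition bop : Type := {T : H -> H | T \in adjointable}.

HB.instance Definition _ :=
  GRing.isSubmodClosed.Build R[i] (H -> H) adjointable adjointable_submod.
HB.instance Definition _ := Choice.on bop.
HB.instance Definition _ := SubChoice.on bop.
HB.instance Definition _ := [SubChoice_isSubLmodule of bop by <:].

Definition opval (T : bop) : H -> H := \val T.
Coercion opval : bop >-> Funclass.
Implicit Types S T : bop.

Lemma bop_eq S T : (forall x, S x = T x) -> S = T.
Proof. by move=> ST; apply: val_inj; apply/funext => x; apply: ST. Qed.

Lemma bop_linear T : linear T. Proof. by have /asboolP[] := valP T. Qed.
Lemma bop0 T : T 0 = 0.
Proof. by have := bop_linear T (-1) 0 0; rewrite scaler0 addr0 scaleN1r addNr. Qed.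
Lemma bopD T x y : T (x + y) = T x + T y.
Proof. by have := bop_linear T 1 x y; rewrite !scale1r. Qed.
Lemma bopZ T c x : T (c *: x) = c *: T x.
Proof. by have := bop_linear T c x 0; rewrite bop0 !addr0. Qed.
Lemma opvalD S T x : (S + T : bop) x = S x + T x. Proof. by []. Qed.
Lemma opvalZ c T x : (c *: T : bop) x = c *: T x. Proof. by []. Qed.
Lemma opval0 x : (0 : bop) x = 0. Proof. by []. Qed.
Lemma opvalB S T x : (S - T : bop) x = S x - T x. Proof. by []. Qed.

Lemma bop_bounded T : exists C, op_bound T C.
Proof. by have /asboolP[] := valP T. Qed.

Definition opnorm T : R := inf [set C | op_bound T C].

Lemma opnorm_ge0 T : 0 <= opnorm T.
Proof. by apply: lb_le_inf; [exact: bop_bounded|move=> C []]. Qed.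

Lemma opnorm_le T (C : R) : op_bound T C -> opnorm T <= C.
Proof.
by move=> TC; apply: ge_inf => //; exists 0 => D [].
Qed.

Lemma opnormP T x : hnorm (T x) <= opnorm T * hnorm x.
Proof.
have [x0|x0] := eqVneq (hnorm x) 0.
  by rewrite (hnorm_eq0 x0) bop0 !hnorm0 mulr0.
have x1 : 0 < hnorm x by rewrite lt_neqAle eq_sym x0 hnorm_ge0.
rewrite -ler_pdivrMr //; apply: lb_le_inf; first exact: bop_bounded.
by move=> C [_ TC]; rewrite ler_pdivrMr.
Qed.

Lemma opnormD S T : opnorm (S + T) <= opnorm S + opnorm T.
Proof.
apply: opnorm_le; split; first by rewrite addr_ge0 ?opnorm_ge0.
move=> x; rewrite opvalD mulrDl; apply: le_trans (hnormD _ _) _.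
by rewrite lerD ?opnormP.
Qed.

Lemma opnormZ_le c T : opnorm (c *: T) <= rnorm c * opnorm T.
Proof.
apply: opnorm_le; split; first by rewrite mulr_ge0 ?opnorm_ge0 ?rnorm_ge0.
move=> x; rewrite opvalZ hnormZ -mulrA.
by rewrite ler_wpM2l ?opnormP ?rnorm_ge0.
Qed.

Lemma opnormZ c T : opnorm (c *: T) = rnorm c * opnorm T.
Proof.
have [->|c0] := eqVneq c 0.
  rewrite scale0r rnorm0 mul0r; apply/eqP; rewrite eq_le opnorm_ge0 andbT.
  by apply: opnorm_le; split=> // x; rewrite opval0 hnorm0 mul0r.
apply/eqP; rewrite eq_le opnormZ_le /=.
have nc : 0 < rnorm c by apply: rnorm_gt0; apply/eqP.
rewrite -ler_pdivlMl //.
have -> : (rnorm c)^-1 = rnorm c^-1.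
  apply: (mulfI (lt0r_neq0 nc)); rewrite mulfV ?lt0r_neq0 //.
  by rewrite -rnorm_complexM mulfV // rnorm1.
by apply: le_trans (opnormZ_le _ _); rewrite scalerA mulVf // scale1r.
Qed.

Lemma opnorm_eq0 T : opnorm T = 0 -> T = 0.
Proof.
move=> T0; apply: bop_eq => x; apply/hnorm_eq0/eqP.
by rewrite eq_le hnorm_ge0 andbT; have := opnormP T x; rewrite T0 mul0r.
Qed.

Let norm T : R[i] := (opnorm T)%:C.

Let ler_normD S T : norm (S + T) <= norm S + norm T.
Proof. by rewrite -rmorphD lecR opnormD. Qed.

Let normrZ (c : R[i]) T : norm (c *: T) = `|c| * norm T.
Proof. by rewrite /norm opnormZ rmorphM rnormE. Qed.

Let normr0_eq0 T : norm T = 0 -> T = 0.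
Proof. by move=> /complexI/opnorm_eq0. Qed.

HB.instance Definition _ :=
  Lmodule_isNormed.Build R[i] bop ler_normD normrZ normr0_eq0.

Lemma rnorm_bop T : rnorm T = opnorm T.
Proof. by apply: complexI; rewrite -rnormE. Qed.


Lemma bop_adjoint_exists T : exists T' : H -> H, adjoint_pair T T'.
Proof. by have /asboolP[] := valP T. Qed.

Definition adj_fun T : H -> H := projT1 (cid (bop_adjoint_exists T)).

Lemma adj_funP T : adjoint_pair T (adj_fun T).
Proof. exact: (projT2 (cid (bop_adjoint_exists T))). Qed.

Lemma adj_pairC (T T' : H -> H) : adjoint_pair T T' -> adjoint_pair T' T.
Proof. by move=> TT' x y; rewrite hipC -TT' hipC. Qed.

Lemma adjoint_linear (T T' : H -> H) :
  linear T -> adjoint_pair T T' -> linear T'.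
Proof.
move=> Tl TT' c x y; apply: hip_sep => z.
have TZ (d : R[i]) v : T (d *: v) = d *: T v.
  have T0 : T 0 = 0 by have := Tl (-1) 0 0; rewrite scaler0 addr0 scaleN1r addNr.
  by have := Tl d v 0; rewrite T0 !addr0.
rewrite !(hipC _ z) -TT' hipDr hipDr -TT'; congr (_ + _).
rewrite (hipC z) hipZl (hipC _ (_ *: z)) -TT' TZ hipZl conjcK.
by [].
Qed.

(** From [|T' y|^2 = <T (T' y), y>]. *)
Lemma adjoint_bound (T T' : H -> H) C :
  op_bound T C -> adjoint_pair T T' -> op_bound T' C.
Proof.
move=> [C0 TC] TT'; split=> // y.
have [y0|y0] := eqVneq (hnorm (T' y)) 0.
  by rewrite y0 mulr_ge0 ?hnorm_ge0.
have y1 : 0 < hnorm (T' y) by rewrite lt_neqAle eq_sym y0 hnorm_ge0.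
rewrite -(ler_pM2l y1) -expr2 hnorm_sqr -TT'.
apply: le_trans (cauchy_schwarz _ _) _.
by rewrite mulrA ler_wpM2r ?hnorm_ge0 // mulrC.
Qed.

Lemma adj_adjointable T : adj_fun T \in adjointable.
Proof.
apply/asboolP; split.
- exact: adjoint_linear (bop_linear T) (adj_funP T).
- by exists T; apply/adj_pairC/adj_funP.
- have [C TC] := bop_bounded T; exists C.
  exact: adjoint_bound TC (adj_funP T).
Qed.

Definition bop_adj T : bop := exist _ (adj_fun T) (adj_adjointable T).

Lemma bop_adjP T x y : hip (T x) y = hip x (bop_adj T y).
Proof. exact: adj_funP. Qed.

Lemma bop_adj_eq S T : adjoint_pair S T -> bop_adj S = T.
Proof.
move=> ST; apply: bop_eq => y; apply: hip_sep => z.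
by rewrite !(hipC _ z) -bop_adjP ST.
Qed.

Lemma comp_adjointable S T : S \o T \in adjointable.
Proof.
apply/asboolP; split.
- by move=> c x y; rewrite /= bopD bopZ bopD bopZ.
- by exists (bop_adj T \o bop_adj S) => x y /=; rewrite !bop_adjP.
- exists (opnorm S * opnorm T); split; first by rewrite mulr_ge0 ?opnorm_ge0.
  move=> x /=; apply: le_trans (opnormP _ _) _.
  by rewrite -mulrA ler_wpM2l ?opnorm_ge0 ?opnormP.
Qed.

Definition bop_comp S T : bop := exist _ (S \o T) (comp_adjointable S T).

Lemma bop_compE S T x : bop_comp S T x = S (T x). Proof. by []. Qed.

Lemma opnorm_adj T : opnorm (bop_adj T) = opnorm T.
Proof.
have adj_le S : opnorm (bop_adj S) <= opnorm S.
  apply: opnorm_le; apply: adjoint_bound (bop_adjP S).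
  by split; [apply: opnorm_ge0|apply: opnormP].
apply/eqP; rewrite eq_le adj_le /=.
have adjK : bop_adj (bop_adj T) = T.
  by apply: bop_adj_eq; apply: adj_pairC; apply: bop_adjP.
by rewrite -{1}adjK adj_le.
Qed.

Lemma bop_adjB S T : bop_adj (S - T) = bop_adj S - bop_adj T.
Proof.
apply: bop_adj_eq => x y; rewrite opvalB hipBl !bop_adjP -hipBr.
by rewrite -opvalB.
Qed.

(** Pointwise limits of a Cauchy sequence and of its adjoints are adjoint. *)
Lemma bop_complete (u : nat -> bop) : cauchy_sequence u -> exists l, tends_to u l.
Proof.
move=> uC.
have ptC (v : nat -> bop) x : cauchy_sequence v ->
    exists y : hspace H, tends_to (fun n => v n x : hspace H) y.
  move=> vC; apply: hspace_complete => e e0.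
  have x1 : 0 < hnorm x + 1 by rewrite ltr_wpDl ?hnorm_ge0.
  have [N NP] := vC _ (divr_gt0 e0 x1); exists N => m n Nm Nn.
  have := NP m n Nm Nn; rewrite rnorm_bop ler_pdivlMr // => le_e.
  rewrite rnorm_hspace -opvalB; apply: le_trans (opnormP _ _) (le_trans _ le_e).
  by rewrite ler_wpM2l ?opnorm_ge0 // lerDl.
have adjC : cauchy_sequence (fun n => bop_adj (u n)).
  move=> e /uC[N NP]; exists N => m n Nm Nn.
  by rewrite -bop_adjB rnorm_bop opnorm_adj -rnorm_bop NP.
have [T uT] := choice (fun x => ptC u x uC).
have [T' uT'] := choice (fun x => ptC _ x adjC).
have lim_dist e N : (forall m n, (N <= m)%N -> (N <= n)%N ->
    rnorm (u m - u n) <= e) -> forall n x, (N <= n)%N ->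
    hnorm (u n x - T x) <= e * hnorm x.
  move=> NP n x Nn; apply/ler_addgt0Pr => e' e0'.
  have [N' NP'] := uT x _ e0'; pose m := maxn N N'.
  apply: le_trans (hdist_triangle (u m x) _ _) _; apply: lerD.
    rewrite -opvalB; apply: le_trans (opnormP _ _) _.
    by rewrite ler_wpM2r ?hnorm_ge0 // -rnorm_bop NP // leq_maxl.
  by have := NP' m (leq_maxr _ _); rewrite rnorm_hspace.
have TA : (T : H -> H) \in adjointable.
  apply/asboolP; split.
  - move=> c x y; apply: (tends_to_uniq (uT _)).
    apply: (tends_to_eq _ (tends_toD (tends_toZ c (uT x)) (uT y))) => n.
    by rewrite bopD bopZ.
  - exists T' => x y; apply: complexI.
    apply: (tends_to_uniq (tends_to_hip y (uT x))); rewrite hipC.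
    apply: (tends_to_eq _ (tends_to_hip x (uT' y))) => n.
    by rewrite hipC -bop_adjP.
  - have [N NP] := uC 1 ltr01; exists (opnorm (u N) + 1).
    split=> [|x]; first by rewrite addr_ge0 ?opnorm_ge0.
    rewrite -[T x](subKr (u N x)); apply: le_trans (hnormD _ _) _.
    rewrite hnormN mulrDl lerD ?opnormP //.
    exact: lim_dist NP N x (leqnn N).
exists (exist _ (T : H -> H) TA : bop) => e e0; have [N NP] := uC e e0.
exists N => n Nn; rewrite rnorm_bop; apply: opnorm_le; split; first exact: ltW.
by move=> x; rewrite opvalB; apply: (lim_dist e N NP).
Qed.

HB.instance Definition _ := Uniform_isComplete.Build bop
  (cauchy_filter_cvg bop_complete).

Let compA : associative bop_comp.
Proof. by move=> S T V; apply: bop_eq. Qed.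

Let comp_linear_l T : linear (bop_comp^~ T).
Proof. by move=> c S V; apply: bop_eq. Qed.

Let comp_linear_r T : linear (bop_comp T).
Proof. by move=> c S V; apply: bop_eq => x; rewrite !(bop_compE, opvalD, opvalZ) bopD bopZ. Qed.

Let adjK : involutive bop_adj.
Proof. by move=> T; apply: bop_adj_eq; apply/adj_pairC/bop_adjP. Qed.

Let adjD : {morph bop_adj : S T / S + T}.
Proof.
move=> S T; apply: bop_adj_eq => x y.
by rewrite !opvalD hipDl hipDr !bop_adjP.
Qed.

Let adjZ (c : R[i]) T : bop_adj (c *: T) = (c^*)%R *: bop_adj T.
Proof.
apply: bop_adj_eq => x y.
by rewrite !opvalZ hipZl bop_adjP bopZ.
Qed.

Let adjM S T : bop_adj (bop_comp S T) = bop_comp (bop_adj T) (bop_adj S).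
Proof. by apply: bop_adj_eq => x y; rewrite !bop_compE !bop_adjP. Qed.

Let opnormM S T : opnorm (bop_comp S T) <= opnorm S * opnorm T.
Proof.
apply: opnorm_le; split; first by rewrite mulr_ge0 ?opnorm_ge0.
move=> x; rewrite bop_compE; apply: le_trans (opnormP _ _) _.
by rewrite -mulrA ler_wpM2l ?opnorm_ge0 ?opnormP.
Qed.

Let normM S T : `|bop_comp S T| <= `|S| * `|T|.
Proof. by rewrite !rnormE -rmorphM lecR !rnorm_bop. Qed.

(* [|T x|^2 = <x, T^* T x>] bounds [|T|^2] by [|T^* T|]. *)
Let star_identity T : `|bop_comp (bop_adj T) T| = `|T| ^+ 2.
Proof.
rewrite !rnormE -rmorphXn /=; congr (_%:C); rewrite !rnorm_bop.
apply/eqP; rewrite eq_le; apply/andP; split.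
  by apply: le_trans (opnormM _ _) _; rewrite opnorm_adj expr2.
set c := opnorm (bop_comp _ _); have c0 : 0 <= c by apply: opnorm_ge0.
rewrite -[leRHS](sqr_sqrtr c0); apply: lerXn2r; rewrite ?nnegrE ?sqrtr_ge0 ?opnorm_ge0 //.
apply: opnorm_le; split=> [|x]; first exact: sqrtr_ge0.
rewrite -(ler_pXn2r (_ : 0 < 2)%N) ?nnegrE ?mulr_ge0 ?hnorm_ge0 ?sqrtr_ge0 //.
rewrite exprMn (sqr_sqrtr c0) hnorm_sqr bop_adjP -bop_compE hipC.
apply: le_trans (cauchy_schwarz _ _) _; rewrite expr2 mulrA.
by rewrite ler_wpM2r ?hnorm_ge0 // opnormP.
Qed.

HB.instance Definition _ := CompleteNormedModule_isCStarAlgebra.Build R bop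
  compA comp_linear_l comp_linear_r adjK adjD adjZ adjM normM star_identity.

End BoundedOperators.

Lemma bop_mulE (R : realType) (H : hilbertSpace R) (S T : bop H) x :
  (S ** T : bop H) x = S (T x).
Proof. by []. Qed.

(** * Square-summable functions *)

Section Nets.
Variables (R : realType) (X : choiceType).
Implicit Types (s t : seq X) (h : X -> R).

(** Convergence along the directed set of finite subsets of [X]. *)
Definition net_lim (u : seq X -> R) (l : R) := forall e : R, 0 < e ->
  exists2 s0, uniq s0 & forall s, uniq s -> {subset s0 <= s} -> `|u s - l| <= e.

Lemma net_common s0 t0 : exists2 s, uniq s & {subset s0 <= s} /\ {subset t0 <= s}.
Proof.
exists (undup (s0 ++ t0)); first exact: undup_uniq.
by split=> x xs; rewrite mem_undup mem_cat xs ?orbT.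
Qed.

Lemma net_lim_uniq u l l' : net_lim u l -> net_lim u l' -> l = l'.
Proof.
move=> ul ul'; apply/eqP; rewrite -subr_eq0 -normr_eq0 eq_le normr_ge0 andbT.
apply/ler_addgt0Pl => e e0; rewrite addr0.
have e20 : 0 < e / 2 by rewrite divr_gt0.
have [s0 _ sP] := ul _ e20; have [t0 _ tP] := ul' _ e20.
have [s us [s0s t0s]] := net_common s0 t0.
apply: le_trans (ler_distD (u s) _ _) _.
have -> : e = e / 2 + e / 2 by field.
by rewrite distrC lerD ?sP ?tP.
Qed.

Lemma net_limD u u' l l' : net_lim u l -> net_lim u' l' ->
  net_lim (fun s => u s + u' s) (l + l').
Proof.
move=> ul ul' e e0; have e20 : 0 < e / 2 by rewrite divr_gt0.
have [s0 _ sP] := ul _ e20; have [t0 _ tP] := ul' _ e20.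
have [s us [s0s t0s]] := net_common s0 t0; exists s => // v uv sv.
rewrite opprD addrACA; apply: le_trans (ler_normD _ _) _.
have -> : e = e / 2 + e / 2 by field.
by apply: lerD; [apply: sP|apply: tP] => // x xs; apply: sv; [apply: s0s|apply: t0s].
Qed.

Lemma net_limZ c u l : net_lim u l -> net_lim (fun s => c * u s) (c * l).
Proof.
move=> ul e e0; have c1 : 0 < `|c| + 1 by rewrite ltr_wpDl.
have [s0 us0 sP] := ul _ (divr_gt0 e0 c1); exists s0 => // s us s0s.
rewrite -mulrBr normrM; have := sP s us s0s; rewrite ler_pdivlMr //.
by have := normr_ge0 (u s - l); have := normr_ge0 c; nra.
Qed.

Lemma net_lim_eq u u' l : (forall s, u s = u' s) -> net_lim u l -> net_lim u' l.
Proof. by move=> /funext->. Qed.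

Lemma sum_support s t h : uniq s -> uniq t -> {subset s <= t} ->
  (forall x, x \in t -> x \notin s -> h x = 0) ->
  \sum_(x <- t) h x = \sum_(x <- s) h x.
Proof.
move=> us ut st h0; rewrite (bigID (mem s)) /= [X in _ + X]big1_seq ?addr0.
  rewrite -big_filter; apply: perm_big; apply: uniq_perm => //.
    exact: filter_uniq.
  move=> x; rewrite mem_filter; apply/andP/idP => [[]//|xs].
  by split=> //; apply: st.
by move=> x /andP[xs xt]; apply: h0.
Qed.

Lemma sum_mono s t h : uniq s -> uniq t -> {subset s <= t} ->
  (forall x, 0 <= h x) -> \sum_(x <- s) h x <= \sum_(x <- t) h x.
Proof.
move=> us ut st h0.
have -> : \sum_(x <- s) h x = \sum_(x <- s) (if x \in s then h x else 0).
  by apply: eq_big_seq => x ->.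
rewrite -(sum_support us ut st) => [|x _ /negbTE->//].
by apply: ler_sum => x _; case: ifP.
Qed.

Definition summable_sq (f : X -> R[i]) :=
  exists C, forall s, uniq s -> \sum_(x <- s) rnorm (f x) ^+ 2 <= C.

Definition sqnorm (f : X -> R[i]) : R :=
  sup [set \sum_(x <- s) rnorm (f x) ^+ 2 | s in [set s | uniq s]].

Lemma sqnorm_ub f s : summable_sq f -> uniq s ->
  \sum_(x <- s) rnorm (f x) ^+ 2 <= sqnorm f.
Proof.
move=> [C fC] us; apply: ub_le_sup; last by exists s.
by exists C => _ [t ut <-]; apply: fC.
Qed.

Lemma sqnorm_le f C : (forall s, uniq s -> \sum_(x <- s) rnorm (f x) ^+ 2 <= C) ->
  sqnorm f <= C.
Proof.
move=> fC; apply: ge_sup; first by exists 0, [::] => //; rewrite big_nil.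
by move=> _ [t ut <-]; apply: fC.
Qed.

Lemma sqnorm_lim f : summable_sq f ->
  net_lim (fun s => \sum_(x <- s) rnorm (f x) ^+ 2) (sqnorm f).
Proof.
move=> fS e e0.
have [_ [s us <-] se] : exists2 y,
    [set \sum_(x <- s) rnorm (f x) ^+ 2 | s in [set s | uniq s]] y &
    sqnorm f - e < y.
  apply: sup_adherent => //; split; first by exists 0, [::] => //; rewrite big_nil.
  by have [C fC] := fS; exists C => _ [t ut <-]; apply: fC.
exists s => // t ut st; rewrite ler_distlC.
have le1 := sqnorm_ub fS ut.
have le2 := sum_mono us ut st (fun x => sqr_ge0 (rnorm (f x))).
by apply/andP; split; lra.
Qed.

(** The real part of [z * w^*]. *)
Definition rip (z w : R[i]) : R :=
  complex.Re z * complex.Re w + complex.Im z * complex.Im w.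

Lemma rip_polarization z w :
  rip z w = 4^-1 * (rnorm (z + w) ^+ 2 + - 1 * rnorm (z - w) ^+ 2).
Proof. by case: z w => [a b] [c d]; rewrite !rnorm_sqr /rip /=; field. Qed.

Lemma rip_self z : rip z z = rnorm z ^+ 2.
Proof. by rewrite rnorm_sqr /rip -!expr2. Qed.

Lemma rip0l w : rip 0 w = 0. Proof. by rewrite /rip !mul0r addr0. Qed.
Lemma rip0r z : rip z 0 = 0. Proof. by rewrite /rip !mulr0 addr0. Qed.

Lemma rnormD_sqr (z w : R[i]) :
  rnorm (z + w) ^+ 2 <= 2 * rnorm z ^+ 2 + 2 * rnorm w ^+ 2.
Proof.
case: z w => [a b] [c d]; rewrite !rnorm_sqr /=.
have := sqr_ge0 (a - c); have := sqr_ge0 (b - d); nra.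
Qed.

Definition l2pred : {pred X -> R[i]} := fun f => `[< summable_sq f >].

Lemma l2_submod : submod_closed l2pred.
Proof.
split.
  by apply/asboolP; exists 0 => s _; rewrite big1 // => x _; rewrite rnorm0 expr0n.
move=> c f g /asboolP[C fC] /asboolP[D gD]; apply/asboolP.
exists (2 * (rnorm c ^+ 2 * C) + 2 * D) => s us.
apply: le_trans (_ : \sum_(x <- s)
  (2 * (rnorm c ^+ 2 * rnorm (f x) ^+ 2) + 2 * rnorm (g x) ^+ 2) <= _).
  apply: ler_sum => x _; apply: le_trans (rnormD_sqr _ _) _.
  by rewrite -exprMn -rnorm_complexM.
rewrite big_split -!mulr_sumr lerD // ler_wpM2l //; last exact: gD.
by rewrite ler_wpM2l ?sqr_ge0 // fC.
Qed.

End Nets.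

Section L2.
Variables (R : realType) (X : choiceType).

Definition l2 : Type := {f : X -> R[i] | f \in @l2pred R X}.

HB.instance Definition _ :=
  GRing.isSubmodClosed.Build R[i] (X -> R[i]) (@l2pred R X) (@l2_submod R X).
HB.instance Definition _ := Choice.on l2.
HB.instance Definition _ := SubChoice.on l2.
HB.instance Definition _ := [SubChoice_isSubLmodule of l2 by <:].

Definition l2val (f : l2) : X -> R[i] := \val f.
Coercion l2val : l2 >-> Funclass.
Implicit Types f g : l2.

Lemma l2P f : summable_sq f. Proof. by have /asboolP := valP f. Qed.

Lemma l2_eq f g : (forall x, f x = g x) -> f = g.
Proof. by move=> fg; apply: val_inj; apply/funext => x; apply: fg. Qed.

(** Polarization defines the inner product from suprema of finite sums.  Its
    description as a limit of finite sums then yields the algebraic identities,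
    by uniqueness of limits. *)
Definition l2ip f g : R := 4^-1 * (sqnorm (f + g : l2) + -1 * sqnorm (f - g : l2)).

Lemma l2ip_lim f g :
  net_lim (fun s => \sum_(x <- s) rip (f x) (g x)) (l2ip f g).
Proof.
have lim := net_limZ 4^-1 (net_limD (sqnorm_lim (l2P (f + g)))
  (net_limZ (-1) (sqnorm_lim (l2P (f - g))))).
apply: net_lim_eq lim => s; rewrite mulr_sumr -big_split mulr_sumr.
by apply: eq_bigr => x _; rewrite rip_polarization.
Qed.

Lemma l2ip_self f : l2ip f f = sqnorm f.
Proof.
apply: net_lim_uniq (l2ip_lim f f) _; apply: net_lim_eq (sqnorm_lim (l2P f)) => s.
by apply: eq_bigr => x _; rewrite rip_self.
Qed.

Lemma l2ipC f g : l2ip f g = l2ip g f.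
Proof.
apply: net_lim_uniq (l2ip_lim f g) _; apply: net_lim_eq (l2ip_lim g f) => s.
by apply: eq_bigr => x _; rewrite /rip mulrC [X in _ + X]mulrC.
Qed.

Lemma l2ipDl (f g h : l2) : l2ip (f + g) h = l2ip f h + l2ip g h.
Proof.
apply: net_lim_uniq (l2ip_lim (f + g) h) _.
apply: net_lim_eq (net_limD (l2ip_lim f h) (l2ip_lim g h)) => s.
rewrite -big_split; apply: eq_bigr => x _ /=.
by rewrite /rip [l2val (f + g) x]/(f x + g x) !raddfD /=; ring.
Qed.

Lemma l2ipZl (c : R[i]) f g : l2ip (c *: f) g = l2ip f (c^*%C *: g).
Proof.
apply: net_lim_uniq (l2ip_lim (c *: f) g) _.
apply: net_lim_eq (l2ip_lim f (c^*%C *: g)) => s; apply: eq_bigr => x _.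
rewrite [l2val (c *: f) x]/(c * f x) [l2val (c^*%C *: g) x]/(c^*%C * g x) /rip.
by case: c (f x) (g x) => [a b] [u v] [w z] /=; ring.
Qed.

Lemma l2ipRl (c : R) f g : l2ip (c%:C *: f) g = c * l2ip f g.
Proof.
apply: net_lim_uniq (l2ip_lim (c%:C *: f) g) _.
apply: net_lim_eq (net_limZ c (l2ip_lim f g)) => s; rewrite mulr_sumr.
apply: eq_bigr => x _; rewrite [l2val (c%:C *: f) x]/(c%:C * f x) /rip.
by case: (f x) (g x) => [u v] [w z] /=; ring.
Qed.

Lemma l2_le_sqnorm f x : rnorm (f x) ^+ 2 <= sqnorm f.
Proof. by have := sqnorm_ub (s := [:: x]) (l2P f) isT; rewrite big_seq1. Qed.

Lemma l2ip_ge0 f : 0 <= l2ip f f.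
Proof.
by rewrite l2ip_self; have := sqnorm_ub (s := [::]) (l2P f) isT; rewrite big_nil.
Qed.

Lemma l2ip_eq0 f : l2ip f f = 0 -> f = 0.
Proof.
rewrite l2ip_self => f0; apply: l2_eq => x; apply/rnorm0_eq0/eqP.
by rewrite -sqrf_eq0 eq_le sqr_ge0 andbT -f0 l2_le_sqnorm.
Qed.

Lemma l2ip_complete (u : nat -> l2) :
  (forall e : R, 0 < e -> exists N, forall m n, (N <= m)%N -> (N <= n)%N ->
     l2ip (u m - u n) (u m - u n) <= e) ->
  exists l, forall e : R, 0 < e -> exists N, forall n, (N <= n)%N ->
     l2ip (u n - l) (u n - l) <= e.
Proof.
move=> uC.
have pt x : exists l : R[i], tends_to (fun n => u n x : R[i]) l.
  apply: complex_cauchy_tends_to => e e0.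
  have [N NP] := uC _ (exprn_gt0 2 e0); exists N => m n Nm Nn.
  rewrite -(ler_pXn2r (_ : 0 < 2)%N) ?nnegrE ?rnorm_ge0 ?(ltW e0) //.
  by apply: le_trans (NP m n Nm Nn); rewrite l2ip_self (l2_le_sqnorm (u m - u n)).
have [l ul] := choice pt.
have fin s (e : R) : 0 < e -> exists N, forall n, (N <= n)%N ->
    \sum_(x <- s) rnorm (u n x - l x) ^+ 2 <= e.
  elim: s e => [|x s IH] e e0; first by exists 0%N => n _; rewrite big_nil ltW.
  have e20 : 0 < e / 2 by rewrite divr_gt0.
  have se : 0 < Num.sqrt (e / 2) by rewrite sqrtr_gt0.
  have [N NP] := IH _ e20; have [N' NP'] := ul x _ se.
  exists (maxn N N') => n; rewrite geq_max => /andP[Nn Nn'].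
  rewrite big_cons; have -> : e = e / 2 + e / 2 by field.
  apply: lerD; last exact: NP.
  rewrite -[leRHS](sqr_sqrtr (ltW e20)).
  by apply: lerXn2r; rewrite ?nnegrE ?rnorm_ge0 ?sqrtr_ge0 ?NP'.
(* The factor 4 comes from comparing with the pointwise limit through one far
   term [u m], with the parallelogram inequality. *)
have bound e N : 0 < e -> (forall m n, (N <= m)%N -> (N <= n)%N ->
    l2ip (u m - u n) (u m - u n) <= e) -> forall n s, (N <= n)%N -> uniq s ->
    \sum_(x <- s) rnorm (u n x - l x) ^+ 2 <= 4 * e.
  move=> e0 NP n s Nn us; have [N' NP'] := fin s e e0; pose m := maxn N N'.
  have le1 := NP' m (leq_maxr _ _).
  have le2 : \sum_(x <- s) rnorm (u n x - u m x) ^+ 2 <= e.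
    have := NP n m Nn (leq_maxl _ _); rewrite l2ip_self; apply: le_trans.
    exact: (sqnorm_ub (l2P (u n - u m))).
  have le3 : \sum_(x <- s) rnorm (u n x - l x) ^+ 2 <= \sum_(x <- s)
      (2 * rnorm (u n x - u m x) ^+ 2 + 2 * rnorm (u m x - l x) ^+ 2).
    apply: ler_sum => x _.
    have -> : u n x - l x = (u n x - u m x) + (u m x - l x) by rewrite addrA subrK.
    exact: rnormD_sqr.
  by move: le3; rewrite big_split -!mulr_sumr /=; lra.
have lS : l \in @l2pred R X.
  have [N NP] := uC 1 ltr01.
  have dS : (fun x => u N x - l x) \in @l2pred R X.
    by apply/asboolP; exists (4 * 1) => s us; apply: (bound 1 N).
  have -> : l = (\val (u N) : X -> R[i]) - (fun x => u N x - l x).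
    by apply/funext => x; rewrite !fctE /l2val subKr.
  by rewrite rpredB //; apply: (valP (u N)).
exists (exist _ l lS : l2) => e e0; have e40 : 0 < e / 4 by rewrite divr_gt0.
have [N NP] := uC _ e40; exists N => n Nn; rewrite l2ip_self.
apply: sqnorm_le => s us; apply: le_trans (bound _ _ e40 NP n s Nn us) _.
by rewrite mulrC divfK.
Qed.

Definition l2space : hilbertSpace R :=
  HilbertSpace l2ipC l2ipDl l2ipZl l2ipRl l2ip_ge0 l2ip_eq0 l2ip_complete.

End L2.

(** * Operators of partial bijections *)

(** Both directions are kept as data: one occurs in an operator, the other in its
    adjoint. *)
Record partial_bijection (X : Type) := PartialBijection {
  pfun : X -> option X ;
  pinv : X -> option X ;
  pfunK : forall x y, pfun x = Some y <-> pinv y = Some x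
}.

Definition pswap (X : Type) (p : partial_bijection X) : partial_bijection X :=
  PartialBijection (fun y x => iff_sym (pfunK p x y)).

Section TranslationOperators.
Variables (R : realType) (X : choiceType).
Implicit Types (p q : partial_bijection X) (f g : l2 R X).

Lemma sum_pmap p (h : X -> X -> R) s :
  \sum_(y <- s) oapp (fun x => h x y) 0 (pinv p y) =
  \sum_(x <- pmap (pinv p) s) oapp (h x) 0 (pfun p x).
Proof.
elim: s => [|y s IH]; first by rewrite !big_nil.
rewrite big_cons /=; case E: (pinv p y) => [x|] /=; last by rewrite add0r.
by rewrite big_cons IH (iffRL (pfunK p x y) E).
Qed.

Lemma uniq_pmap p s : uniq s -> uniq (pmap (pinv p) s).
Proof.
elim: s => //= y s IH /andP[ys us]; case E: (pinv p y) => [x|] /=; last exact: IH.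
rewrite IH // andbT; apply: contra ys; rewrite mem_pmap => /mapP[y' y's /esym E'].
move/pfunK: E; move/pfunK: E' => -> [<-].
exact: y's.
Qed.

(** The function carried along [p], extended by 0 outside the range of [p]. *)
Definition translate p (f : X -> R[i]) : X -> R[i] := fun y => oapp f 0 (pinv p y).

Lemma sum_translate_le p (f : X -> R[i]) s : summable_sq f -> uniq s ->
  \sum_(y <- s) rnorm (translate p f y) ^+ 2 <= sqnorm f.
Proof.
move=> fS us; apply: le_trans (sqnorm_ub fS (uniq_pmap p us)).
have -> : \sum_(y <- s) rnorm (translate p f y) ^+ 2 =
    \sum_(y <- s) oapp (fun x => rnorm (f x) ^+ 2) 0 (pinv p y).
  apply: eq_bigr => y _; rewrite /translate; case: pinv => //=.
  by rewrite rnorm0 expr0n.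
rewrite (sum_pmap p (fun x _ => rnorm (f x) ^+ 2)); apply: ler_sum => x _.
by case: pfun => //=; rewrite sqr_ge0.
Qed.

Lemma translate_l2 p f : translate p f \in @l2pred R X.
Proof.
by apply/asboolP; exists (sqnorm f) => s us; apply: sum_translate_le (l2P f) us.
Qed.

Definition l2translate p (f : l2space R X) : l2space R X :=
  exist _ (translate p (l2val f)) (translate_l2 p f) : l2 R X.

(** On finite sets exchanged by the partial bijection both inner products are
    the same finite sum. *)
Lemma l2translate_adjoint p : adjoint_pair (l2translate p) (l2translate (pswap p)).
Proof.
move=> f g; pose f' := l2val f; pose g' := l2val g.
pose h x y := rip (f' x) (g' y).
have lhs s : \sum_(y <- s) rip (translate p f' y) (g' y) =
    \sum_(y <- s) oapp (fun x => h x y) 0 (pinv p y).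
  by apply: eq_bigr => y _; rewrite /translate; case: pinv => //=; rewrite rip0l.
have rhs t : \sum_(x <- t) rip (f' x) (translate (pswap p) g' x) =
    \sum_(x <- t) oapp (h x) 0 (pfun p x).
  by apply: eq_bigr => x _; rewrite /translate /=; case: pfun => //=; rewrite rip0r.
apply: net_lim_uniq (l2ip_lim _ _) _ => e e0.
have [t0 ut0 tP] := l2ip_lim f (l2translate (pswap p) g) e0.
pose s0 := pmap (pfun p) t0; exists s0; first exact: (uniq_pmap (pswap p)).
move=> s us s0s; rewrite lhs sum_pmap.
pose t1 := pmap (pinv p) s; pose t := undup (t0 ++ t1).
have ut : uniq t by apply: undup_uniq.
rewrite -(@sum_support _ _ t1 t) ?uniq_pmap //.
- by rewrite -rhs; apply: tP => // x xt; rewrite mem_undup mem_cat xt.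
- by move=> x xt; rewrite mem_undup mem_cat xt orbT.
move=> x; rewrite mem_undup mem_cat => /orP[xt0|->//] xt1.
case E: (pfun p x) => [y|] //=; case/negP: xt1; rewrite mem_pmap.
apply/mapP; exists y; last by apply/esym/pfunK.
by apply: s0s; rewrite mem_pmap; apply/mapP; exists x.
Qed.

Lemma l2translate_bop p : l2translate p \in @adjointable R (l2space R X).
Proof.
apply/asboolP; split.
- move=> c f g; apply: l2_eq => y.
  change (oapp (fun x => c * l2val f x + l2val g x) 0 (pinv p y) =
    c * oapp (l2val f) 0 (pinv p y) + oapp (l2val g) 0 (pinv p y)).
  by case: pinv => [x|] //=; rewrite mulr0 addr0.
- by exists (l2translate (pswap p)); apply: l2translate_adjoint.
exists 1; split=> // f; rewrite mul1r ler_sqrt ?hip_ge0 //= !l2ip_self.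
by apply: sqnorm_le => s us; apply: sum_translate_le (l2P _) us.
Qed.

Definition pop p : bop (l2space R X) :=
  exist (fun T => T \in @adjointable R (l2space R X)) _ (l2translate_bop p).

Lemma popE p (f : l2space R X) y : l2val (pop p f) y = oapp (l2val f) 0 (pinv p y).
Proof. by []. Qed.

Lemma pop_adj p : (pop p)^#* = pop (pswap p).
Proof. by apply: bop_adj_eq; apply: l2translate_adjoint. Qed.

Lemma pop_eq (T : bop (l2space R X)) p :
  (forall f y, l2val (T f) y = oapp (l2val f) 0 (pinv p y)) -> T = pop p.
Proof. by move=> Tp; apply: bop_eq => f; apply: l2_eq => y; apply: Tp. Qed.

Lemma pop_range p (f : l2space R X) y :
  l2val ((pop p ** (pop p)^#* : bop (l2space R X)) f) y =
  if pinv p y is Some _ then l2val f y else 0.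
Proof.
rewrite pop_adj bop_mulE popE; case E: (pinv p y) => [x|] //=.
by rewrite popE /= (iffRL (pfunK p x y) E).
Qed.

Lemma pop_source p (f : l2space R X) x :
  l2val (((pop p)^#* ** pop p : bop (l2space R X)) f) x =
  if pfun p x is Some _ then l2val f x else 0.
Proof.
rewrite pop_adj bop_mulE popE /=; case E: (pfun p x) => [y|] //=.
by rewrite popE (iffLR (pfunK p x y) E).
Qed.

Lemma pop_isometry p : partial_isometry (pop p).
Proof.
apply: pop_eq => f y; rewrite bop_mulE pop_range popE.
by case E: (pinv p y).
Qed.

Lemma pop_mul p q r : (forall x, pfun r x = obind (pfun p) (pfun q x)) ->
  pop r = pop p ** pop q.
Proof.
move=> rE; apply/esym/pop_eq => f y; rewrite bop_mulE popE.
case E: (pinv p y) => [z|] /=.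
  rewrite popE; case F: (pinv q z) => [x|] /=.
    have -> : pinv r y = Some x; last by [].
    apply/pfunK; rewrite rE (iffRL (pfunK q x z) F) /=.
    exact/pfunK.
  case G: (pinv r y) => [x|] //=.
  move/pfunK: G; rewrite rE; case Q: (pfun q x) => [z'|] //= /pfunK.
  by rewrite E => -[zz]; move/pfunK: Q; rewrite -zz F.
case G: (pinv r y) => [x|] //=.
move/pfunK: G; rewrite rE; case Q: (pfun q x) => [z'|] //= /pfunK.
by rewrite E.
Qed.

Lemma l2val_sum (I : Type) (r : seq I) (T : I -> bop (l2space R X))
    (f : l2space R X) y :
  l2val ((\sum_(i <- r) T i : bop (l2space R X)) f) y = \sum_(i <- r) l2val (T i f) y.
Proof.
by elim: r => [|i r IH]; rewrite ?big_nil // !big_cons -IH.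
Qed.

Definition l2delta_fun (x : X) : X -> R[i] := fun y => (y == x)%:R.

Lemma l2delta_subproof x : l2delta_fun x \in @l2pred R X.
Proof.
apply/asboolP; exists 1 => s us; rewrite /l2delta_fun.
have [xs|xs] := boolP (x \in s); last first.
  rewrite big1_seq // => y /andP[_ ys]; case: eqP => [yx|_].
    by rewrite yx (negbTE xs) in ys.
  by rewrite rnorm0 expr0n.
rewrite (bigD1_seq x) //= eqxx rnorm1 expr1n big1 ?addr0 // => y yx.
by rewrite (negbTE yx) rnorm0 expr0n.
Qed.

Definition l2delta x : l2space R X :=
  exist (fun h => h \in @l2pred R X) _ (l2delta_subproof x) : l2 R X.

End TranslationOperators.

(** * The infinite path space *)

Section InfinitePaths.
Variables (k : nat) (L : kgraph k).
Hypothesis hL : row_finite_no_sources L.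
Local Notation degree := {ffun 'I_k -> nat}.
Implicit Types (l : mor L) (v : ob L) (m n d : degree).

Lemma degree_addI m : injective (+%R m).
Proof.
move=> n n' /ffunP e; apply/ffunP => i; have := e i; rewrite !ffunE.
exact: addnI.
Qed.

Definition splitting m l (p : mor L * mor L) :=
  [/\ src p.1 = rng p.2, l = kcomp p.1 p.2 & deg p.1 = m].

(** When [m] is below the degree of [l], unique factorisation determines this
    choice. *)
Definition factors m l : mor L * mor L := xget (l, l) [set p | splitting m l p].
Definition pre m l := (factors m l).1.
Definition suf m l := (factors m l).2.

Lemma splitting_uniq m l p p' : splitting m l p -> splitting m l p' -> p = p'.
Proof.
move=> [pc lp pm] [pc' lp' pm'].
have lE : deg l = m + deg p.2 by rewrite lp deg_kcomp // pm.
have lE' : deg l = m + deg p'.2 by rewrite lp' deg_kcomp // pm'.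
have p2 : deg p'.2 = deg p.2 by apply: (@degree_addI m); rewrite -lE -lE'.
by have [u [_ uP]] := factorisation lE; rewrite -(uP p) // -(uP p').
Qed.

Lemma factorsP m d l : deg l = m + d ->
  [/\ src (pre m l) = rng (suf m l), l = kcomp (pre m l) (suf m l),
      deg (pre m l) = m & deg (suf m l) = d].
Proof.
move=> lE; have [p [[pc lp pm pd] _]] := factorisation lE.
have [c e dm] : splitting m l (factors m l).
  by rewrite /factors; case: xgetP => [p' _ //|/(_ p)]; case.
split=> //; apply: (@degree_addI m).
by rewrite -lE [in RHS]e deg_kcomp // dm.
Qed.

Lemma factors_kcomp a b : src a = rng b ->
  pre (deg a) (kcomp a b) = a /\ suf (deg a) (kcomp a b) = b.
Proof.
move=> ab; have sp : splitting (deg a) (kcomp a b) (a, b) by [].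
suff : factors (deg a) (kcomp a b) = (a, b) by rewrite /pre /suf => ->.
rewrite /factors; case: xgetP => [p _ pP|/(_ (a, b))/(_ sp)//].
exact: splitting_uniq pP sp.
Qed.

Lemma pre_kcomp a b : src a = rng b -> pre (deg a) (kcomp a b) = a.
Proof. by move=> /factors_kcomp[]. Qed.

Lemma suf_kcomp a b : src a = rng b -> suf (deg a) (kcomp a b) = b.
Proof. by move=> /factors_kcomp[]. Qed.

Lemma rng_pre m d l : deg l = m + d -> rng (pre m l) = rng l.
Proof. by move=> /factorsP[c e _ _]; rewrite [in RHS]e rng_kcomp. Qed.

Lemma pre_kcompl m d a b : src a = rng b -> deg a = m + d ->
  pre m (kcomp a b) = pre m a.
Proof.
move=> ab aE; have [c e dm _] := factorsP aE.
have sb : src (suf m a) = rng b by rewrite -ab [in RHS]e src_kcomp.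
rewrite {1}e -kcompA // -{1}dm pre_kcomp //.
by rewrite rng_kcomp.
Qed.

Lemma pre_pre m d d' l : deg l = m + d + d' -> pre m (pre (m + d) l) = pre m l.
Proof.
move=> lE; have [c e dm _] := factorsP lE.
by rewrite [in RHS]e (pre_kcompl (d := d)).
Qed.

(** An infinite path is given by its initial segments of all degrees. *)
Definition infinite_path (x : degree -> mor L) :=
  (forall n, deg (x n) = n) /\ forall n d, pre n (x (n + d)) = x n.

Definition path_pred : {pred degree -> mor L} := fun x => `[< infinite_path x >].
Definition ipath : Type := {x : degree -> mor L | x \in path_pred}.
HB.instance Definition _ := Choice.on ipath.

Definition ival (x : ipath) : degree -> mor L := \val x.
Coercion ival : ipath >-> Funclass.
Implicit Types x y : ipath.

Lemma ipath_eq x y : (forall n, x n = y n) -> x = y.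
Proof. by move=> xy; apply: val_inj; apply/funext. Qed.

Lemma deg_ipath x n : deg (x n) = n.
Proof. by have /asboolP[] := valP x. Qed.

Lemma pre_ipath x n d : pre n (x (n + d)) = x n.
Proof. by have /asboolP[_] := valP x. Qed.

Lemma ipath_split x n d :
  [/\ src (x n) = rng (suf n (x (n + d))), x (n + d) = kcomp (x n) (suf n (x (n + d))) &
      deg (suf n (x (n + d))) = d].
Proof.
by have [] := factorsP (deg_ipath x (n + d)); rewrite pre_ipath.
Qed.

Definition irng x : ob L := rng (x 0).

Lemma rng_ipath x n : rng (x n) = irng x.
Proof. by have [c e _] := ipath_split x 0 n; rewrite add0r in c e; rewrite e rng_kcomp. Qed.

Definition prepend_fun l x : degree -> mor L := fun n => pre n (kcomp l (x n)).

Lemma deg_kcomp_ipath l x n : src l = irng x -> deg (kcomp l (x n)) = n + deg l.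
Proof. by move=> lx; rewrite deg_kcomp ?rng_ipath // deg_ipath addrC. Qed.

Lemma kcomp_ipathD l x n d : src l = irng x ->
  exists2 e, src (kcomp l (x n)) = rng e & kcomp l (x (n + d)) = kcomp (kcomp l (x n)) e.
Proof.
move=> lx; have [c e _] := ipath_split x n d; exists (suf n (x (n + d))).
  by rewrite src_kcomp ?rng_ipath.
by rewrite [in LHS]e kcompA // rng_ipath.
Qed.

Lemma prepend_subproof l x : src l = irng x -> prepend_fun l x \in path_pred.
Proof.
move=> lx; apply/asboolP; split=> [n|n d].
  by have [] := factorsP (deg_kcomp_ipath n lx).
rewrite /prepend_fun (@pre_pre n d (deg l)) ?deg_kcomp_ipath //.
have [e ce ->] := kcomp_ipathD n d lx.
by rewrite (pre_kcompl (d := deg l)) // deg_kcomp_ipath.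
Qed.

Definition prepend l x : option ipath :=
  match pselect (src l = irng x) with
  | left lx => Some (exist (fun z => z \in path_pred) (prepend_fun l x) (prepend_subproof lx))
  | right _ => None
  end.

Lemma prepend_some l x : src l = irng x -> exists2 y, prepend l x = Some y &
  forall n, y n = pre n (kcomp l (x n)).
Proof.
move=> lx; rewrite /prepend; case: pselect => // lx'.
by exists (exist (fun z => z \in path_pred) (prepend_fun l x) (prepend_subproof lx')).
Qed.

Lemma prepend_none l x : src l <> irng x -> prepend l x = None.
Proof. by move=> lx; rewrite /prepend; case: pselect. Qed.

Lemma shift_subproof m x : (fun n => suf m (x (m + n))) \in path_pred.
Proof.
apply/asboolP; split=> [n|n d]; first by have [] := ipath_split x m n.
have [c e _] := ipath_split x (m + n) d; have [c' e' de] := ipath_split x m n.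
set b := suf m (x (m + n)) in c' e' de *; set w := suf (m + n) _ in c e.
have bw : src b = rng w by rewrite -c e' src_kcomp.
have -> : suf m (x (m + (n + d))) = kcomp b w.
  rewrite addrA e [in X in kcomp X _]e' -kcompA // -{1}(deg_ipath x m).
  by rewrite suf_kcomp // rng_kcomp.
by rewrite -{1}de pre_kcomp.
Qed.

Definition shift m x : ipath :=
  exist (fun z => z \in path_pred) _ (shift_subproof m x).

Lemma shiftE m x n : shift m x n = suf m (x (m + n)).
Proof. by []. Qed.

Lemma irng_shift m x : irng (shift m x) = src (x m).
Proof. by rewrite /irng shiftE; have [-> _ _] := ipath_split x m 0. Qed.

Definition unprepend l y : option ipath :=
  if y (deg l) == l then Some (shift (deg l) y) else None.

Lemma irng_prepend l x y : prepend l x = Some y -> src l = irng x /\ irng y = rng l.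
Proof.
have [lx|lx] := pselect (src l = irng x); last by rewrite prepend_none.
have [y' -> yE] := prepend_some lx => -[<-]; split=> //.
by rewrite /irng yE (rng_pre (deg_kcomp_ipath 0 lx)) rng_kcomp // rng_ipath.
Qed.

Lemma prependK l x y : prepend l x = Some y <-> unprepend l y = Some x.
Proof.
rewrite /unprepend; split=> [pxy|].
  have [lx _] := irng_prepend pxy; have [y' e yE] := prepend_some lx.
  move: pxy; rewrite e => -[yy]; rewrite -{}yy {y}.
  have yl : y' (deg l) = l by rewrite yE pre_kcomp // rng_ipath.
  rewrite yl eqxx; congr Some; apply: ipath_eq => n.
  rewrite shiftE yE; have [w cw ew] := kcomp_ipathD n (deg l) lx.
  rewrite addrC ew -{1}(deg_kcomp_ipath n lx) pre_kcomp //.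
  by rewrite suf_kcomp // rng_ipath.
case: eqP => // yl [<-]; have lx : src l = irng (shift (deg l) y).
  by rewrite irng_shift yl.
have [y' -> yE] := prepend_some lx; congr Some; apply: ipath_eq => n.
have [_ e _] := ipath_split y (deg l) n; rewrite yl in e.
by rewrite yE shiftE -e addrC pre_ipath.
Qed.

Definition path_bijection l : partial_bijection ipath := PartialBijection (@prependK l).

Lemma prepend_kcomp l l' x : src l = rng l' ->
  prepend (kcomp l l') x = obind (prepend l) (prepend l' x).
Proof.
move=> lm; have [mx|mx] := pselect (src l' = irng x); last first.
  by rewrite !prepend_none // src_kcomp.
have [y py yE] := prepend_some mx; rewrite py /=.
have [_ ry] := irng_prepend py.
have ly : src l = irng y by rewrite ry.
have [z -> zE] := prepend_some ly.
have lmx : src (kcomp l l') = irng x by rewrite src_kcomp.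
have [z' -> zE'] := prepend_some lmx; congr Some; apply: ipath_eq => n.
rewrite zE zE' -kcompA ?rng_ipath //.
have [c e dn _] := factorsP (deg_kcomp_ipath n mx); rewrite -yE in c e dn.
rewrite {1}e kcompA ?rng_ipath // (pre_kcompl (d := deg l)) //.
  by rewrite src_kcomp ?rng_ipath.
exact: deg_kcomp_ipath.
Qed.

(** Without sources a path can be prolonged indefinitely in all directions, and
    an infinite path is read off from the initial segments. *)
Lemma ipath_exists v : exists x, irng x = v.
Proof.
pose one : degree := [ffun=> 1%N].
have ext (w : mor L) : exists e, src w = rng e /\ deg e = one.
  by have [_ [e [de re]]] := hL one (src w); exists e.
have [next nextP] := choice ext.
pose w j := iter j (fun w => kcomp w (next w)) (idm L v).
pose cst j : degree := [ffun=> j].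
have deg_w j : deg (w j) = cst j.
  elim: j => [|j IH]; first by rewrite deg_idm; apply/ffunP => i; rewrite !ffunE.
  have [c dn] := nextP (w j); rewrite /w iterS -/(w j) deg_kcomp // IH dn.
  by apply/ffunP => i; rewrite !ffunE [LHS]addn1.
have cstD n j : (\sum_i n i <= j)%N -> exists d, cst j = n + d.
  move=> nj; exists [ffun i => (j - n i)%N]; apply/ffunP => i; rewrite !ffunE.
  apply/esym/subnKC; apply: leq_trans nj.
  by rewrite (bigD1 i) //= leq_addr.
have pre_w n j j' : (\sum_i n i <= j)%N -> (j <= j')%N -> pre n (w j') = pre n (w j).
  move=> nj /subnK <-; elim: (j' - j)%N => // i IH; rewrite addSn.
  have [c _] := nextP (w (i + j)%N); rewrite [w _.+1]iterS -/(w (i + j)%N) -IH.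
  have [|d dE] := cstD n (i + j)%N; first by rewrite (leq_trans nj) ?leq_addl.
  by rewrite (pre_kcompl (d := d)) // deg_w.
have xP : (fun n => pre n (w (\sum_i n i)%N)) \in path_pred.
  apply/asboolP; split=> [n|n d].
    have [d dE] := cstD n _ (leqnn _).
    by have [] := factorsP (etrans (deg_w _) dE).
  have le_nd : (\sum_i n i <= \sum_i (n + d)%R i)%N.
    by apply: leq_sum => i _; rewrite ffunE leq_addr.
  have [d' dE] := cstD (n + d) _ (leqnn _).
  by rewrite (@pre_pre n d d') ?deg_w // (pre_w _ _ _ (leqnn _) le_nd).
exists (exist (fun z => z \in path_pred) _ xP); rewrite /irng /ival /=.
have -> : (\sum_(i < k) (0%R : degree) i = 0)%N by rewrite big1 // => i _; rewrite ffunE.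
by rewrite (@rng_pre 0 0) ?rng_idm // addr0 deg_idm.
Qed.

(** The operators of the partial bijections [x |-> l x] on the square-summable
    functions of infinite paths form a Cuntz-Krieger family: every path [y]
    extends exactly one path of each degree, its initial segment [y n].  The
    vertex projection of [v] fixes the delta function of a path with range [v]. *)
Lemma ck_family_nonzero (R : realType) (v : ob L) :
  exists (B : cstarAlgType R) (t : mor L -> B),
    ck_family t /\ t (idm L v) <> 0.
Proof.
pose t l : bop (l2space R ipath) := pop R (path_bijection l).
have unprepend_idm w y :
    unprepend (idm L w) y = if irng y == w then Some y else None.
  have [u yu] : exists u, y 0 = idm L u by apply/deg_eq0; rewrite deg_ipath.
  have ry : irng y = u by rewrite /irng yu rng_idm.
  have sh : shift 0 y = y.
    apply: ipath_eq => n; rewrite shiftE add0r.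
    have [c e _] := ipath_split y 0 n; rewrite add0r in c e.
    by rewrite [in RHS]e yu; rewrite yu src_idm in c; rewrite c kcomp_idl.
  rewrite /unprepend deg_idm sh yu ry; congr (if _ then _ else _).
  apply/eqP/eqP => [uw|->//].
  by have := congr1 (@rng _ L) uw; rewrite !rng_idm.
have vertexE w f y : l2val (t (idm L w) f) y = if irng y == w then l2val f y else 0.
  by rewrite popE /= unprepend_idm; case: ifP.
have vertex_range w : t (idm L w) = t (idm L w) ** (t (idm L w))^#*.
  apply: bop_eq => f; apply: l2_eq => y.
  by rewrite vertexE pop_range /= unprepend_idm; case: ifP.
exists (bop (l2space R ipath)), t; split; last first.
  have [x xv] := ipath_exists v => t0.
  have := vertexE v (l2delta R x) x; rewrite t0 xv eqxx.
  rewrite [RHS]/(l2delta_fun R x x) /l2delta_fun eqxx => /esym/eqP.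
  by rewrite oner_eq0.
split.
- by move=> l; apply: pop_isometry.
- move=> w; split; last by rewrite vertex_range cadjM cadjK.
  apply: bop_eq => f; apply: l2_eq => y.
  by rewrite bop_mulE !vertexE; case: (irng y == w).
- move=> w w' ww; apply: bop_eq => f; apply: l2_eq => y.
  rewrite bop_mulE !vertexE; by case: eqP => [->|//]; case: eqP.
- by move=> l l' ll; apply: pop_mul => x; apply: prepend_kcomp.
- move=> l; apply: bop_eq => f; apply: l2_eq => x.
  rewrite pop_source vertexE /=; case: eqP => [e|ne].
    by have [y -> _] := prepend_some (esym e).
  by rewrite prepend_none // => e; case: ne.
move=> w n; have [fin _] := hL n w.
rewrite fsbig_finite //; apply: bop_eq => f; apply: l2_eq => y.
rewrite vertexE l2val_sum -/(path_seq n w).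
have -> : \sum_(l <- path_seq n w)
      l2val ((t l ** (t l)^#* : bop (l2space R ipath)) f) y =
    \sum_(l <- path_seq n w) if ival y n == l then l2val f y else 0.
  apply: eq_big_seq => l; rewrite path_seqP // => /andP[/eqP ln _].
  by rewrite pop_range /= /unprepend ln; case: ifP.
have ynP : (ival y n \in path_seq n w) = (irng y == w).
  by rewrite path_seqP // deg_ipath eqxx rng_ipath.
case: ifP => yw; rewrite yw in ynP.
  rewrite (bigD1_seq (ival y n)) ?path_seq_uniq //= eqxx big1 ?addr0 // => l ly.
  by rewrite eq_sym (negbTE ly).
rewrite big1_seq // => l /andP[_ lw]; case: eqP => // e.
by rewrite -e ynP in lw.
Qed.

End InfinitePaths.

(** * The theorem *)

Theorem theorem3p4 (R : realType) (k : nat) (hk : (1 <= k)%N)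
    (L : kgraph k) (hL : row_finite_no_sources L)
    (A : cstarAlgType R) (s : mor L -> A) (hA : universal_ck s)
    (alpha : torus_action k A) (halpha : gauge_action s alpha)
    (B : cstarAlgType R) (pi : A -> B) (hpi : star_hom pi)
    (beta : torus_action k B)
    (hbeta : forall (t : torus R k) (a : A), pi (alpha t a) = beta t (pi a)) :
  injective pi <->
    forall v : ob L, pi (s (idm L v) ** (s (idm L v))^#*) <> 0.
Proof.
have vertex (C : cstarAlgType R) (t : mor L -> C) v : ck_family t ->
    t (idm L v) ** (t (idm L v))^#* = t (idm L v).
  by move=> tCK; have [pp ->] := ck_proj tCK v.
have sCK := univ_family hA; split=> [pi_inj v|pi_neq0].
  rewrite vertex // -(star_hom0 hpi) => /pi_inj sv0.
  have [C [t [tCK tv]]] := ck_family_nonzero hL R v.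
  have [f [hf fs]] := univ_map hA tCK.
  by apply: tv; rewrite -fs sv0 (star_hom0 hf).
apply: (gauge_invariant_uniqueness hL hA halpha hpi hbeta) => v.
by rewrite -(vertex _ _ v sCK).
Qed.
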